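(* Let $V$ be a $G$-symplectic representation and let $h: V \to \mathbb{R}$ be a smooth $G$-invariant Hamiltonian function with $\mathrm{d}h(0) = 0$ such that (GC) and (NR') hold for $h$. If $\xi \in \mathfrak{t}$ and $V_0 := \ker \mathrm{d}^2(h - \mathbf{J}^\xi)(0)$ has linearly independent weights, then there is a neighborhood $U$ of $0$ in $V_0$ and a local map $m_{V_0}: U \to V$ such that $M_0 := m_{V_0}(U)$ is a manifold of $T$-relative equilibria with $0 \in M_0$, $T_0 M_0 = V_0$, and $G_{m_{V_0}(x)} = G_x$ for every $x \in U$.
   Context: $G$ is a compact connected Lie group with Lie algebra $\mathfrak{g}$, and $T \subset G$ is a fixed maximal torus with Lie algebra $\mathfrak{t}$. $G_p$ denotes the isotropy subgroup of a point $p$. An integral form is an $\alpha\in\mathfrak{t}^*$ with $\alpha(\ker(\exp:\mathfrak{t}\to T))\subset\mathbb{Z}$; $\mathbb{C}_\alpha$ is the complex $T$-representation on $\mathbb{C}$ in which $\exp(\xi)$ acts by $e^{2\pi i \alpha(\xi)}$. The weights of a complex representation are the $\alpha$ for which $\mathbb{C}_\alpha$ occurs, counted with multiplicity (so linear independence of the weights forces multiplicity 1). A $G$-symplectic representation is a finite-dimensional real $G$-representation $V$ with a $G$-invariant symplectic form $\omega$. The Hamiltonian vector field $X_h$ is given by $\mathrm{d}h(x)=\omega(X_h(x),\cdot)$. The momentum map $\mathbf{J}:V\to\mathfrak{g}^*$ is the equivariant map with $\mathbf{J}(0)=0$ and $\langle \mathrm{d}\mathbf{J}(x)v,\xi\rangle=\omega(\xi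 x,v)$; $\mathbf{J}^\xi(x)=\langle\mathbf{J}(x),\xi\rangle$ is a quadratic form. A $T$-relative equilibrium is a point $x$ that is a critical point of $h-\mathbf{J}^\xi$ for some $\xi\in\mathfrak{t}$ (then $\xi$ is called a generator); equivalently the orbit $Tx$ is $X_h$-invariant. The center space $V^c$ is the sum of the generalized eigenspaces of $\mathrm{d}X_h(0)$ for eigenvalues with real part $0$. (GC): $\mathrm{d}X_h(0)$ is non-degenerate and $V^c$ splits into irreducible $G$-symplectic subrepresentations (no proper non-trivial $G$-symplectic subrepresentations) that coincide with the eigenspaces $U_i$ of $\mathrm{d}^2h(0)|_{V^c}$. Here a $G$-invariant inner product on $V$ is fixed with $\omega=\langle\cdot,J\cdot\rangle$, where $J$ restricts to a $G$-equivariant complex structure on $V^c$ commuting with $\mathrm{d}X_h(0)|_{V^c}$; $\mathrm{d}^2h(0)$ is regarded as a symmetric endomorphism via this inner product, and $V^c$ is regarded as a complex $G$-representation via $J$. Every $\ker \mathrm{d}^2(h-\mathbf{J}^\xi)(0)$ with $\xi\in\mathfrak{t}$ is a complex $T$-subrepresentation of $V^c$, and its weights are its weights as such. A union $S=\bigcup_{i=1}^n S_i$ of subsets $S_i\subset\mathfrak{t}^*$ is full if for every $(c_1,\dots,c_n)\in\mathbb{R}^n$ there is $x\in\mathfrak{t}$ with $\alpha(x)=c_i$ for all $i$ and all $\alpha\in S_i$. (NR') (for $h$ satisfying (GC)): for each union $S=\bigcup_i S_i$ of sets $S_i$ of linearly independent weights of the eigenspaces $U_i$, with $c_i$ the eigenvalue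 of $\mathrm{d}^2h(0)|_{V^c}$ on $U_i$, there is $\xi\in\mathfrak{t}$ with $\alpha(\xi)=c_i$ for all $i$ and all $\alpha\in S_i$ if and only if $S$ is full. *)

(* Defs.v *)
From HB Require Import structures.
From mathcomp Require Import all_boot all_order all_algebra.
From mathcomp Require Import complex.
From mathcomp Require Import all_classical all_reals all_analysis.

Set Implicit Arguments.
Unset Strict Implicit.
Unset Printing Implicit Defensive.

Import Order.TTheory GRing.Theory Num.Theory.
Import numFieldNormedType.Exports.

Local Open Scope classical_set_scope.
Local Open Scope ring_scope.

Fixpoint Ck_on (R : realType) (V W : normedModType R) (k : nat) (O : set V)
    (f : V -> W) : Prop :=
  match k with
  | 0%N => forall x, O x -> {for x, continuous f}
  | k'.+1 => (forall x, O x -> differentiable f x) /\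
             forall v : V, Ck_on k' O (fun x => 'D_v f x)
  end.

(** On an open set this is C^infinity; on an arbitrary set, smoothness means, as
    usual, that locally there is a smooth extension to an open set. *)
Definition smooth_on (R : realType) (V W : normedModType R) (A : set V)
    (f : V -> W) : Prop :=
  forall x, A x -> exists (O : set V) (g : V -> W),
    [/\ open O, O x, forall k, Ck_on k O g & {in A `&` O, f =1 g}].

Definition d2 (R : realType) (V : normedModType R) (f : V -> R) (x u v : V) : R :=
  'D_u (fun y => 'D_v f y : R^o) x.

Definition submanifold_dim (R : realType) (n d : nat) (M : set 'rV[R]_n) : Prop :=
  forall p, M p ->
  exists (W W' : set 'rV[R]_n) (phi psi : 'rV[R]_n -> 'rV[R]_n)
         (E : {vspace 'rV[R]_n}),
  [/\ [/\ open W, W p & open W'],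
      smooth_on W phi /\ smooth_on W' psi,
      (forall y, W y -> W' (phi y) /\ psi (phi y) = y) /\
      (forall z, W' z -> W (psi z) /\ phi (psi z) = z) ,
      \dim E = d &
      forall y, W y -> (M y <-> phi y \in E)].

Definition submanifold (R : realType) (n : nat) (M : set 'rV[R]_n) : Prop :=
  exists d, submanifold_dim d M.

Definition tangent_space (R : realType) (n : nat) (M : set 'rV[R]_n)
    (p : 'rV[R]_n) : set 'rV[R]_n :=
  [set v | exists (e : R) (gamma : R -> 'rV[R]_n),
    [/\ 0 < e, smooth_on `]- e, e[ (gamma : R^o -> 'rV[R]_n), gamma 0 = p,
        (forall s, s \in `]- e, e[ -> M (gamma s)) & v = derive1 gamma 0]].

#[short(type="topGroupType")]
HB.structure Definition TopGroup := {G of Topological G & Group G}.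

Record chart (R : realType) (d : nat) (G : topologicalType) := Chart {
  chart_dom : set G;
  chart_map : G -> 'rV[R]_d;
  chart_inv : 'rV[R]_d -> G;
  chart_dom_open : open chart_dom;
  chart_img_open : open (chart_map @` chart_dom);
  chart_mapK : {in chart_dom, cancel chart_map chart_inv};
  chart_map_cont : {in chart_dom, continuous chart_map};
  chart_inv_cont : {in chart_map @` chart_dom, continuous chart_inv}
}.

Definition smooth_atlas (R : realType) (d : nat) (G : topologicalType)
    (A : set (chart R d G)) : Prop :=
  (forall g : G, exists2 a, A a & chart_dom a g) /\
  (forall a b, A a -> A b ->
    smooth_on (chart_map a @` (chart_dom a `&` chart_dom b))
              (chart_map b \o chart_inv a)).

Definition smooth_mul (R : realType) (d : nat) (G : topGroupType)
    (A : set (chart R d G)) : Prop :=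
  continuous (fun p : G * G => (p.1 * p.2)%g) /\
  forall a b c, A a -> A b -> A c ->
    smooth_on
      [set z : 'rV[R]_(d + d) |
        exists g h, [/\ chart_dom a g, chart_dom b h, chart_dom c (g * h)%g &
                        z = row_mx (chart_map a g) (chart_map b h)]]
      (fun z => chart_map c (chart_inv a (lsubmx z) * chart_inv b (rsubmx z))%g).

Definition smooth_inv (R : realType) (d : nat) (G : topGroupType)
    (A : set (chart R d G)) : Prop :=
  continuous (fun g : G => g^-1%g) /\
  forall a b, A a -> A b ->
    smooth_on (chart_map a @` [set g | chart_dom a g /\ chart_dom b g^-1%g])
              (fun z => chart_map b (chart_inv a z)^-1%g).

(** A smooth structure making a topological group a Lie group is unique, so
    being a Lie group is a property. *)
Definition lie_group (R : realType) (G : topGroupType) : Prop :=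
  [/\ hausdorff_space G, @second_countable G &
      exists (d : nat) (A : set (chart R d G)),
        [/\ smooth_atlas A, smooth_mul A & smooth_inv A]].

(** [T] is a subgroup isomorphic to R^k / Z^k. *)
Definition torus (R : realType) (G : topGroupType) (T : set G) : Prop :=
  exists (k : nat) (E : 'rV[R]_k -> G),
    [/\ continuous E,
        (forall x y, E (x + y) = (E x * E y)%g),
        range E = T &
        forall x, E x = 1%g <-> forall i, x 0 i \is a Num.int].

Definition maximal_torus (R : realType) (G : topGroupType) (T : set G) : Prop :=
  torus R T /\ forall T' : set G, torus R T' -> T `<=` T' -> T' = T.

(** Elements of the Lie algebra of a closed subgroup [K] are identified with
    the one-parameter subgroups of [K], [xi] corresponding to
    [s |-> exp (s xi)]. *)
Definition one_param (R : realType) (G : topGroupType) (K : set G) :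
    set (R -> G) :=
  [set gamma | [/\ continuous gamma,
                   (forall s s', gamma (s + s') = (gamma s * gamma s')%g) &
                   forall s, K (gamma s)]].

Definition exp_line (R : realType) (G : topGroupType) (t : vectType R)
    (exp : t -> G) (xi : t) : R -> G := fun s => exp (s *: xi).

(** [t] is the Lie algebra of the torus [T], with exponential map [exp]:
    [xi |-> exp_line exp xi] is a linear isomorphism onto the one-parameter
    subgroups of [T], whose sum is the pointwise product as [T] is abelian. *)
Definition lie_algebra_exp (R : realType) (G : topGroupType) (T : set G)
    (t : vectType R) (exp : t -> G) : Prop :=
  [/\ (forall xi eta, exp (xi + eta) = (exp xi * exp eta)%g),
      (forall xi, one_param T (exp_line exp xi)),
      injective (exp_line exp) &
      forall gamma, one_param T gamma -> exists xi, gamma = exp_line exp xi].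

Definition representation (R : realType) (G : topGroupType) (n : nat)
    (act : G -> 'rV[R]_n -> 'rV[R]_n) : Prop :=
  [/\ (forall g, linear (act g)),
      (forall x, act 1%g x = x),
      (forall g h x, act (g * h)%g x = act g (act h x)) &
      continuous (fun p : G * 'rV[R]_n => act p.1 p.2)].

Definition isotropy (R : realType) (G : topGroupType) (n : nat)
    (act : G -> 'rV[R]_n -> 'rV[R]_n) (x : 'rV[R]_n) : set G :=
  [set g | act g x = x].

Definition invariant_form (R : realType) (G : topGroupType) (n : nat)
    (act : G -> 'rV[R]_n -> 'rV[R]_n) (b : 'rV[R]_n -> 'rV[R]_n -> R) : Prop :=
  [/\ (forall y, scalar (b ^~ y)), (forall x, scalar (b x)) &
      forall g x y, b (act g x) (act g y) = b x y].

Definition symplectic_form (R : realType) (G : topGroupType) (n : nat)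
    (act : G -> 'rV[R]_n -> 'rV[R]_n)
    (omega : 'rV[R]_n -> 'rV[R]_n -> R) : Prop :=
  [/\ invariant_form act omega, (forall x, omega x x = 0) &
      forall x, (forall y, omega x y = 0) -> x = 0].

Definition inner_product (R : realType) (G : topGroupType) (n : nat)
    (act : G -> 'rV[R]_n -> 'rV[R]_n)
    (ip : 'rV[R]_n -> 'rV[R]_n -> R) : Prop :=
  [/\ invariant_form act ip, (forall x y, ip x y = ip y x) &
      forall x, x != 0 -> 0 < ip x x].

Definition symplectic_subrep (R : realType) (G : topGroupType) (n : nat)
    (act : G -> 'rV[R]_n -> 'rV[R]_n) (omega : 'rV[R]_n -> 'rV[R]_n -> R)
    (W : {vspace 'rV[R]_n}) : Prop :=
  (forall g x, x \in W -> act g x \in W) /\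
  (forall x, x \in W -> (forall y, y \in W -> omega x y = 0) -> x = 0).

Definition irreducible_symplectic (R : realType) (G : topGroupType) (n : nat)
    (act : G -> 'rV[R]_n -> 'rV[R]_n) (omega : 'rV[R]_n -> 'rV[R]_n -> R)
    (W : {vspace 'rV[R]_n}) : Prop :=
  [/\ symplectic_subrep act omega W, W != 0%VS &
      forall W' : {vspace 'rV[R]_n}, (W' <= W)%VS ->
        symplectic_subrep act omega W' -> W' = 0%VS \/ W' = W].

Definition hamiltonian_vf (R : realType) (n : nat)
    (omega : 'rV[R]_n -> 'rV[R]_n -> R) (h : 'rV[R]_n -> R)
    (X : 'rV[R]_n -> 'rV[R]_n) : Prop :=
  forall x v, 'd (h : 'rV[R]_n -> R^o) x v = omega (X x) v.

(** [xi x], for [xi] the one-parameter subgroup [gamma]. *)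
Definition inf_act (R : realType) (G : topGroupType) (n : nat)
    (act : G -> 'rV[R]_n -> 'rV[R]_n) (gamma : R -> G) (x : 'rV[R]_n) :
    'rV[R]_n :=
  derive1 (fun s : R => act (gamma s) x) 0.

(** [Jm x gamma] is the pairing of [J(x)] with [gamma] in the Lie algebra of
    [G]; conjugation of one-parameter subgroups is the adjoint action. *)
Definition momentum_map (R : realType) (G : topGroupType) (n : nat)
    (act : G -> 'rV[R]_n -> 'rV[R]_n) (omega : 'rV[R]_n -> 'rV[R]_n -> R)
    (Jm : 'rV[R]_n -> (R -> G) -> R) : Prop :=
  forall gamma, one_param [set: G] gamma ->
  [/\ Jm 0 gamma = 0,
      (forall x, differentiable (Jm ^~ gamma : 'rV[R]_n -> R^o) x),
      (forall x v, 'd (Jm ^~ gamma : 'rV[R]_n -> R^o) x v =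
                   omega (inf_act act gamma x) v) &
      forall g x, Jm (act g x) gamma = Jm x (fun s => g^-1 * gamma s * g)%g].

Definition augmented (R : realType) (G : topGroupType) (n : nat)
    (t : vectType R) (exp : t -> G) (Jm : 'rV[R]_n -> (R -> G) -> R)
    (h : 'rV[R]_n -> R) (xi : t) : 'rV[R]_n -> R :=
  fun x => h x - Jm x (exp_line exp xi).

Definition T_relative_equilibrium (R : realType) (G : topGroupType) (n : nat)
    (t : vectType R) (exp : t -> G) (Jm : 'rV[R]_n -> (R -> G) -> R)
    (h : 'rV[R]_n -> R) (x : 'rV[R]_n) : Prop :=
  exists xi : t, forall v : 'rV[R]_n,
    'd (augmented exp Jm h xi : 'rV[R]_n -> R^o) x v = 0.


(** The dual of [t] is ['Hom(t, R^o)]. *)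
Definition integral_form (R : realType) (G : topGroupType) (t : vectType R)
    (exp : t -> G) (alpha : 'Hom(t, R^o)) : Prop :=
  forall xi, exp xi = 1%g -> (alpha xi : R) \is a Num.int.

(** [exp xi] acts on [v] by [e^(2 pi i alpha(xi))], [i] acting by [J]. *)
Definition weight_vector (R : realType) (G : topGroupType) (n : nat)
    (act : G -> 'rV[R]_n -> 'rV[R]_n) (t : vectType R) (exp : t -> G)
    (J : 'End('rV[R]_n)) (alpha : 'Hom(t, R^o)) (v : 'rV[R]_n) : Prop :=
  forall xi, act (exp xi) v =
    cos (2 * pi * (alpha xi : R)) *: v + sin (2 * pi * (alpha xi : R)) *: J v.

Definition weight (R : realType) (G : topGroupType) (n : nat)
    (act : G -> 'rV[R]_n -> 'rV[R]_n) (t : vectType R) (exp : t -> G)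
    (J : 'End('rV[R]_n)) (W : {vspace 'rV[R]_n}) (alpha : 'Hom(t, R^o)) : Prop :=
  integral_form exp alpha /\
  exists v, [/\ v \in W, v != 0 & weight_vector act exp J alpha v].

(** [s] lists the weights of [W] with multiplicity: [W] is the direct sum of
    the complex lines spanned by [v_i], isomorphic to [C_alpha] for [alpha] the
    [i]-th entry of [s]. *)
Definition weights_with_mult (R : realType) (G : topGroupType) (n : nat)
    (act : G -> 'rV[R]_n -> 'rV[R]_n) (t : vectType R) (exp : t -> G)
    (J : 'End('rV[R]_n)) (W : {vspace 'rV[R]_n})
    (s : seq 'Hom(t, R^o)) : Prop :=
  exists v : seq 'rV[R]_n,
  [/\ size v = size s,
      basis_of W (v ++ map J v) &
      forall i, (i < size s)%N ->
        integral_form exp s`_i /\ weight_vector act exp J s`_i v`_i].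

Definition full (R : realType) (t : vectType R) (r : nat)
    (S : 'I_r -> seq 'Hom(t, R^o)) : Prop :=
  forall c : 'I_r -> R, exists x : t,
    forall i alpha, alpha \in S i -> alpha x = c i.

(** Real points of the sum of the generalized eigenspaces of the
    complexification of [A], acting on row vectors, for eigenvalues with real
    part 0. *)
Definition center_space (R : realType) (n : nat) (A : 'M[R]_n) :
    set 'rV[R]_n :=
  [set x | exists2 s : seq R[i], (forall l, l \in s -> complex.Re l = 0) &
    (map_mx (real_complex R) x <=
      \sum_(l <- s) geigenspace (map_mx (real_complex R) A) l)%MS].

Record GC (R : realType) (G : topGroupType) (n : nat)
    (act : G -> 'rV[R]_n -> 'rV[R]_n)
    (omega ip : 'rV[R]_n -> 'rV[R]_n -> R) (h : 'rV[R]_n -> R)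
    (X : 'rV[R]_n -> 'rV[R]_n) (J H : 'End('rV[R]_n))
    (Vc : {vspace 'rV[R]_n}) (r : nat) (U : 'I_r -> {vspace 'rV[R]_n})
    (c : 'I_r -> R) : Prop := {
  GC_nondegenerate : forall x, 'd X 0 x = 0 -> x = 0;
  GC_center : forall x, x \in Vc <-> center_space (jacobian X 0) x;
  GC_inner_product : inner_product act ip;
  GC_omega : forall x y, omega x y = ip x (J y);
  GC_J_center : forall x, x \in Vc -> J x \in Vc;
  GC_J_complex : forall x, x \in Vc -> J (J x) = - x;
  GC_J_equivariant : forall g x, x \in Vc -> J (act g x) = act g (J x);
  GC_J_commutes : forall x, x \in Vc -> J ('d X 0 x) = 'd X 0 (J x);
  (* [H] is [d^2 h(0)] as a symmetric endomorphism *)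
  GC_H : forall u v, ip (H u) v = d2 h 0 u v;
  GC_c_inj : injective c;
  GC_eigenspace : forall i, U i = (Vc :&: passmx.leigenspace H (c i))%VS;
  GC_irreducible : forall i, irreducible_symplectic act omega (U i);
  GC_directv : directv (\sum_i U i);
  GC_split : Vc = (\sum_i U i)%VS
}.

Definition NR' (R : realType) (G : topGroupType) (n : nat)
    (act : G -> 'rV[R]_n -> 'rV[R]_n) (t : vectType R) (exp : t -> G)
    (J : 'End('rV[R]_n)) (r : nat) (U : 'I_r -> {vspace 'rV[R]_n})
    (c : 'I_r -> R) : Prop :=
  forall S : 'I_r -> seq 'Hom(t, R^o),
    (forall i, free (S i) /\
       forall alpha, alpha \in S i -> weight act exp J (U i) alpha) ->
    (exists xi : t, forall i alpha, alpha \in S i -> alpha xi = c i) <-> full S.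

(* Main.v *)
Require Import Defs.
From HB Require Import structures.
From mathcomp Require Import all_boot all_order all_algebra.
From mathcomp Require Import complex.
From mathcomp Require Import all_classical all_reals all_analysis.
From mathcomp Require Import ring lra.

Set Implicit Arguments.
Unset Strict Implicit.
Unset Printing Implicit Defensive.

Import Order.TTheory GRing.Theory Num.Theory.
Import numFieldNormedType.Exports.

Local Open Scope classical_set_scope.
Local Open Scope ring_scope.

(** Write [A] for the linearization of [X] at [0] and [zeta x] for the
    infinitesimal action of [zeta] in the Lie algebra of the torus. The gradient
    of [h - J^zeta] is the [omega]-dual of [X - zeta], so a relative equilibrium
    with generator [zeta] is a solution of [X y = zeta y], and [V0] is the kernel
    of [A - xi]. It is an orthogonal sum of planes spanned by weight vectors
    [v_j] and [J v_j]. Linear independence of the weights [alpha_j] yields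
    [eta_j] with [2 pi alpha_i(eta_j) = delta_ij] ([weight_generators]): the
    generators [zeta_l = xi + sum_j l_j eta_j] rotate the planes at frequencies
    that can be prescribed independently.

    The equation [X y = zeta_l y] is solved in two steps. Off the planes [A - xi]
    is invertible, so the implicit function theorem solves the component of the
    equation in the complement of [V0] by some [y = x + phi (x, l)], with [x] in
    [V0] ([complement_reduction]). The residual [r = X y - zeta_l y] then lies in
    [V0]. As [h] is invariant, both terms of [r] are [omega]-orthogonal to the
    orbit direction [eta_j y], which says that in each plane the component of [r]
    is orthogonal to that of [x] ([weights_radial]), hence a multiple of the
    rotated component. A division lemma ([division]) makes the factor
    [f_j (x, l) - l_j] smooth up to [x = 0]. What remains is the system
    [l_j = f_j (x, l)], one equation for each frequency, with [f_j (0, l) = 0],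
    and a second application of the implicit function theorem solves it for [l]
    ([planar_reduction]). The relative equilibria found are the graph over a ball
    of [V0] of a map whose differential vanishes at [0].

    For the isotropy groups, equivariance of the construction is not available,
    because the torus need not be normal in [G]. Instead, let [K] be the isotropy
    group of [x] and [V^K] the space of the vectors that it fixes. Compactness of
    [G] implies that [zeta] preserves [V^K] as soon as [zeta x] lies in [V^K]
    ([lie_act_isotropy]). This applies to [xi x = A x], as [A] is equivariant.
    The projection on [V0] preserves [V^K] because it is spectral
    ([plane_proj_stable]), so the iterations that define the implicit functions
    never leave [V^K], and [K] fixes [phi x]. Conversely, for the isotropy group
    [K] of [m x = x + phi x] the generator satisfies [zeta (m x) = X (m x)], which
    [K] fixes; again [V^K] is preserved by [zeta] and by the projection on [V0],
    which maps [m x] to [x]. *)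

(** * Linear maps, Frechet derivatives and C^k functions *)

Section Linear.
Variables (R : realType) (V W : normedModType R).
Lemma linear_rV_continuous n (f : {linear 'rV[R]_n -> W}) : continuous f.
Proof.
move=> x.
have -> : (f : 'rV[R]_n -> W) =
    \sum_(i < n) (fun y : 'rV[R]_n => (y 0 i : R) *: f (delta_mx 0 i)).
  apply/funext => y; rewrite fct_sumE {1}(row_sum_delta y) linear_sum.
  by apply: eq_bigr => i _; rewrite linearZ.
elim/big_ind: _ => [|g h Hg Hh|i _].
- exact: cst_continuous.
- exact: continuousD.
- apply: (@continuous_comp _ _ _ (fun y : 'rV[R]_n => y 0 i)
    (fun a : R => a *: f (delta_mx 0 i))).
    exact: coord_continuous.
  exact: scalel_continuous.
Qed.

Lemma linear_rV_differentiable n (f : {linear 'rV[R]_n -> W}) x :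
  differentiable f x.
Proof. exact/linear_differentiable/linear_rV_continuous. Qed.

Lemma derive_linear_rV n (f : {linear 'rV[R]_n -> W}) x v : 'D_v f x = f v.
Proof.
rewrite deriveE; last exact: linear_rV_differentiable.
by rewrite diff_lin //; exact: linear_rV_continuous.
Qed.

End Linear.

Section FrechetEps.
Variables (R : realType) (V W : normedModType R).

Lemma differentiable_eps (f : V -> W) x : differentiable f x ->
  forall e, 0 < e -> \forall y \near x,
    `|f y - f x - 'd f x (y - x)| <= e * `|y - x|.
Proof.
move=> /diff_locally /eqaddoP H e e0.
have := H e e0; rewrite -nbhs_nearE => {}H.
rewrite (near_shift 0 x); apply: filterS H => h /=.
rewrite !fctE /= subr0 addrK.
by rewrite opprD addrA.
Qed.

Lemma eps_differentiable (f : V -> W) x (L : {linear V -> W}) :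
  continuous L ->
  (forall e, 0 < e -> \forall y \near x,
    `|f y - f x - L (y - x)| <= e * `|y - x|) ->
  differentiable f x /\ 'd f x = L :> (V -> W).
Proof.
move=> cL H.
have E : f \o shift x = cst (f x) + L +o_ (nbhs (0 : V)) id.
  apply/eqaddoP => e e0; move: (H e e0); rewrite (near_shift 0 x).
  by apply: filterS => h /=; rewrite !fctE /= subr0 addrK opprD addrA.
have D : 'd f x = L :> (V -> W) by exact: diff_unique.
by split=> //; apply/diff_locallyP; rewrite D.
Qed.

Lemma near_eq_differentiable (f g : V -> W) x :
  {near x, f =1 g} -> differentiable f x -> differentiable g x.
Proof.
move=> fg df; have [] // := @eps_differentiable g x ('d f x).
  exact: diff_continuous.
move=> e e0; have := differentiable_eps df e0; move: fg (nbhs_singleton fg).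
move=> fg fgx; apply: filterS2 fg => y fgy; first by move=> H; rewrite -fgx -fgy; exact: H.
Qed.

End FrechetEps.

Section Ck.
Variables (R : realType) (V W : normedModType R).
Implicit Types (O : set V) (k : nat).

Lemma Ck_sub k O O' (f : V -> W) : O' `<=` O -> Ck_on k O f -> Ck_on k O' f.
Proof.
move=> sub; elim: k f => [|k IH] f /=; first by move=> H x /sub; exact: H.
by case=> H1 H2; split=> [x /sub|v]; [exact: H1|exact: IH].
Qed.

Lemma CkS k O (f : V -> W) : Ck_on k.+1 O f -> Ck_on k O f.
Proof.
elim: k f => [|k IH] f [H1 H2].
  by move=> x /H1; exact: differentiable_continuous.
by split=> // v; exact/IH/H2.
Qed.

Lemma Ck_continuous k O (f : V -> W) x :
  Ck_on k O f -> O x -> {for x, continuous f}.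
Proof.
elim: k f => [|k IH] f; first by move=> H; exact: H.
by move=> /CkS; exact: IH.
Qed.

(** Openness matters from the first derivative on: a directional derivative at a
    point of [O] depends on values at nearby points. *)
Lemma Ck_ext k O (f g : V -> W) :
  open O -> (forall x, O x -> f x = g x) -> Ck_on k O f -> Ck_on k O g.
Proof.
move=> oO; elim: k f g => [|k IH] f g fg.
  move=> H x Ox.
  have nfg : \forall y \near x, f y = g y.
    by apply: filterS fg _; exact: open_nbhs_nbhs.
  rewrite /prop_for /continuous_at -(fg x Ox).
  by apply: cvg_trans (H x Ox); apply: near_eq_cvg.
case=> H1 H2.
have nfg x : O x -> {near x, f =1 g}.
  by move=> Ox; apply: filterS fg _; exact: open_nbhs_nbhs.
split=> [x Ox|v].
  by apply: near_eq_differentiable (nfg _ Ox) (H1 _ Ox).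
by apply: IH (H2 v) => x /nfg; exact: near_eq_derive.
Qed.

Lemma Ck_cst k O (w : W) : Ck_on k O (fun _ : V => w).
Proof.
elim: k w => [|k IH] w; first by move=> x _; exact: cst_continuous.
split=> [x _|v]; first exact: differentiable_cst.
rewrite (_ : 'D_v _ = fun=> 0) //.
by apply/funext => x; exact: derive_cst.
Qed.

Lemma Ck_local k O (f : V -> W) :
  (forall x, O x -> exists O', [/\ open O', O' x & Ck_on k O' f]) ->
  Ck_on k O f.
Proof.
elim: k f => [|k IH] f H.
  by move=> x Ox; case: (H x Ox) => O' [oO' O'x] H'; exact: H'.
split=> [x Ox|v].
  by case: (H x Ox) => O' [oO' O'x [H1 _]]; exact: H1.
by apply: IH => x Ox; case: (H x Ox) => O' [? ? [_ H2]]; exists O'; split=> //; exact: H2.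
Qed.

Lemma Ck_add k O (f g : V -> W) : open O ->
  Ck_on k O f -> Ck_on k O g -> Ck_on k O (fun x => f x + g x).
Proof.
move=> oO; elim: k f g => [|k IH] f g.
  by move=> Hf Hg x Ox; apply: continuousD; [exact: Hf|exact: Hg].
move=> [f1 f2] [g1 g2]; split=> [x Ox|v].
  by apply: differentiableD; [exact: f1|exact: g1].
apply: Ck_ext (IH _ _ (f2 v) (g2 v)) => // x Ox; symmetry.
by apply: deriveD; apply: diff_derivable; [exact: f1|exact: g1].
Qed.

Lemma Ck_opp k O (f : V -> W) : open O -> Ck_on k O f -> Ck_on k O (fun x => - f x).
Proof.
move=> oO; elim: k f => [|k IH] f.
  by move=> Hf x Ox; apply: continuousN; exact: Hf.
move=> [f1 f2]; split=> [x Ox|v]; first by apply: differentiableN; exact: f1.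
apply: Ck_ext (IH _ (f2 v)) => // x Ox; symmetry.
by apply: deriveN; apply: diff_derivable; exact: f1.
Qed.

Lemma Ck_sum k O (I : Type) (r : seq I) (P : pred I) (f : I -> V -> W) : open O ->
  (forall i, Ck_on k O (f i)) -> Ck_on k O (fun x => \sum_(i <- r | P i) f i x).
Proof.
move=> oO H; elim: r => [|i r IH].
  by under eq_fun do rewrite big_nil; exact: Ck_cst.
under eq_fun do rewrite big_cons.
by case: (P i) => //; apply: Ck_add.
Qed.

Lemma Ck_scalel k O (f : V -> R^o) (w : W) : open O ->
  Ck_on k O f -> Ck_on k O (fun x => (f x : R) *: w).
Proof.
move=> oO; elim: k f => [|k IH] f.
  move=> Hf x Ox; apply: (@continuous_comp _ _ _ f (fun a : R => a *: w)).
    exact: Hf.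
  exact: scalel_continuous.
move=> [f1 f2]; split=> [x Ox|v].
  by apply: differentiableZl; exact: f1.
apply: Ck_ext (IH _ (f2 v)) => // x Ox; symmetry.
rewrite deriveE; last by apply: differentiableZl; exact: f1.
by rewrite diffZl ?deriveE//; exact: f1.
Qed.

End Ck.

Section CkScalar.
Variables (R : realType) (V : normedModType R).
Implicit Types (O : set V) (k : nat).

Lemma Ck_scalar_mul k O (f g : V -> R^o) : open O ->
  Ck_on k O f -> Ck_on k O g -> Ck_on k O (fun x => f x * g x : R^o).
Proof.
move=> oO; elim: k f g => [|k IH] f g.
  by move=> Hf Hg x Ox; apply: continuousM; [exact: Hf|exact: Hg].
move=> Hf Hg; have [[f1 f2] [g1 g2]] := (Hf, Hg); split=> [x Ox|v].
  by apply: differentiableM; [exact: f1|exact: g1].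
have H := Ck_add oO (IH _ _ (CkS Hf) (g2 v)) (IH _ _ (CkS Hg) (f2 v)).
apply: Ck_ext H => // x Ox; symmetry.
by apply: deriveM; apply: diff_derivable; [exact: f1|exact: g1].
Qed.

Lemma Ck_prod k O (I : Type) (r : seq I) (P : pred I) (f : I -> V -> R^o) : open O ->
  (forall i, Ck_on k O (f i)) ->
  Ck_on k O (fun x => \prod_(i <- r | P i) f i x : R^o).
Proof.
move=> oO H; elim: r => [|i r IH].
  by under eq_fun do rewrite big_nil; exact: Ck_cst.
under eq_fun do rewrite big_cons.
by case: (P i) => //; apply: Ck_scalar_mul.
Qed.

Lemma Ck_inv k O (f : V -> R^o) : open O -> (forall x, O x -> f x != 0) ->
  Ck_on k O f -> Ck_on k O (fun x => (f x)^-1 : R^o).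
Proof.
move=> oO f0; elim: k => [|k IH].
  move=> Hf x Ox; apply: (@cvgV R V (nbhs x) _ f (f x)); first exact: f0.
  exact: Hf.
move=> Hf; have [f1 f2] := Hf; split=> [x Ox|v].
  by apply: differentiableV; [exact: f1|exact: f0].
have Hv := IH (CkS Hf).
have H := Ck_opp oO (Ck_scalar_mul oO (Ck_scalar_mul oO Hv Hv) (f2 v)).
apply: Ck_ext H => // x Ox; symmetry.
rewrite (deriveV (f0 _ Ox)); last exact/diff_derivable/f1.
rewrite /GRing.scale /= expr2 invfM mulNr; rewrite -/(GRing.scale _ _).
by [].
Qed.

End CkScalar.

Section CkRow.
Variables (R : realType) (V : normedModType R).
Implicit Types (O : set V) (k m n : nat).

Lemma Ck_linear_comp (U W W' : normedModType R) (f : {linear W -> W'}) k (O : set U) (g : U -> W) :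
  open O -> continuous f -> Ck_on k O g -> Ck_on k O (f \o g).
Proof.
move=> oO cf; elim: k g => [|k IH] g.
  by move=> H x Ox; apply: continuous_comp; [exact: H|exact: cf].
move=> [g1 g2]; have df x : differentiable f x by exact: linear_differentiable.
split=> [x Ox|v]; first by apply: differentiable_comp => //; exact: g1.
apply: Ck_ext (IH _ (g2 v)) => // x Ox; symmetry.
rewrite deriveE; last by apply: differentiable_comp => //; exact: g1.
by rewrite diff_comp ?diff_lin//=; [rewrite deriveE//; exact: g1|exact: g1].
Qed.

Lemma Ck_linear n k (O : set 'rV[R]_n) (f : {linear 'rV[R]_n -> V}) : Ck_on k O f.
Proof.
case: k => [|k]; first by move=> x _; exact: linear_rV_continuous.
split=> [x _|v]; first exact: linear_rV_differentiable.
rewrite (_ : 'D_v f = fun=> f v); first exact: Ck_cst.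
by apply/funext => x; exact: derive_linear_rV.
Qed.

Lemma Ck_coord n m k (O : set V) (f : V -> 'M[R]_(m, n)) i j : open O ->
  Ck_on k O f -> Ck_on k O (fun x => f x i j : R^o).
Proof.
move=> oO; elim: k f => [|k IH] f.
  move=> H x Ox; apply: (@continuous_comp _ _ _ f (fun M : 'M[R]_(m, n) => M i j)).
    exact: H.
  exact: coord_continuous.
move=> [f1 f2]; split=> [x Ox|v].
  apply: (@differentiable_comp _ _ _ _ f (fun M : 'M[R]_(m, n) => M i j : R^o)).
    exact: f1.
  exact: differentiable_coord.
apply: Ck_ext (IH _ (f2 v)) => // x Ox; symmetry.
by rewrite derive_mx ?mxE//; apply: diff_derivable; exact: f1.
Qed.

Lemma Ck_row n k (O : set V) (f : V -> 'rV[R]_n) : open O ->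
  (forall i, Ck_on k O (fun x => f x 0 i : R^o)) -> Ck_on k O f.
Proof.
move=> oO H.
have := @Ck_sum _ _ _ k O _ (index_enum 'I_n) predT (fun i x => (f x 0 i : R) *: (delta_mx 0 i : 'rV[R]_n)) oO
  (fun i => Ck_scalel _ oO (H i)).
by apply: Ck_ext => // x _; rewrite -row_sum_delta.
Qed.

End CkRow.

(** * Composition, matrix inversion and strict differentiability *)

Section CkComp.
Variables (R : realType) (V : normedModType R).
Implicit Types (O : set V) (k m p : nat).

Lemma diff_coordE m (W : normedModType R) (g : 'rV[R]_m -> W) y (h : 'rV[R]_m) :
  differentiable g y -> 'd g y h = \sum_i h 0 i *: 'D_(delta_mx 0 i) g y.
Proof.
move=> dg; rewrite {1}(row_sum_delta h) linear_sum; apply: eq_bigr => i _.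
by rewrite linearZ deriveE.
Qed.

(** The chain rule expresses the derivative of the composite by derivatives of
    [g] along the coordinate vectors, whose composites with [f] are covered by the
    induction hypothesis. *)
Lemma Ck_comp_scalar m k O (P : set 'rV[R]_m) (f : V -> 'rV[R]_m)
    (g : 'rV[R]_m -> R^o) :
  open O -> (forall x, O x -> P (f x)) ->
  Ck_on k O f -> Ck_on k P g -> Ck_on k O (g \o f).
Proof.
move=> oO OP; elim: k g => [|k IH] g.
  by move=> Hf Hg x Ox; apply: continuous_comp; [exact: Hf|exact/Hg/OP].
move=> Hf [g1 g2]; have [f1 f2] := Hf; split=> [x Ox|v].
  by apply: differentiable_comp; [exact: f1|exact/g1/OP].
have H : Ck_on k O (fun x => \sum_i
    (('D_v f x) 0 i * ('D_(delta_mx 0 i) g \o f) x) : R^o).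
  apply: Ck_sum => // i; apply: Ck_scalar_mul => //.
    by apply: Ck_coord => //; exact: f2.
  by apply: IH (g2 _); exact: CkS.
apply: Ck_ext H => // x Ox; symmetry.
rewrite deriveE; last by apply: differentiable_comp; [exact: f1|exact/g1/OP].
rewrite diff_comp; [|exact: f1|exact/g1/OP].
rewrite /= diff_coordE; last exact/g1/OP.
by rewrite deriveE; last exact: f1.
Qed.

Lemma Ck_comp m p k O (P : set 'rV[R]_m) (f : V -> 'rV[R]_m)
    (g : 'rV[R]_m -> 'rV[R]_p) :
  open O -> open P -> (forall x, O x -> P (f x)) ->
  Ck_on k O f -> Ck_on k P g -> Ck_on k O (g \o f).
Proof.
move=> oO oP OP Hf Hg; apply: Ck_row => // i.
by apply: (Ck_comp_scalar (g := fun y => g y 0 i : R^o) oO OP Hf); exact: Ck_coord.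
Qed.

Lemma Ck_scale p k O (f : V -> R^o) (g : V -> 'rV[R]_p) : open O ->
  Ck_on k O f -> Ck_on k O g -> Ck_on k O (fun x => (f x : R) *: g x).
Proof.
move=> oO Hf Hg; apply: Ck_row => // i.
apply: (@Ck_ext _ _ _ _ _ (fun x => (f x : R) * g x 0 i : R^o)) => //.
  by move=> x _; rewrite mxE.
by apply: Ck_scalar_mul => //; exact: Ck_coord.
Qed.

Lemma Ck_mulmx m p k O (f : V -> 'rV[R]_m) (g : V -> 'M[R]_(m, p)) : open O ->
  Ck_on k O f -> (forall i j, Ck_on k O (fun x => g x i j : R^o)) ->
  Ck_on k O (fun x => f x *m g x).
Proof.
move=> oO Hf Hg; apply: Ck_row => // j.
apply: (@Ck_ext _ _ _ _ _ (fun x => \sum_i (f x 0 i * g x i j) : R^o)) => //.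
  by move=> x _; rewrite mxE.
apply: Ck_sum => // i.
by apply: Ck_scalar_mul => //; exact: Ck_coord.
Qed.

Lemma Ck_det m k O (g : V -> 'M[R]_m) : open O ->
  (forall i j, Ck_on k O (fun x => g x i j : R^o)) ->
  Ck_on k O (fun x => \det (g x) : R^o).
Proof.
move=> oO Hg; rewrite /determinant; apply: Ck_sum => // s.
apply: Ck_scalar_mul => //; first exact: Ck_cst.
by apply: Ck_prod.
Qed.

(** Cramer's rule reduces inversion of matrices to determinants. *)
Lemma Ck_invmx m k O (g : V -> 'M[R]_m) : open O ->
  (forall x, O x -> g x \in unitmx) ->
  (forall i j, Ck_on k O (fun x => g x i j : R^o)) ->
  forall i j, Ck_on k O (fun x => invmx (g x) i j : R^o).
Proof.
move=> oO ug Hg i j.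
apply: (@Ck_ext _ _ _ _ _ (fun x => (\det (g x))^-1 * cofactor (g x) j i : R^o)) => //.
  by move=> x Ox; rewrite /invmx ug// !mxE.
apply: Ck_scalar_mul => //.
  apply: Ck_inv => //; last exact: Ck_det.
  by move=> x /ug; rewrite unitmxE unitfE.
apply: Ck_scalar_mul => //; first exact: Ck_cst.
apply: Ck_det => // a b.
apply: (@Ck_ext _ _ _ _ _ (fun x => g x (lift j a) (lift i b) : R^o)) => //.
by move=> x _; rewrite !mxE.
Qed.

End CkComp.

Section Strict.
Variables (R : realType).
Implicit Types (m p : nat).

Lemma rV_norm_le m p (x : 'M[R]_(m, p)) c : 0 <= c ->
  (forall i j, `|x i j| <= c) -> `|x| <= c.
Proof.
by move=> c0 H; rewrite [leLHS]mx_normrE; apply: bigmax_le => // -[i j] _ /=.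
Qed.

Lemma rV_coord_le m p (x : 'M[R]_(m, p)) i j : `|x i j| <= `|x|.
Proof.
rewrite [leRHS]mx_normrE.
exact: (le_bigmax _ (fun ij : 'I_m * 'I_p => `|x ij.1 ij.2|) (i, j)).
Qed.

Lemma segment_ball (V : normedModType R) (x u v : V) d (s : R) :
  ball x d u -> ball x d v -> 0 <= s <= 1 -> ball x d (v + s *: (u - v)).
Proof.
rewrite -!ball_normE /= => xu xv /andP[s0 s1].
have -> : x - (v + s *: (u - v)) = s *: (x - u) + (1 - s) *: (x - v).
  have -> : u - v = (x - v) - (x - u) by rewrite opprB [RHS]addrC addrA subrK.
  by rewrite opprD addrA scalerBr opprB scalerBl scale1r addrCA.
apply: le_lt_trans (ler_normD _ _) _.
rewrite !normrZ (ger0_norm s0) ger0_norm ?subr_ge0//.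
have [->|sn0] := eqVneq s 0; first by rewrite mul0r add0r subr0 mul1r.
have sp : 0 < s by rewrite lt_neqAle eq_sym sn0.
rewrite [ltRHS](_ : d = s * d + (1 - s) * d); last first.
  by rewrite -mulrDl addrC subrK mul1r.
apply: ltr_leD; first by rewrite ltr_pM2l.
by apply: ler_wpM2l; [rewrite subr_ge0|exact: ltW].
Qed.

Lemma mean_value_rV (V : normedModType R) (f : V -> R^o) (u v : V) :
  (forall s : R, 0 <= s <= 1 -> differentiable f (v + s *: (u - v))) ->
  exists2 s : R, 0 <= s <= 1 & f u - f v = 'd f (v + s *: (u - v)) (u - v).
Proof.
move=> df.
pose g (s : R) := v + s *: (u - v).
pose F (s : R) : R := f (g s).
have dg (s : R) : is_diff s g (fun t : R => t *: (u - v)).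
  rewrite /g; apply: is_diff_eq.
  by apply/funext => t; rewrite /= add0r.
have dF (s : R) : 0 <= s <= 1 -> is_derive s 1 F ('d f (g s) (u - v)).
  move=> s01; have dfg : differentiable f (g s) by exact: df.
  have dgs : differentiable g s by [].
  have dFs : differentiable F s by apply: (differentiable_comp dgs dfg).
  apply: DeriveDef; first exact: diff_derivable.
  rewrite deriveE// [LHS](congr1 (fun h => h 1) (diff_comp dgs dfg)) /=.
  by rewrite diff_val scale1r.
have dFo (s : R) : s \in `]0%R, 1%R[ -> is_derive s 1 F ('d f (g s) (u - v)).
  by rewrite in_itv/= => /andP[s0 s1]; apply: dF; rewrite !ltW.
have cF : {within `[0%R, 1%R], continuous F}.
  by apply: derivable_within_continuous => s; rewrite in_itv /= => /dF[].
have [t Ht E] := MVT_segment (@ler01 R) dFo cF.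
exists t; first by rewrite in_itv/= in Ht.
move: E; rewrite subr0 mulr1 => <-.
by rewrite /F /g scale1r scale0r addr0 subrKC.
Qed.

Lemma diff_near m (O : set 'rV[R]_m) (f : 'rV[R]_m -> R^o) x :
  open O -> Ck_on 1 O f -> O x -> forall e, 0 < e ->
  exists2 d, 0 < d & forall y, ball x d y ->
    O y /\ forall h, `|'d f y h - 'd f x h| <= e * `|h|.
Proof.
move=> oO [f1 f2] Ox e e0.
have N1 : \forall y \near x, O y by exact: open_nbhs_nbhs.
have N2 : \forall y \near x, forall i : 'I_m,
    `|'D_(delta_mx 0 i) f x - 'D_(delta_mx 0 i) f y| < e / m.+1%:R.
  have FF : Filter (nbhs x) by exact: nbhs_filter.
  apply: (@filter_forall _ 'I_m (fun i y =>
    `|'D_(delta_mx 0 i) f x - 'D_(delta_mx 0 i) f y| < e / m.+1%:R) _ FF) => i.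
  have /cvgrPdist_lt := f2 (delta_mx 0 i) x Ox.
  by apply; rewrite divr_gt0.
have /nbhs_ballP[d /= d0 Hd] : \forall y \near x, O y /\
    forall i : 'I_m, `|'D_(delta_mx 0 i) f x - 'D_(delta_mx 0 i) f y| < e / m.+1%:R.
  exact: filterI N1 N2.
exists d => // y /Hd[Oy Hy]; split=> // h.
have key (p q : R) : p = \sum_i h 0 i * 'D_(delta_mx 0 i) f y ->
    q = \sum_i h 0 i * 'D_(delta_mx 0 i) f x -> `|p - q| <= e * `|h|; last first.
  by apply: key; [exact: diff_coordE (f1 _ Oy)|exact: diff_coordE (f1 _ Ox)].
move=> -> ->.
rewrite -sumrB.
apply: le_trans (ler_norm_sum _ _ _) _.
have -> : e * `|h| = \sum_(i < m.+1) (e / m.+1%:R * `|h|).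
  by rewrite sumr_const card_ord -[RHS]mulr_natr [RHS]mulrAC divfK ?pnatr_eq0.
rewrite big_ord_recr /= -[leLHS]addr0; apply: lerD; last first.
  by rewrite mulr_ge0// divr_ge0// ltW.
apply: ler_sum => i _; rewrite -mulrBr normrM mulrC.
apply: ler_pM => //; last exact: rV_coord_le.
by rewrite distrC ltW.
Qed.

Lemma strict_differentiable_scalar m (O : set 'rV[R]_m) (f : 'rV[R]_m -> R^o) x :
  open O -> Ck_on 1 O f -> O x -> forall e, 0 < e ->
  exists2 d, 0 < d & forall u v, ball x d u -> ball x d v ->
    `|f u - f v - 'd f x (u - v)| <= e * `|u - v|.
Proof.
move=> oO Hf Ox e e0; have [d d0 Hd] := diff_near oO Hf Ox e0.
exists d => // u v xu xv.
have seg s : 0 <= s <= 1 -> ball x d (v + s *: (u - v)) by exact: segment_ball.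
have [s s01 ->] : exists2 s : R, 0 <= s <= 1 &
    f u - f v = 'd f (v + s *: (u - v)) (u - v).
  by apply: mean_value_rV => s /seg /Hd[] /Hf.1.
exact: (Hd _ (seg _ s01)).2.
Qed.

Lemma diff_coord_fun (V : normedModType R) m p (f : V -> 'M[R]_(m, p)) x h i j :
  differentiable f x -> ('d f x h) i j = 'd (fun y => f y i j : R^o) x h.
Proof.
move=> df; have dfi : differentiable (fun y => f y i j : R^o) x.
  apply: (@differentiable_comp _ _ _ _ f (fun M : 'M[R]_(m, p) => M i j : R^o)) => //.
  exact: differentiable_coord.
by rewrite -!deriveE// derive_mx ?mxE//; exact: diff_derivable.
Qed.

(** The estimate is uniform in two points near [x]; it makes the Newton-type map
    of the implicit function theorem a contraction. *)
Lemma strict_differentiable m p (O : set 'rV[R]_m) (f : 'rV[R]_m -> 'rV[R]_p) x :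
  open O -> Ck_on 1 O f -> O x -> forall e, 0 < e ->
  exists2 d, 0 < d & forall u v, ball x d u -> ball x d v ->
    `|f u - f v - 'd f x (u - v)| <= e * `|u - v|.
Proof.
move=> oO Hf Ox e e0; have [f1 f2] := Hf.
have : \forall d \near 0^'+, forall i : 'I_p, forall u v, ball x d u -> ball x d v ->
    `|(f u - f v - 'd f x (u - v)) 0 i| <= e * `|u - v|.
  apply: filter_forall => i.
  have [d d0 Hd] := @strict_differentiable_scalar m O (fun y => f y 0 i) x oO
    (Ck_coord 0 i oO Hf) Ox e e0.
  near=> d' => u v xu xv.
  have le_d : d' <= d by near: d'; exact: nbhs_right_le.
  have := Hd u v (le_ball le_d xu) (le_ball le_d xv).
  rewrite !mxE; congr (`|_ - _| <= _).
  by rewrite -diff_coord_fun//; exact: f1.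
move=> Hn; have [d [Hd d0]] := filter_ex (filterI Hn (@nbhs_right_gt R 0)).
exists d => // u v xu xv; apply: rV_norm_le => [|i j].
  by rewrite mulr_ge0// ltW.
rewrite ord1; exact: Hd.
Unshelve. all: by end_near. Qed.

Lemma open_norm_lt m (r : R) (f : 'rV[R]_m -> 'rV[R]_m) : continuous f ->
  open [set z : 'rV[R]_m | `|f z| < r].
Proof.
move=> cf; rewrite (_ : mkset _ = (fun z => `|f z|) @^-1` [set x | x < r])//.
apply: open_comp; last exact: open_lt.
by move=> x _; apply: continuous_comp; [exact: cf|exact: norm_continuous].
Qed.

Lemma open_norm_ball m (r : R) : open [set z : 'rV[R]_m | `|z| < r].
Proof. by apply: (@open_norm_lt m r (fun z => z)) => z; exact: cvg_id. Qed.

End Strict.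

(** * The implicit function theorem *)

(** Completeness as a uniform space, joined with the normed structure, makes the
    Banach fixed point theorem applicable to row vectors. *)
HB.instance Definition _ (R : realType) m n :=
  Uniform_isComplete.Build 'M[R]_(m, n) (@mx_complete R m n).


Section Contraction.
Variable R : realType.

Lemma contraction_fixed_point b (U : set 'rV[R]_b) (f : 'rV[R]_b -> 'rV[R]_b) :
  closed U -> U 0 -> (forall w, U w -> U (f w)) ->
  (forall w w', U w -> U w' -> `|f w - f w'| <= 2^-1 * `|w - w'|) ->
  exists2 w, U w & w = f w.
Proof.
move=> clU U0 fU cf.
pose F : {fun U >-> U} := mkfun_fun fU.
have q0 : (0 : R) <= 2^-1 by rewrite invr_ge0.
have cF : is_contraction F.
  exists (NngNum q0); split=> /=; first by rewrite invf_lt1// ltr1n.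
  by move=> -[w w'] [/= Uw Uw']; exact: cf.
by have [w Uw E] := banach_fixed_point cF clU (ex_intro _ _ U0); exists w.
Qed.

End Contraction.

Section Implicit.
Variables (R : realType) (a b : nat).
Implicit Types (p v : 'rV[R]_a) (w : 'rV[R]_b).

Lemma row_mxB p p' w w' : row_mx p w - row_mx p' w' = row_mx (p - p') (w - w').
Proof. by rewrite opp_row_mx add_row_mx. Qed.

Lemma row_mx_norm_le p w c : 0 <= c -> `|p| <= c -> `|w| <= c -> `|row_mx p w| <= c.
Proof.
move=> c0 pc wc; apply: rV_norm_le => // i j; rewrite mxE.
by case: (fintype.split j) => k; apply: le_trans (rV_coord_le _ _ _) _.
Qed.

Lemma row_mx_sum p w : row_mx p w = p *m row_mx 1%:M 0 + w *m row_mx 0 1%:M.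
Proof. by rewrite !mul_mx_row !mulmx1 !mulmx0 add_row_mx addr0 add0r. Qed.

(** For fixed [p] the solution is the fixed point of the contraction
    [w |-> w - Phi (p, w)] iterated from [0]. The last clause records that a closed
    set containing [0] and stable under this map contains the solution: it is the
    way in which symmetries are transferred to solutions. Smoothness is a
    bootstrap, the derivative of [phi] being an expression in [phi] itself. *)
Lemma implicit_function (O : set 'rV[R]_(a + b)) (Phi : 'rV[R]_(a + b) -> 'rV[R]_b) :
  open O -> O 0 -> (forall k, Ck_on k O Phi) -> Phi 0 = 0 ->
  (forall w, 'd Phi 0 (row_mx 0 w) = w) ->
  exists (r : R) (phi : 'rV[R]_a -> 'rV[R]_b),
  [/\ 0 < r,
      (forall p, `|p| < r -> O (row_mx p (phi p)) /\ Phi (row_mx p (phi p)) = 0),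
      phi 0 = 0 /\ (forall k, Ck_on k [set p | `|p| < r] phi),
      (forall v, 'd phi 0 v = - 'd Phi 0 (row_mx v 0)) &
      forall p (E : set 'rV[R]_b), `|p| < r -> closed E -> E 0 ->
        (forall w, O (row_mx p w) -> E w -> E (w - Phi (row_mx p w))) ->
        E (phi p)].
Proof.
move=> oO O0 sPhi Phi0 dPhi.
have [dPhiO _] := sPhi 1%N.
have half0 : (0 : R) < 2^-1 by rewrite invr_gt0.
have [d0 d00 Hd0] := strict_differentiable oO (sPhi 1%N) O0 half0.
have /nbhs_ballP[d1 /= d10 Hd1] : nbhs (0 : 'rV[R]_(a + b)) O by exact: open_nbhs_nbhs.
pose d := Num.min d0 d1.
have dp : 0 < d by rewrite lt_min d00.
have inO p w : `|p| < d -> `|w| < d -> ball (0 : 'rV[R]_(a + b)) d0 (row_mx p w) /\ O (row_mx p w).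
  move=> pd wd; have H : `|row_mx p w| < d.
    have : `|row_mx p w| <= Num.max `|p| `|w|.
      by apply: row_mx_norm_le; rewrite ?le_max ?lexx ?orbT ?normr_ge0.
    by move/le_lt_trans; apply; rewrite gt_max pd wd.
  split; last apply: Hd1; rewrite -ball_normE /= sub0r normrN.
    by apply: lt_le_trans H _; rewrite ge_min lexx.
  by apply: lt_le_trans H _; rewrite ge_min lexx orbT.
(* the differential of [T p] in [w] vanishes at [0], whence the ratio [1 / 2] *)
pose T p w := w - Phi (row_mx p w).
have Tc p w w' : `|p| < d -> `|w| < d -> `|w'| < d ->
    `|T p w - T p w'| <= 2^-1 * `|w - w'|.
  move=> pd wd w'd.
  have := Hd0 _ _ (inO _ _ pd wd).1 (inO _ _ pd w'd).1.
  rewrite row_mxB subrr dPhi => H.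
  have -> : T p w - T p w' =
      - (Phi (row_mx p w) - Phi (row_mx p w') - (w - w')).
    rewrite /T !opprB -[LHS]addrA -[RHS]addrA; congr (_ + _).
    by rewrite addrCA [RHS]addrCA [X in _ + X]addrC.
  rewrite normrN; apply: le_trans H _; apply: ler_wpM2l; first exact: ltW.
  by apply: row_mx_norm_le => //; rewrite normr0.
have /linear_lipschitz[K K0 HK] : continuous ('d Phi 0).
  by apply: diff_continuous; exact: dPhiO.
have Pc p p' w : `|p| < d -> `|p'| < d -> `|w| < d ->
    `|Phi (row_mx p w) - Phi (row_mx p' w)| <= (2^-1 + K) * `|p - p'|.
  move=> pd p'd wd; have := Hd0 _ _ (inO _ _ pd wd).1 (inO _ _ p'd wd).1.
  rewrite row_mxB subrr => H.
  have Hn : `|row_mx (p - p') (0 : 'rV[R]_b)| <= `|p - p'|.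
    by apply: row_mx_norm_le => //; rewrite normr0.
  rewrite -[X in `|X|](subrK ('d Phi 0 (row_mx (p - p') 0))).
  apply: le_trans (ler_normD _ _) _; rewrite mulrDl; apply: lerD.
    by apply: le_trans H _; apply: ler_wpM2l => //; exact: ltW.
  by apply: le_trans (HK _) _; apply: ler_wpM2l => //; exact: ltW.
pose r := Num.min d (d / 4 / (2^-1 + K)).
have K1 : 0 < 2^-1 + K by rewrite addr_gt0.
have rp : 0 < r by rewrite lt_min dp divr_gt0// divr_gt0.
have rd p : `|p| < r -> `|p| < d by rewrite /r lt_min => /andP[].
have d2 : d / 2 < d by rewrite ltr_pdivrMr// ltr_pMr// ltr1n.
have d2' w : `|w| <= d / 2 -> `|w| < d by move/le_lt_trans; apply.
have T0 p : `|p| < r -> `|T p 0| <= d / 4.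
  move=> pr; rewrite /T sub0r normrN.
  have z : `|0 : 'rV[R]_a| < d by rewrite normr0.
  have z' : `|0 : 'rV[R]_b| < d by rewrite normr0.
  have := Pc _ _ _ (rd _ pr) z z'; rewrite row_mx0 Phi0 !subr0 => /le_trans; apply.
  rewrite mulrC -ler_pdivlMr//; apply: ltW.
  by move: pr; rewrite /r lt_min => /andP[].
have TU p w : `|p| < r -> `|w| <= d / 2 -> `|T p w| <= d / 2.
  move=> pr wd; rewrite -[X in `|X|](subrK (T p 0)).
  apply: le_trans (ler_normD _ _) _.
  have -> : d / 2 = 2^-1 * (d / 2) + d / 4 by lra.
  apply: lerD; last exact: T0.
  apply: le_trans (Tc _ _ _ (rd _ pr) (d2' _ wd) _) _; first by rewrite normr0.
  by rewrite subr0 ler_pM2l.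
have clU : closed [set w : 'rV[R]_b | `|w| <= d / 2].
  rewrite (_ : mkset _ = (fun w : 'rV[R]_b => `|w|) @^-1` [set x | x <= d / 2])//.
  apply: closed_comp; last exact: closed_le.
  by move=> x _; exact: norm_continuous.
have ex p (E : set 'rV[R]_b) : `|p| < r -> closed E -> E 0 ->
    (forall w, O (row_mx p w) -> E w -> E (T p w)) ->
    exists2 w, `|w| <= d / 2 /\ E w & w = T p w.
  move=> pr cE E0 HE.
  have [//|||w w'|w [w1 w2] w3] := @contraction_fixed_point R b
    ([set w : 'rV[R]_b | `|w| <= d / 2] `&` E) (T p).
  - exact: closedI.
  - by split=> //=; rewrite normr0 ltW// divr_gt0.
  - move=> w [w1 w2]; split; first exact: TU.
    by apply: HE => //; apply: (inO _ _ (rd _ pr) (d2' _ w1)).2.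
  - move=> [w1 _] [w1' _]; apply: Tc; [exact: rd|exact: d2'|exact: d2'].
  - by exists w.
(* the set [E] is arbitrary in [ex], and uniqueness identifies all fixed points *)
pose phi p := xget 0 [set w | `|w| <= d / 2 /\ w = T p w].
have phiP p : `|p| < r -> `|phi p| <= d / 2 /\ phi p = T p (phi p).
  move=> pr; have [w [w1 _] w2] := ex p setT pr closedT I (fun _ _ _ => I).
  by apply: (@xgetPex _ 0 [set w | `|w| <= d / 2 /\ w = T p w]); exists w.
have uniq p w w' : `|p| < r -> `|w| <= d / 2 -> `|w'| <= d / 2 ->
    w = T p w -> w' = T p w' -> w = w'.
  move=> pr wd wd' E E'; have := Tc _ _ _ (rd _ pr) (d2' _ wd) (d2' _ wd').
  rewrite -E -E' => H; apply/eqP; rewrite -subr_eq0 -normr_le0.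
  have := H; have := normr_ge0 (w - w').
  by lra.
have phi0 : phi 0 = 0.
  have z : `|0 : 'rV[R]_a| < r by rewrite normr0.
  have [h1 h2] := phiP 0 z; apply: (uniq 0) => //.
    by rewrite normr0 ltW// divr_gt0.
  by rewrite /T row_mx0 Phi0 subr0.
have phiE p (E : set 'rV[R]_b) : `|p| < r -> closed E -> E 0 ->
    (forall w, O (row_mx p w) -> E w -> E (T p w)) -> E (phi p).
  move=> pr cE E0 HE; have [w [w1 Ew] w2] := ex p E pr cE E0 HE.
  have [h1 h2] := phiP p pr.
  by rewrite (uniq p (phi p) w).
pose u p := row_mx p (phi p).
have uE p : u p = row_mx p (phi p) by [].
clearbody u phi.
have phiPhi p : `|p| < r -> O (u p) /\ Phi (u p) = 0.
  move=> pr; have [h1 h2] := phiP p pr; rewrite uE; split.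
    exact: (inO _ _ (rd _ pr) (d2' _ h1)).2.
  by have := h2; rewrite /T => /eqP; rewrite eq_sym subr_eq addrC -subr_eq subrr => /eqP <-.
have phiL p p' : `|p| < r -> `|p'| < r ->
    `|phi p - phi p'| <= 2 * (2^-1 + K) * `|p - p'|.
  move=> pr pr'; have [h1 h2] := phiP p pr; have [h1' h2'] := phiP p' pr'.
  have A := Tc p _ _ (rd _ pr) (d2' _ h1) (d2' _ h1').
  have B := Pc p p' _ (rd _ pr) (rd _ pr') (d2' _ h1').
  have := (phiPhi p' pr').2; rewrite uE => Z.
  have E : phi p - phi p' = (T p (phi p) - T p (phi p')) -
      (Phi (row_mx p (phi p')) - Phi (row_mx p' (phi p'))).
    rewrite -h2 Z subr0 /T.
    by rewrite opprB addrA [RHS]addrAC addrK.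
  have C : `|phi p - phi p'| <= `|T p (phi p) - T p (phi p')| +
     `|Phi (row_mx p (phi p')) - Phi (row_mx p' (phi p'))|.
    by rewrite {1}E; exact: ler_normB.
  by lra.
have u0 : u 0 = 0 by rewrite uE phi0 row_mx0.
have dPhiu p : `|p| < r -> differentiable Phi (u p).
  by move=> pr; exact: (dPhiO _ (phiPhi p pr).1).
have uL p p' : `|p| < r -> `|p'| < r ->
    `|u p - u p'| <= (1 + 2 * (2^-1 + K)) * `|p - p'|.
  move=> pr pr'; rewrite !uE row_mxB; apply: row_mx_norm_le.
  - by rewrite mulr_ge0// addr_ge0// mulr_ge0// ltW.
  - by rewrite mulrDl mul1r lerDl mulr_ge0// mulr_ge0// ltW.
  - by apply: le_trans (phiL _ _ pr pr') _; rewrite ler_wpM2r// lerDr.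
(* [M p] is the partial differential of [Phi] in the second variable at [u p] *)
pose M p : 'M[R]_b := \matrix_(i, j) ('D_(row_mx 0 (delta_mx 0 i)) Phi (u p)) 0 j.
have ME p w : `|p| < r -> 'd Phi (u p) (row_mx 0 w) = w *m M p.
  move=> pr; rewrite row_mx_sum mul0mx add0r.
  rewrite {1}(row_sum_delta w) mulmx_suml linear_sum.
  apply/rowP => j; rewrite summxE !mxE; apply: eq_bigr => i _.
  rewrite -scalemxAl linearZ !mxE; congr (_ * _).
  by rewrite deriveE ?row_mx_sum ?mul0mx ?add0r//; exact: dPhiu.
(* a kernel vector [w] would make [Phi] nearly constant along [w] near [u p],
   whereas strict differentiability at [0] makes it nearly the identity *)
have Mu p : `|p| < r -> M p \in unitmx.
  move=> pr; rewrite unitmxE unitfE; apply/det0P => -[w w0 Mw0].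
  have := ME p w pr; rewrite Mw0 => dw0.
  have q0 : (0 : R) < 4^-1 by rewrite invr_gt0.
  have H1 := differentiable_eps (dPhiu p pr) q0.
  have [h1 h2] := phiP p pr.
  have H2 : \forall y \near u p, ball (0 : 'rV[R]_(a + b)) d0 y.
    apply: open_nbhs_nbhs; split; first exact: ball_open.
    by rewrite uE; exact: (inO _ _ (rd _ pr) (d2' _ h1)).1.
  have /nbhs_ballP[e /= e0 He] : \forall y \near u p,
      `|Phi y - Phi (u p) - 'd Phi (u p) (y - u p)| <= 4^-1 * `|y - u p| /\
      ball (0 : 'rV[R]_(a + b)) d0 y by exact: filterI H1 H2.
  pose h : 'rV[R]_(a + b) := row_mx 0 w.
  have hn : `|h| = `|w|.
    apply/le_anti/andP; split; first by apply: row_mx_norm_le; rewrite ?normr0.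
    apply: rV_norm_le => // i j; have := rV_coord_le h i (rshift a j).
    by rewrite row_mxEr.
  have wp : 0 < `|w| by rewrite normr_gt0.
  pose t : R := e / 2 / `|w|.
  have tp : 0 < t by rewrite !divr_gt0.
  have tw : t * `|w| = e / 2 by rewrite /t divfK// gt_eqF.
  have B : ball (u p) e (u p + t *: h).
    rewrite -ball_normE /= opprD addrA subrr sub0r normrN normrZ hn gtr0_norm// tw.
    by rewrite ltr_pdivrMr// ltr_pMr// ltr1n.
  have [A1 A2] := He _ B.
  have := (inO _ _ (rd _ pr) (d2' _ h1)).1; rewrite -uE => A3.
  have Eh : u p + t *: h - u p = t *: h by rewrite addrC addKr.
  have hN : `|t *: h| = t * `|w| by rewrite normrZ hn (gtr0_norm tp).
  have E1 : 'd Phi (u p) (t *: h) = 0 by rewrite linearZ /= dw0 scaler0.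
  have E2 : 'd Phi 0 (t *: h) = t *: w by rewrite linearZ /= dPhi.
  move: A1; rewrite Eh E1 hN.
  move=> A4.
  rewrite subr0 in A4.
  have A5 := Hd0 _ _ A2 A3.
  rewrite Eh hN in A5.
  rewrite E2 in A5.
  have A6 : t * `|w| <= `|Phi (u p + t *: h) - Phi (u p)| +
     `|Phi (u p + t *: h) - Phi (u p) - t *: w|.
    rewrite -[leLHS](_ : `|t *: w| = _); last by rewrite normrZ gtr0_norm.
    rewrite -[X in `|X| <= _](subKr (Phi (u p + t *: h) - Phi (u p))).
    exact: ler_normB.
  by move: A4 A5 A6; move: (mulr_gt0 tp wp); lra.
pose L p : {linear 'rV[R]_a -> 'rV[R]_b} :=
  - (mulmxr (invmx (M p)) \o 'd Phi (u p) \o mulmxr (row_mx 1%:M 0)).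
have LE p v : L p v = - ('d Phi (u p) (row_mx v 0) *m invmx (M p)).
  by rewrite /L /= mul_mx_row mulmx1 mulmx0.
have dphi p : `|p| < r -> differentiable phi p /\ 'd phi p = L p :> (_ -> _).
  move=> pr; apply: eps_differentiable; first exact: linear_rV_continuous.
  have /linear_lipschitz[C C0 HC] := @linear_rV_continuous R _ b (mulmxr (invmx (M p))).
  move=> e e0.
  pose c := 1 + 2 * (2^-1 + K).
  have c0 : 0 < c by rewrite addr_gt0// mulr_gt0.
  have e'0 : 0 < e / c / C by rewrite !divr_gt0.
  have /nbhs_ballP[s /= s0 Hs] := differentiable_eps (dPhiu p pr) e'0.
  have oB : open [set q : 'rV[R]_a | `|q| < r] by exact: open_norm_ball.
  have N1 : \forall q \near p, `|q| < r by exact: open_nbhs_nbhs.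
  have N2 : \forall q \near p, `|q - p| < s / c.
    apply/nbhs_ballP; exists (s / c); first exact: divr_gt0.
    by move=> q; rewrite -ball_normE /= distrC.
  apply: filterS2 N1 N2 => q qr qp.
  have Bq : ball (u p) s (u q).
    rewrite -ball_normE /= distrC; apply: le_lt_trans (uL _ _ qr pr) _.
    by rewrite mulrC -ltr_pdivlMr.
  have := Hs _ Bq; rewrite (phiPhi q qr).2 (phiPhi p pr).2 subrr sub0r normrN => A1.
  have -> : phi q - phi p - L p (q - p) =
      mulmxr (invmx (M p)) ('d Phi (u p) (u q - u p)).
    have -> : u q - u p = row_mx (q - p) 0 + row_mx 0 (phi q - phi p).
      by rewrite !uE row_mxB add_row_mx addr0 add0r.
    by rewrite LE opprK linearD /= mulmxDl ME// mulmxK ?Mu// addrC.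
  apply: le_trans (HC _) _.
  have := uL _ _ qr pr; rewrite -/c => A2.
  have A3 : e / c / C * `|u q - u p| <= e / c / C * (c * `|q - p|).
    by rewrite ler_pM2l.
  have A4 := le_trans A1 A3.
  apply: le_trans (ler_wpM2l (ltW C0) A4) _.
  rewrite mulrA le_eqVlt; apply/orP; left; apply/eqP.
  by field; rewrite !gt_eqF.
exists r, phi; split=> //.
- by move=> p pr; rewrite -uE; exact: phiPhi.
- split=> // k.
  have oB : open [set q : 'rV[R]_a | `|q| < r] by exact: open_norm_ball.
  elim: k => [|k IH].
    by move=> p pr; apply: differentiable_continuous; exact: (dphi p pr).1.
  split=> [p pr|v]; first exact: (dphi p pr).1.
  have Cu : Ck_on k [set q | `|q| < r] u.
    apply: (@Ck_ext _ _ _ _ _ (fun p => mulmxr (row_mx 1%:M 0) p +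
      (mulmxr (row_mx 0 1%:M) \o phi) p)) => //.
      by move=> p _; rewrite uE row_mx_sum.
    apply: Ck_add => //; first exact: Ck_linear.
    by apply: Ck_linear_comp => //; exact: linear_rV_continuous.
  have DPhi (h : 'rV[R]_(a + b)) : Ck_on k [set q | `|q| < r] ('D_h Phi \o u).
    apply: (Ck_comp oB oO _ Cu); first by move=> p /phiPhi[].
    by have [_] := sPhi k.+1; apply.
  apply: (@Ck_ext _ _ _ _ _ (fun p => - ('D_(row_mx v 0) Phi (u p) *m invmx (M p)))) => //.
    move=> p pr; symmetry; rewrite deriveE; last exact: (dphi p pr).1.
    by rewrite (dphi p pr).2 LE deriveE//; exact: dPhiu.
  apply: Ck_opp => //; apply: Ck_mulmx => //; first exact: DPhi.
  apply: Ck_invmx => // i j.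
  apply: (@Ck_ext _ _ _ _ _ (fun p => ('D_(row_mx 0 (delta_mx 0 i)) Phi (u p)) 0 j)) => //.
    by move=> p pr; rewrite mxE.
  by apply: Ck_coord => //; exact: DPhi.
- move=> v; have z : `|0 : 'rV[R]_a| < r by rewrite normr0.
  rewrite (dphi 0 z).2 LE u0.
  have -> : M 0 = 1%:M.
    apply/row_matrixP => i; rewrite !rowE mulmx1.
    by have := ME 0 (delta_mx 0 i) z; rewrite u0 dPhi.
  by rewrite invmx1 mulmx1.
Qed.

End Implicit.

(** * Smooth division by a pair of linear forms *)

Section UnitIntegral.
Variable R : realType.
Local Notation mu := (@lebesgue_measure R).
Implicit Types f g F : R -> R.

Definition int01 f : R := \int[mu]_(s in `[0, 1]) f s.

Lemma integrable01 f : {within `[0, 1], continuous f} ->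
  mu.-integrable `[0, 1] (EFin \o f).
Proof.
by move=> cf; apply: continuous_compact_integrable => //; exact: segment_compact.
Qed.

Lemma within01D f g : {within `[0, 1], continuous f} -> {within `[0, 1], continuous g} ->
  {within `[0, 1], continuous (fun s => f s + g s)}.
Proof. by move=> cf cg x; apply: continuousD; [exact: cf|exact: cg]. Qed.

Lemma within01B f g : {within `[0, 1], continuous f} -> {within `[0, 1], continuous g} ->
  {within `[0, 1], continuous (fun s => f s - g s)}.
Proof. by move=> cf cg x; apply: continuousB; [exact: cf|exact: cg]. Qed.

Lemma within01Z c f : {within `[0, 1], continuous f} ->
  {within `[0, 1], continuous (fun s => c * f s)}.
Proof.
move=> cf x; apply: continuousM; last exact: cf.
exact: cst_continuous.
Qed.

Lemma int01D f g : {within `[0, 1], continuous f} -> {within `[0, 1], continuous g} ->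
  int01 (fun s => f s + g s) = int01 f + int01 g.
Proof. by move=> cf cg; rewrite /int01 RintegralD//; exact: integrable01. Qed.

Lemma int01B f g : {within `[0, 1], continuous f} -> {within `[0, 1], continuous g} ->
  int01 (fun s => f s - g s) = int01 f - int01 g.
Proof. by move=> cf cg; rewrite /int01 RintegralB//; exact: integrable01. Qed.

Lemma int01Z c f : {within `[0, 1], continuous f} ->
  int01 (fun s => c * f s) = c * int01 f.
Proof. by move=> cf; rewrite /int01 RintegralZl//; exact: integrable01. Qed.

Lemma eq_int01 f g : (forall s, 0 <= s <= 1 -> f s = g s) -> int01 f = int01 g.
Proof.
move=> fg; apply: eq_Rintegral => s; rewrite inE /= in_itv /=; exact: fg.
Qed.

Lemma int01_le f c : {within `[0, 1], continuous f} ->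
  (forall s, 0 <= s <= 1 -> `|f s| <= c) -> `|int01 f| <= c.
Proof.
move=> cf fc; apply: le_trans (le_normr_Rintegral _ (integrable01 cf)) _ => //.
have -> : c = \int[mu]_(s in `[0, 1]) c.
  rewrite Rintegral_cst//= lebesgue_measure_itv/= lte_fin ltr01.
  by rewrite oppr0 adde0 /= mulr1.
apply: le_Rintegral => //.
- apply: integrable01 => x; apply: continuous_comp; first exact: cf.
  exact: norm_continuous.
- apply: (integrable01 (f := fun=> c)) => x; exact: cvg_cst.
Qed.

Lemma int01_ftc F f : {within `[0, 1], continuous f} ->
  (forall s : R, 0 <= s <= 1 -> is_derive s 1 F (f s)) -> int01 f = F 1 - F 0.
Proof.
move=> cf dF.
have cF (s : R) : 0 <= s <= 1 -> {for s, continuous F}.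
  move=> /dF[d _]; apply: differentiable_continuous.
  exact/derivable1_diffP.
rewrite /int01 /Rintegral (@continuous_FTC2 R f F 0 1)//.
- split.
  + move=> x; rewrite in_itv /= => /andP[x0 x1].
    have x01 : 0 <= x <= 1 by rewrite !ltW.
    by case: (dF x x01).
  + by apply: cvg_at_right_filter; apply: cF; rewrite lexx ler01.
  + by apply: cvg_at_left_filter; apply: cF; rewrite lexx ler01.
- move=> x; rewrite in_itv /= => /andP[x0 x1]; rewrite derive1E.
  have x01 : 0 <= x <= 1 by rewrite !ltW.
  by case: (dF x x01).
Qed.

Lemma antiderivative f : continuous f ->
  exists F, forall x : R, -1 < x < 1 -> is_derive x 1 F (f x).
Proof.
move=> cf; exists (fun x => \int[mu]_(s in `[-1, x]) f s) => x /andP[x0 x1].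
have [|d1 d2] := @continuous_FTC1_closed R f (-1) x 1 x1 _ x0 (cf x).
  apply: continuous_compact_integrable => //; first exact: segment_compact.
  exact: continuous_subspaceT.
by apply: DeriveDef; [exact: d1|rewrite -derive1E; exact: d2].
Qed.

End UnitIntegral.

Section Fiber.
Variables (R : realType) (N : nat) (Q : {linear 'rV[R]_N -> 'rV[R]_N}).
Implicit Types (z v h : 'rV[R]_N) (s : R) (k : nat).

(** The homothety of ratio [s] along the image of the projection [Q], identity on
    its kernel. *)
Definition squeeze s z := (z - Q z) + s *: Q z.

Lemma squeezeB s z z' : squeeze s z - squeeze s z' = squeeze s (z - z').
Proof.
rewrite /squeeze linearB scalerBr !opprD addrACA; congr (_ + _).
by rewrite addrACA.
Qed.

Lemma squeeze_bound : exists2 C, 0 < C & forall s z, 0 <= s <= 1 -> `|squeeze s z| <= C * `|z|.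
Proof.
have /linear_lipschitz[K K0 HK] := @linear_rV_continuous R _ N Q.
exists (1 + 2 * K) => [|s z /andP[s0 s1]]; first by rewrite addr_gt0// mulr_gt0.
apply: le_trans (ler_normD _ _) _.
have A := ler_normB z (Q z); have B := HK z.
have C : `|s *: Q z| <= `|Q z| by rewrite normrZ ger0_norm// ler_piMl.
by lra.
Qed.

(** A property that holds near each point of the compact segment
    [squeeze s z0], for [s] in [[0, 1]], holds on the segments over all [z] close
    to [z0]. *)
Lemma squeeze_tube z0 (P : R -> 'rV[R]_N -> Prop) :
  (forall s1, 0 <= s1 <= 1 -> exists2 d, 0 < d & forall s z, 0 <= s <= 1 ->
     ball (squeeze s1 z0) d (squeeze s z) ->
     ball (squeeze s1 z0) d (squeeze s z0) -> P s z) ->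
  \forall z \near z0, forall s, 0 <= s <= 1 -> P s z.
Proof.
move=> H.
have [C C0 HC] := squeeze_bound.
have /near_covering_withinP cov : near_covering (`[0, 1]%classic : set R).
  by apply/compact_near_coveringP; exact: segment_compact.
have := cov _ (nbhs z0) (fun z s => P s z) _.
move=> /(_ _)/= W.
have : \forall z \near z0, `[0, 1]%classic `<=` (fun s => P s z).
  apply: W => s1; rewrite /= in_itv /= => s101.
  have [d d0 Hd] := H _ s101.
  pose c := `|Q z0| + 1.
  have c0 : 0 < c by rewrite ltr_wpDl.
  near=> s z => /=; rewrite in_itv /= => s01.
  have A : `|s1 - s| < d / 2 / c.
    near: s; apply/nbhs_ballP; exists (d / 2 / c) => /=; first by rewrite !divr_gt0.
    by move=> s; rewrite -ball_normE.
  have B : `|z0 - z| < d / 2 / C.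
    near: z; apply/nbhs_ballP; exists (d / 2 / C) => /=; first by rewrite !divr_gt0.
    by move=> y; rewrite -ball_normE.
  have D : `|squeeze s1 z0 - squeeze s z0| < d / 2.
    have -> : squeeze s1 z0 - squeeze s z0 = (s1 - s) *: Q z0.
      by rewrite /squeeze; move: (z0 - Q z0) => w; rewrite opprD addrACA subrr add0r scalerBl.
    rewrite normrZ; apply: (@le_lt_trans _ _ (`|s1 - s| * c)).
      by rewrite ler_wpM2l// /c lerDl.
    by rewrite -ltr_pdivlMr.
  apply: Hd => //; rewrite -ball_normE /=; last first.
    by apply: lt_trans D _; rewrite ltr_pdivrMr// ltr_pMr// ltr1n.
  rewrite -(subrKA (squeeze s z0)) squeezeB.
  apply: le_lt_trans (ler_normD _ _) _; rewrite (splitr d) ltrD//.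
  apply: le_lt_trans (HC _ _ s01) _.
  by rewrite mulrC -ltr_pdivlMr.
apply: filterS => z Hz s s01; apply: Hz => /=.
by rewrite in_itv.
Unshelve. all: by end_near. Qed.

End Fiber.

Lemma dist_le_scaled (R : realType) (p q r nh ny C e : R) : 0 < C -> 0 <= e ->
  nh <= C * ny -> `|p - r| <= e / 2 / C * nh -> `|q - r| <= e / 2 / C * nh ->
  `|p - q| <= e * ny.
Proof.
move=> C0 e0 hy pr qr.
have H : `|p - q| <= `|p - r| + `|q - r|.
  by rewrite -(subrKA r) [`|q - r|]distrC; exact: ler_normD.
have H' : e / 2 / C * nh <= e / 2 / C * (C * ny).
  by rewrite ler_wpM2l// divr_ge0// ?divr_ge0// ltW.
have H'' : e / 2 / C * (C * ny) = e / 2 * ny by rewrite mulrA divfK// gt_eqF.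
apply: le_trans H _; apply: le_trans (lerD pr qr) _.
have -> : e * ny = e / 2 * ny + e / 2 * ny by rewrite -mulrDl -splitr.
by rewrite -H''; exact: lerD.
Qed.

Section FiberIntegral.
Variables (R : realType) (N : nat) (Q : {linear 'rV[R]_N -> 'rV[R]_N}).
Variable O : set 'rV[R]_N.
Hypothesis oO : open O.
Hypothesis starO : forall z (s : R), O z -> 0 <= s <= 1 -> O (squeeze Q s z).
Implicit Types (z v h : 'rV[R]_N) (s : R) (k : nat) (g : 'rV[R]_N -> R^o).

(** The weight [s ^+ k] makes the family stable under differentiation: a derivative
    along the image of [Q] produces one more factor [s]. *)
Definition fiber_int k g z : R^o := int01 (fun s => s ^+ k * g (squeeze Q s z)).

Lemma squeeze_continuous z : continuous (fun s => squeeze Q s z).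
Proof.
rewrite /squeeze => s; apply: cvgD; first exact: cvg_cst.
exact: scalel_continuous.
Qed.

Lemma fiber_continuous k g z : Ck_on 0 O g -> O z ->
  {within `[0, 1], continuous (fun s => s ^+ k * g (squeeze Q s z) : R)}.
Proof.
move=> cg Oz; apply: continuous_in_subspaceT => s; rewrite inE /= in_itv /= => s01.
apply: (@continuousM _ _ (fun s : R => s ^+ k) (fun s => g (squeeze Q s z) : R)).
  exact: exprn_continuous.
apply: (@continuous_comp _ _ _ (fun s => squeeze Q s z) g).
  exact: squeeze_continuous.
by apply: cg; exact: starO.
Qed.

Lemma fiber_int_continuous k g : Ck_on 0 O g -> Ck_on 0 O (fiber_int k g).
Proof.
move=> cg z0 Oz0; have FF : Filter (nbhs z0) by exact: nbhs_filter.
apply: (proj2 (@cvgrPdist_le R R^o _ (nbhs z0) FF (fiber_int k g) _)) => e e0.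
have e2 : 0 < e / 2 by rewrite divr_gt0.
have N1 : \forall z \near z0, forall s, 0 <= s <= 1 ->
    `|g (squeeze Q s z0) - g (squeeze Q s z)| <= e.
  apply: squeeze_tube => s1 s101.
  have /cvgrPdist_lt/(_ _ e2)/nbhs_ballP[d /= d0 Hd] := cg _ (starO Oz0 s101).
  exists d => // s z s01 /Hd A /Hd B.
  have key (p q r : R) : `|p - q| < e / 2 -> `|p - r| < e / 2 -> `|q - r| <= e.
    move=> pq pr; have H : `|q - r| <= `|p - q| + `|p - r|.
      by rewrite -(subrKA p) [`|p - q|]distrC; exact: ler_normD.
    by move: H pq pr; lra.
  exact: key B A.
have N2 : \forall z \near z0, O z by exact: open_nbhs_nbhs.
apply: filterS2 N1 N2 => z Hz Oz.
have c1 := fiber_continuous (k := k) cg Oz0; have c2 := fiber_continuous (k := k) cg Oz.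
rewrite /fiber_int -int01B//; apply: int01_le => [|s s01].
  exact: within01B.
rewrite -mulrBr normrM; have /andP[s0 s1] := s01.
rewrite ger0_norm ?exprn_ge0// -[leRHS]mul1r; apply: ler_pM => //.
- exact: exprn_ge0.
- exact: exprn_ile1.
- exact: Hz.
Qed.

Definition fiber_dint k g z v :=
  fiber_int k ('D_(v - Q v) g) z + fiber_int k.+1 ('D_(Q v) g) z.

Lemma fiber_dintE k g z v : Ck_on 1 O g -> O z ->
  fiber_dint k g z v = int01 (fun s => s ^+ k * 'd g (squeeze Q s z) (squeeze Q s v)).
Proof.
move=> [dg cg] Oz; rewrite /fiber_dint /fiber_int -int01D; last first.
- exact: (fiber_continuous (cg _) Oz).
- exact: (fiber_continuous (cg _) Oz).
apply: eq_int01 => s s01.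
have D : differentiable g (squeeze Q s z) by apply: dg; exact: starO.
rewrite !deriveE// exprSr -mulrA -mulrDr; congr (_ * _).
have -> : squeeze Q s v = (v - Q v) + s *: Q v by [].
by rewrite [RHS]linearD linearZ.
Qed.

Lemma fiber_int_lin k g z c u v : Ck_on 1 O g -> O z ->
  fiber_int k ('D_(c *: u + v) g) z =
  c * fiber_int k ('D_u g) z + fiber_int k ('D_v g) z.
Proof.
move=> [dg cg] Oz; rewrite /fiber_int.
have cu := fiber_continuous (k := k) (cg u) Oz.
have cv := fiber_continuous (k := k) (cg v) Oz.
rewrite -(int01Z c cu) -(int01D (within01Z (c := c) cu) cv).
apply: eq_int01 => s s01.
have D : differentiable g (squeeze Q s z) by apply: dg; exact: starO.
by rewrite !deriveE// linearD linearZ /= mulrDr mulrCA.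
Qed.

Lemma fiber_dint_linear k g z : Ck_on 1 O g -> O z -> linear (fiber_dint k g z : _ -> R^o).
Proof.
move=> Hg Oz c u v; rewrite /fiber_dint.
have -> : c *: u + v - Q (c *: u + v) = c *: (u - Q u) + (v - Q v).
  by rewrite [Q _]linearP scalerBr opprD addrACA.
rewrite [Q (c *: u + v)]linearP.
have E1 := fiber_int_lin k c (u - Q u) (v - Q v) Hg Oz.
have E2 := fiber_int_lin k.+1 c (Q u) (Q v) Hg Oz.
by apply: etrans (congr2 +%R E1 E2) _; rewrite addrACA -mulrDr.
Qed.

(** Differentiation under the integral sign, the compactness of the segment giving
    an estimate uniform in [s]. *)
Lemma fiber_int_derive k g z : Ck_on 1 O g -> O z ->
  differentiable (fiber_int k g) z /\ 'd (fiber_int k g) z = fiber_dint k g z :> (_ -> _).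
Proof.
move=> Hg Oz; have [dg cg] := Hg.
pose Lm := GRing.isLinear.Build _ _ _ _ _ (fiber_dint_linear k Hg Oz).
pose L : {linear 'rV[R]_N -> R^o} := HB.pack (fiber_dint k g z : 'rV[R]_N -> R^o) Lm.
apply: (@eps_differentiable _ _ _ _ _ L); first exact: linear_rV_continuous.
move=> e e0; have [C C0 HC] := squeeze_bound Q.
have e'0 : 0 < e / 2 / C by rewrite !divr_gt0.
have N1 : \forall y \near z, forall s, 0 <= s <= 1 ->
    `|g (squeeze Q s y) - g (squeeze Q s z) -
      'd g (squeeze Q s z) (squeeze Q s (y - z))| <= e * `|y - z|.
  apply: squeeze_tube => s1 s101.
  have [d d0 Hd] := diff_near oO Hg (starO Oz s101) e'0.
  exists d => // s y s01 By Bz.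
  have seg := segment_ball By Bz.
  have [t t01 ->] := mean_value_rV (fun t t01 => dg _ (Hd _ (seg t t01)).1).
  rewrite squeezeB in seg *; set h := squeeze Q s (y - z) in seg *.
  have A := (Hd _ (seg _ t01)).2 h; have B := (Hd _ Bz).2 h.
  have hle := HC s (y - z) s01; rewrite -/h in hle.
  exact: (dist_le_scaled (r := 'd g (squeeze Q s1 z) h) C0 (ltW e0) hle A B).
have N2 : \forall y \near z, O y by exact: open_nbhs_nbhs.
apply: filterS2 N1 N2 => y Hy Oy.
have c0 : Ck_on 0 O g by exact: CkS.
have c1 := fiber_continuous (k := k) c0 Oy; have c2 := fiber_continuous (k := k) c0 Oz.
rewrite /= fiber_dintE//.
have c3 : {within `[0, 1], continuous
    (fun s => s ^+ k * 'd g (squeeze Q s z) (squeeze Q s (y - z)) : R)}.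
  have H : {in `[0, 1]%classic, (fun s => s ^+ k * 'D_(y - z - Q (y - z)) g (squeeze Q s z) +
      s ^+ k.+1 * 'D_(Q (y - z)) g (squeeze Q s z)) =1
      (fun s => s ^+ k * 'd g (squeeze Q s z) (squeeze Q s (y - z)) : R)}.
    move=> s; rewrite inE /= in_itv /= => s01.
    have D : differentiable g (squeeze Q s z) by apply: dg; exact: starO.
    rewrite !deriveE// exprSr -mulrA -mulrDr; congr (_ * _).
    have -> : squeeze Q s (y - z) = (y - z - Q (y - z)) + s *: Q (y - z) by [].
    by rewrite [RHS]linearD linearZ.
  apply: subspace_eq_continuous H _.
  by apply: within01D; exact: (fiber_continuous (cg _) Oz).
have c4 : {within `[0, 1], continuous (fun s => s ^+ k * g (squeeze Q s y) -
    s ^+ k * g (squeeze Q s z) : R)}.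
  exact: within01B.
rewrite /fiber_int -int01B// -int01B//; apply: int01_le => [|s s01].
  exact: within01B.
rewrite -!mulrBr normrM; have /andP[s0 s1] := s01.
rewrite ger0_norm ?exprn_ge0// -[leRHS]mul1r; apply: ler_pM => //.
- exact: exprn_ge0.
- exact: exprn_ile1.
- exact: Hy.
Qed.

Lemma Ck_fiber_int m k g : Ck_on m O g -> Ck_on m O (fiber_int k g).
Proof.
elim: m k g => [|m IH] k g; first exact: fiber_int_continuous.
move=> Hg; have [dg cg] := Hg.
have H1 : Ck_on 1 O g by elim: (m) Hg => // j IHj /CkS.
split=> [z Oz|v]; first exact: (fiber_int_derive k H1 Oz).1.
apply: (@Ck_ext _ _ _ _ _ (fun z => fiber_int k ('D_(v - Q v) g) z +
  fiber_int k.+1 ('D_(Q v) g) z)) => //.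
  move=> z Oz; have [d1 d2] := fiber_int_derive k H1 Oz.
  by rewrite deriveE// d2.
by apply: Ck_add => //; apply: IH; exact: cg.
Qed.

End FiberIntegral.

Section Division.
Variables (R : realType) (N : nat).
Variables (a b : {linear 'rV[R]_N -> R^o}) (e1 e2 : 'rV[R]_N).
Hypotheses (a1 : a e1 = 1) (a2 : a e2 = 0) (b1 : b e1 = 0) (b2 : b e2 = 1).
Variable Q : {linear 'rV[R]_N -> 'rV[R]_N}.
Hypothesis QE : forall z, Q z = (a z : R) *: e1 + (b z : R) *: e2.

(** A planar vector field [(r1, r2)] orthogonal to the radial field [(a, b)] is a
    smooth multiple of the rotated field [(- b, a)]. The factor is the integral
    of [s (D_e1 r2 - D_e2 r1)] over the segment that contracts the plane to [0]:
    differentiating the relation along [e1] and [e2] shows that this integrand times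
    the rotated field is the derivative in [s] of [s r (squeeze s z)]. No division by
    [a] or [b] occurs, so smoothness extends to [a = b = 0]. *)
Lemma division (O : set 'rV[R]_N) (r1 r2 : 'rV[R]_N -> R^o) :
  open O -> (forall z (s : R), O z -> 0 <= s <= 1 -> O (squeeze Q s z)) ->
  (forall k, Ck_on k O r1) -> (forall k, Ck_on k O r2) ->
  (forall z, O z -> a z * r1 z + b z * r2 z = 0) ->
  exists f : 'rV[R]_N -> R^o, (forall k, Ck_on k O f) /\
    forall z, O z -> r1 z = - (f z * b z) /\ r2 z = f z * a z.
Proof.
move=> oO starO s1 s2 E.
pose g z : R^o := 'D_e1 r2 z - 'D_e2 r1 z.
have sg k : Ck_on k O g.
  apply: Ck_add => //; first by have [_] := s2 k.+1; apply.
  by apply: Ck_opp => //; have [_] := s1 k.+1; apply.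
exists (fiber_int Q 1 g); split=> [k|z Oz]; first exact: Ck_fiber_int.
have [dr1 _] := s1 1%N; have [dr2 _] := s2 1%N.
have aS s : a (squeeze Q s z) = s * a z.
  rewrite /squeeze QE linearD linearB linearZ linearD !linearZ /= a1 a2.
  by rewrite /GRing.scale /= mulr0 mulr1 addr0 subrr add0r.
have bS s : b (squeeze Q s z) = s * b z.
  rewrite /squeeze QE linearD linearB linearZ linearD !linearZ /= b1 b2.
  by rewrite /GRing.scale /= mulr0 mulr1 add0r subrr add0r.
have dE v w : O w -> a v * r1 w + a w * 'D_v r1 w + (b v * r2 w + b w * 'D_v r2 w) = 0.
  move=> Ow.
  have da := @linear_rV_differentiable R R^o N a w.
  have db := @linear_rV_differentiable R R^o N b w.
  have D1 : derivable (fun z => a z * r1 z : R^o) w v.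
    apply: derivableM; apply: diff_derivable; [exact: da|exact: dr1].
  have D2 : derivable (fun z => b z * r2 z : R^o) w v.
    apply: derivableM; apply: diff_derivable; [exact: db|exact: dr2].
  have H : 'D_v (fun z => a z * r1 z + b z * r2 z : R^o) w = 0.
    rewrite -[RHS](derive_cst (0 : R^o) w v); apply: near_eq_derive.
    by apply: filterS (open_nbhs_nbhs (conj oO Ow)) => y /E.
  have H1 : 'D_v (fun z => a z * r1 z : R^o) w = a w * 'D_v r1 w + r1 w * 'D_v a w.
    by apply: deriveM; apply: diff_derivable; [exact: da|exact: dr1].
  have H2 : 'D_v (fun z => b z * r2 z : R^o) w = b w * 'D_v r2 w + r2 w * 'D_v b w.
    by apply: deriveM; apply: diff_derivable; [exact: db|exact: dr2].
  have H3 := deriveD D1 D2; rewrite H1 H2 !derive_linear_rV in H3.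
  rewrite -[RHS]H [RHS]H3.
  by rewrite addrC [r1 w * _]mulrC [r2 w * _]mulrC addrC [X in X + _]addrC [X in _ + X]addrC.
have sq1 : squeeze Q 1 z = z by rewrite /squeeze scale1r subrK.
have dF (r : 'rV[R]_N -> R^o) (s : R) : (forall w, O w -> differentiable r w) -> 0 <= s <= 1 ->
    is_derive s 1 (fun s : R => s * r (squeeze Q s z) : R)
      (r (squeeze Q s z) + s * (a z * 'D_e1 r (squeeze Q s z) + b z * 'D_e2 r (squeeze Q s z))).
  move=> dr s01.
  have drw : differentiable r (squeeze Q s z) by apply: dr; exact: starO.
  have dsq : is_diff s (fun s : R => squeeze Q s z) (fun t : R => t *: Q z).
    rewrite /squeeze; apply: is_diff_eq.
    by apply/funext => t; rewrite /= add0r.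
  have dsq' : differentiable (fun s : R => squeeze Q s z) s by [].
  have dc : differentiable (r \o (fun s : R => squeeze Q s z)) s.
    exact: differentiable_comp.
  have Dc : is_derive s (1 : R) (r \o (fun s : R => squeeze Q s z))
      (a z * 'D_e1 r (squeeze Q s z) + b z * 'D_e2 r (squeeze Q s z)).
    apply: DeriveDef; first exact: diff_derivable.
    rewrite deriveE// [LHS](congr1 (fun h => h 1) (diff_comp dsq' drw)) /=.
    rewrite diff_val scale1r QE linearD !linearZ /=.
    by rewrite !deriveE.
  have Di : is_derive s (1 : R) (id : R -> R) 1 by exact: is_derive_id.
  have Dm := @is_deriveM R _ (id : R -> R) (r \o (fun s : R => squeeze Q s z)) s 1 _ _ Di Dc.
  have [Dm1 Dm2] := Dm; apply: DeriveDef; first exact: Dm1.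
  apply: etrans Dm2 _; rewrite addrC; congr (_ + _).
  by rewrite /GRing.scale /= mulr1.
have c1 : {within `[0, 1], continuous (fun s => s ^+ 1 * g (squeeze Q s z) : R)}.
  apply: (fiber_continuous (Q := Q) (O := O)) => //; exact: (sg 0%N).
have F r : (forall w, O w -> differentiable r w) -> forall c : R,
    (forall s : R, 0 <= s <= 1 ->
      r (squeeze Q s z) + s * (a z * 'D_e1 r (squeeze Q s z) + b z * 'D_e2 r (squeeze Q s z))
      = c * (s ^+ 1 * g (squeeze Q s z))) -> r z = c * fiber_int Q 1 g z.
  move=> dr c H; rewrite /fiber_int -(int01Z c c1).
  have K := @int01_ftc R (fun s => s * r (squeeze Q s z)) _ (within01Z (c := c) c1).
  symmetry; apply: (etrans (K _)); last by rewrite mul1r mul0r subr0 sq1.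
  by move=> s s01; rewrite -H//; exact: dF.
split.
  rewrite (F r1 dr1 (- b z)); first by rewrite mulNr mulrC.
  move=> s s01; have Ow := starO _ _ Oz s01.
  have := dE e1 _ Ow; rewrite a1 b1 aS bS /g expr1 => K.
  rewrite /g; move: K.
  move: (r1 _) ('D_e1 r1 _) ('D_e2 r1 _) (r2 _) ('D_e1 r2 _) (a z) (b z).
  clear => A B C D K p q H.
  by apply/eqP; rewrite -subr_eq0 -[X in _ == X]H; apply/eqP; ring.
rewrite (F r2 dr2 (a z)); first by rewrite mulrC.
move=> s s01; have Ow := starO _ _ Oz s01.
have := dE e2 _ Ow; rewrite a2 b2 aS bS /g expr1 => K.
rewrite /g; move: K.
move: (r1 _) ('D_e2 r1 _) (r2 _) ('D_e1 r2 _) ('D_e2 r2 _) (a z) (b z).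
clear => A B C D K p q H.
by apply/eqP; rewrite -subr_eq0 -[X in _ == X]H; apply/eqP; ring.
Qed.

End Division.

(** * Curves and one-parameter groups *)

Section Curves.
Variables (R : realType).

Lemma is_derive_linear_comp (V W : normedModType R) (L : {linear V -> W}) (gamma : R -> V) (s : R) d :
  continuous L -> is_derive s 1 gamma d -> is_derive s 1 (L \o gamma) (L d).
Proof.
move=> cL [dg <-].
have dg' : differentiable gamma s by exact/derivable1_diffP.
have dL : differentiable L (gamma s) by exact: linear_differentiable.
have dc : differentiable (L \o gamma) s by exact: differentiable_comp.
apply: DeriveDef; first exact: diff_derivable.
rewrite !deriveE// [LHS](congr1 (fun h => h 1) (diff_comp dg' dL)) /=.
by rewrite diff_lin.
Qed.

Lemma is_derive_diff_comp (V : normedModType R) (W : normedModType R) (f : V -> W) (gamma : R -> V) (s : R) d :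
  differentiable f (gamma s) -> is_derive s 1 gamma d -> is_derive s 1 (f \o gamma) ('d f (gamma s) d).
Proof.
move=> df [dg <-].
have dg' : differentiable gamma s by exact/derivable1_diffP.
have dc : differentiable (f \o gamma) s by exact: differentiable_comp.
apply: DeriveDef; first exact: diff_derivable.
by rewrite !deriveE// [LHS](congr1 (fun h => h 1) (diff_comp dg' df)).
Qed.

Lemma is_derive_row n (gamma : R -> 'rV[R]_n) (s : R) (d : 'rV[R]_n) :
  (forall j, is_derive s 1 (fun t => gamma t 0 j : R) (d 0 j)) ->
  is_derive s 1 gamma d.
Proof.
move=> H; have D : derivable gamma s 1.
  by apply/derivable_mxP => i j; rewrite ord1; case: (H j).
apply: DeriveDef => //; rewrite derive_mx//.
by apply/rowP => j; rewrite mxE; case: (H j).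
Qed.

Lemma is_derive_row_coord n (gamma : R -> 'rV[R]_n) (s : R) (d : 'rV[R]_n) j :
  is_derive s 1 gamma d -> is_derive s 1 (fun t => gamma t 0 j : R) (d 0 j).
Proof.
move=> [D <-]; apply: DeriveDef; first by move/derivable_mxP: D.
by rewrite derive_mx// mxE.
Qed.

Lemma is_derive_sumR n (f : 'I_n -> R -> R) (s : R) (d : 'I_n -> R) :
  (forall i, is_derive s 1 (f i) (d i)) ->
  is_derive s 1 (fun t => \sum_i f i t) (\sum_i d i).
Proof.
move=> H; rewrite (_ : (fun t => _) = \sum_i f i); first exact: is_derive_sum.
by apply/funext => t; rewrite fct_sumE.
Qed.

Lemma is_derive_mulmx n m (gamma : R -> 'rV[R]_n) (M : R -> 'M[R]_(n, m)) (s : R) d (M' : 'M[R]_(n, m)) :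
  is_derive s 1 gamma d ->
  (forall i j, is_derive s 1 (fun t => M t i j : R) (M' i j)) ->
  is_derive s 1 (fun t => gamma t *m M t) (d *m M s + gamma s *m M').
Proof.
move=> Hg HM; apply: is_derive_row => j.
rewrite (_ : (fun t => _) = (fun t => \sum_i (gamma t 0 i * M t i j))); last first.
  by apply/funext => t; rewrite mxE.
rewrite !mxE -big_split /=; apply: is_derive_sumR => i.
have H1 := is_derive_row_coord i Hg.
have [D1 D2] := @is_deriveM R _ (fun t => gamma t 0 i : R) (fun t => M t i j : R) s 1 _ _ H1 (HM i j).
apply: DeriveDef; first exact: D1.
apply: etrans D2 _; rewrite addrC /GRing.scale /=; congr (_ + _).
by rewrite mulrC.
Qed.

Lemma is_derive_shiftR (V : normedModType R) (gamma : R -> V) (s c : R) d :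
  is_derive (s + c) 1 gamma d -> is_derive s 1 (fun t => gamma (t + c)) d.
Proof.
move=> Hg.
have [dg <-] := Hg.
have dg' : differentiable gamma (s + c) by exact/derivable1_diffP.
have ds : is_diff s (fun t : R => t + c) (id : R -> R).
  by apply: is_diff_eq; apply/funext => t /=; rewrite addr0.
have ds' : differentiable (fun t : R => t + c) s by [].
have dc : differentiable (gamma \o (fun t : R => t + c)) s by exact: differentiable_comp.
apply: DeriveDef; first exact: (diff_derivable (f := gamma \o (fun t : R => t + c))).
rewrite [LHS](deriveE (1 : R) dc) [LHS](congr1 (fun h => h 1) (diff_comp ds' dg')) /=.
by rewrite diff_val deriveE.
Qed.

Lemma zero_derive_const (f : R -> R) (a : R) : 0 <= a ->
  (forall s, 0 <= s <= a -> is_derive s 1 f 0) -> f a = f 0.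
Proof.
move=> a0 H.
have Ho s : s \in `]0, a[ -> is_derive s 1 f ((fun=> 0) s).
  by rewrite in_itv/= => /andP[? ?]; apply: H; rewrite !ltW.
have cf : {within `[0, a], continuous f}.
  by apply: derivable_within_continuous => s; rewrite in_itv /= => /H[].
have [t _ E] := MVT_segment a0 Ho cf.
by apply/eqP; rewrite -subr_eq0 E mul0r.
Qed.

Lemma derivable_along (U W : normedModType R) (g : U -> W) x e :
  differentiable g x -> derivable g x e.
Proof. exact: diff_derivable. Qed.

Lemma derive_linear_comp (U W W' : normedModType R) (L : {linear W -> W'}) (g : U -> W) x e :
  continuous L -> differentiable g x -> 'D_e (L \o g) x = L ('D_e g x).
Proof.
move=> cL dg; have dL : differentiable L (g x) by exact: linear_differentiable.
have dc : differentiable (L \o g) x by exact: differentiable_comp.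
apply: etrans (deriveE _ dc) _.
apply: etrans (congr1 (fun f => f e) (diff_comp dg dL)) _.
apply: etrans (congr1 (fun f => f _) (diff_lin _ cL)) _.
by congr (L _); exact: esym (deriveE _ dg).
Qed.

Lemma derive_zero_line (U W : normedModType R) (g : U -> W) e :
  differentiable g 0 -> (\forall s \near (0 : R), g (s *: e) = 0) -> 'D_e g 0 = 0.
Proof.
move=> dg H.
have ds : is_derive (0 : R) (1 : R) (fun s : R => s *: e) e.
  have d1 : differentiable (fun s : R => s *: e) (0 : R) by [].
  apply: DeriveDef; first exact: diff_derivable.
  by rewrite deriveE// diff_val scale1r.
have dg0 : differentiable g ((0 : R) *: e) by rewrite scale0r.
have [_ D] := @is_derive_diff_comp U W g (fun s : R => s *: e) 0 e dg0 ds.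
apply: etrans (deriveE _ dg) _.
have E : 'd g ((0 : R) *: e) e = 0.
  apply: etrans (esym D) _.
  by rewrite -(derive_cst (0 : W) (0 : R) (1 : R)); exact: near_eq_derive.
by move: E; rewrite scale0r.
Qed.

End Curves.
Arguments derivable_along {R U W g x} e _.

Section OneParameterGroup.
Variables (R : realType) (n : nat) (phi : R -> {linear 'rV[R]_n -> 'rV[R]_n}).
Hypothesis phi0 : forall x, phi 0 x = x.
Hypothesis phiD : forall s t x, phi (s + t) x = phi s (phi t x).
Hypothesis phic : forall x, continuous (fun s => phi s x).

(** A continuous one-parameter group is differentiable because averaging smooths
    it: with [F] an antiderivative, the average of [phi] over a short interval
    [[0, a]] is an invertible matrix, and applying [phi t] to it gives the average
    over [[t, t + a]], which is differentiable in [t]. *)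
Lemma one_parameter_derivable0 x : derivable (fun s => phi s x) 0 1.
Proof.
have cU i j : continuous (fun s => phi s (delta_mx 0 i) 0 j : R).
  move=> s; apply: (@continuous_comp _ _ _ (fun s => phi s (delta_mx 0 i))
     (fun y : 'rV[R]_n => y 0 j : R)); first exact: phic.
  exact: coord_continuous.
pose F i j := projT1 (cid (antiderivative (cU i j))).
have FP i j (s : R) : -1 < s < 1 -> is_derive s 1 (F i j) (phi s (delta_mx 0 i) 0 j).
  exact: projT2 (cid (antiderivative (cU i j))) s.
pose Fm (s : R) : 'M[R]_n := \matrix_(i, j) F i j s.
have dF y (s : R) : -1 < s < 1 -> is_derive s 1 (fun s => y *m Fm s) (phi s y).
  move=> s1; have Dy : is_derive s (1 : R) (fun _ : R => y) 0 by exact: is_derive_cst.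
  have := @is_derive_mulmx R n n (fun _ => y) Fm s 0
    (\matrix_(i, j) phi s (delta_mx 0 i) 0 j) Dy.
  rewrite mul0mx add0r (_ : y *m _ = phi s y).
    apply=> i j; rewrite mxE (_ : (fun t => _) = F i j); first exact: FP.
    by apply/funext => t; rewrite mxE.
  rewrite [in RHS](row_sum_delta y) linear_sum mulmx_sum_row; apply: eq_bigr => i _.
  by rewrite linearZ; congr (_ *: _); apply/rowP => j; rewrite !mxE.
(* for small [a] the averages [(Fm a - Fm 0) / a] are close to the identity *)
have [a /andP[a0 a1] aW] : exists2 a : R, 0 < a < 1 & Fm a - Fm 0 \in unitmx.
  have N : \forall a \near (0 : R)^'+, forall ij : 'I_n * 'I_n,
     `|a^-1 * (F ij.1 ij.2 a - F ij.1 ij.2 0) - (ij.1 == ij.2)%:R| < (2 * n.+1%:R)^-1.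
    apply: filter_forall => -[i j] /=.
    have z1 : -1 < (0 : R) < 1 by rewrite oppr_lt0 ltr01.
    have [D1 D2] := FP i j 0 z1.
    have DE : 'D_1 (F i j) 0 = ((i == j)%:R : R).
      by rewrite D2 phi0 mxE eqxx eq_sym.
    have cv : (fun h : R => h^-1 *: ((F i j \o shift 0) (h *: 1) - F i j 0)) @ 0^'
        --> ((i == j)%:R : R).
      by rewrite -DE; exact: D1.
    have e0 : 0 < (2 * n.+1%:R)^-1 :> R by rewrite invr_gt0 mulr_gt0.
    have /cvgrPdist_lt/(_ _ e0) H := cv.
    have : \forall h \near (0 : R)^'+, `|(i == j)%:R - h^-1 *: ((F i j \o shift 0) (h *: 1) - F i j 0)| < (2 * n.+1%:R)^-1.
      move: H; rewrite !near_withinE; apply: filterS => h Hh h0; apply: Hh.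
      by rewrite gt_eqF.
    apply: filterS => h; rewrite distrC /= addr0 /GRing.scale /=.
    by rewrite mulr1.
  have N1 : \forall a \near (0 : R)^'+, a < 1 by apply: nbhs_right_lt.
  have N2 : \forall a \near (0 : R)^'+, 0 < a by apply: nbhs_right_gt.
  have [a [[Na a1] a0]] := filter_ex (filterI (filterI N N1) N2).
  exists a; first by rewrite a0.
  rewrite unitmxE unitfE; apply/det0P => -[w w0 wM].
  have wn : 0 < `|w| by rewrite normr_gt0.
  have : `|w| <= 2^-1 * `|w|.
    apply: rV_norm_le => [|i j]; first by rewrite mulr_ge0// invr_ge0.
    rewrite ord1 {i}.
    have E : w 0 j = - \sum_i w 0 i * (a^-1 * (F i j a - F i j 0) - (i == j)%:R).
      under eq_bigr do rewrite mulrBr.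
      rewrite sumrB opprB (bigD1 j)//= eqxx mulr1 big1 ?addr0; last first.
        by move=> i /negPf->; rewrite mulr0.
      have := congr1 (fun M : 'rV[R]_n => a^-1 * M 0 j) wM.
      rewrite !mxE mulr0 mulr_sumr (eq_bigr (fun i => w 0 i * (a^-1 * (F i j a - F i j 0)))).
        by move=> ->; rewrite subr0.
      by move=> i _; rewrite !mxE mulrCA.
    rewrite E normrN; apply: le_trans (ler_norm_sum _ _ _) _.
    have -> : 2^-1 * `|w| = \sum_(i < n.+1) (`|w| * (2 * n.+1%:R)^-1).
      rewrite sumr_const card_ord -[RHS]mulr_natr.
      have : (n.+1%:R : R) != 0 by rewrite pnatr_eq0.
      by move: (n.+1%:R) (`|w|) => N' w' N0; field.
    rewrite big_ord_recr /= -[leLHS]addr0; apply: lerD; last first.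
      by rewrite mulr_ge0// invr_ge0 mulr_ge0.
    apply: ler_sum => i _; rewrite normrM; apply: ler_pM => //; first exact: rV_coord_le.
    by apply: ltW; exact: (Na (i, j)).
  by lra.
pose y := x *m invmx (Fm a - Fm 0).
have xE : x = y *m Fm a - y *m Fm 0 by rewrite -mulmxBr mulmxKV.
have key (t : R) : -1 < t -> t + a < 1 ->
    phi t x = y *m Fm (t + a) - y *m Fm t.
  move=> t0 t1.
  have Dh (s : R) : 0 <= s <= a ->
      is_derive s 1 (fun s => phi t (y *m Fm s) - y *m Fm (s + t)) 0.
    move=> /andP[s0 sa].
    have s1 : -1 < s < 1 by apply/andP; split; lra.
    have st1 : -1 < s + t < 1 by apply/andP; split; lra.
    have H1 := is_derive_linear_comp (@linear_rV_continuous _ _ _ (phi t)) (dF y s s1).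
    have H2 := is_derive_shiftR (dF y _ st1).
    have := is_deriveB H1 H2.
    by rewrite -phiD [t + s]addrC subrr; exact.
  have E : phi t (y *m Fm a) - y *m Fm (a + t) = phi t (y *m Fm 0) - y *m Fm (0 + t).
    apply/rowP => j.
    apply: (zero_derive_const (f := fun s => (phi t (y *m Fm s) - y *m Fm (s + t)) 0 j)).
      exact: ltW.
    move=> s sa; have := is_derive_row_coord j (Dh s sa).
    by rewrite mxE.
  rewrite {1}xE linearB /= [t + a]addrC.
  move: E; rewrite add0r; move: (phi t (y *m Fm a)) (phi t (y *m Fm 0)) (y *m Fm (a + t)) (y *m Fm t) => A B C D E.
  have -> : A = B - D + C by rewrite -E subrK.
  by rewrite addrAC [B - D - B]addrAC subrr add0r addrC.
have D : is_derive (0 : R) 1 (fun t => y *m Fm (t + a) - y *m Fm t) (phi a y - phi 0 y).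
  have z1 : -1 < (0 : R) < 1 by rewrite oppr_lt0 ltr01.
  have a1' : -1 < 0 + a < 1 by apply/andP; split; lra.
  have H1 := is_derive_shiftR (dF y _ a1'); rewrite add0r in H1.
  exact: is_deriveB H1 (dF y _ z1).
have [D' _] := D; apply: near_eq_derivable D'.
have N1 : \forall t \near (0 : R), t + a < 1.
  have : \forall t \near (0 : R), t < 1 - a by apply: lt_nbhsl; rewrite subr_gt0.
  by apply: filterS => t; rewrite ltrBrDr.
have N2 : \forall t \near (0 : R), -1 < t by apply: lt_nbhsr; rewrite oppr_lt0 ltr01.
by apply: filterS2 N1 N2 => t t1 t0; rewrite key.
Qed.

End OneParameterGroup.

(** * The infinitesimal action *)

Section Infinitesimal.
Variables (R : realType) (G : topGroupType) (T : set G) (t : vectType R) (exp : t -> G).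
Hypothesis hexp : lie_algebra_exp T exp.
Variables (n : nat) (act : G -> 'rV[R]_n -> 'rV[R]_n).
Hypothesis hact : representation act.
Implicit Types (zeta eta : t) (x y w : 'rV[R]_n) (g k : G).

Lemma act_linear g : linear (act g). Proof. by have [H _ _ _] := hact. Qed.

Definition actL g : {linear 'rV[R]_n -> 'rV[R]_n} :=
  HB.pack (act g) (GRing.isLinear.Build _ _ _ _ _ (act_linear g)).

Lemma act1 x : act 1%g x = x. Proof. by have [_ H _ _] := hact. Qed.

Lemma actM g k x : act (g * k)%g x = act g (act k x).
Proof. by have [_ _ H _] := hact. Qed.

Lemma actKV g x : act g (act g^-1%g x) = x.
Proof. by rewrite -actM mulgV act1. Qed.

Lemma actVK g x : act g^-1%g (act g x) = x.
Proof. by rewrite -actM mulVg act1. Qed.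

Lemma act_continuous x : continuous (fun g => act g x).
Proof.
have [_ _ _ H] := hact; move=> g.
apply: (@continuous_comp _ _ _ (fun g => (g, x)) (fun p : G * 'rV[R]_n => act p.1 p.2)).
  exact: (@cvg_pair G G 'rV[R]_n (nbhs g) (nbhs g) (nbhs x) _ _ _ (fun g => g) (fun=> x) (@cvg_id _ _) (@cvg_cst _ x _ _ _)).
exact: H.
Qed.

Lemma expD zeta eta : exp (zeta + eta) = (exp zeta * exp eta)%g.
Proof. by have [H _ _ _] := hexp. Qed.

Lemma exp0 : exp 0 = 1%g.
Proof.
have := expD 0 0; rewrite addr0 -{1}[exp 0]mulg1 => /mulgI.
by [].
Qed.

Definition flow zeta (s : R) : {linear 'rV[R]_n -> 'rV[R]_n} := actL (exp (s *: zeta)).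

Lemma flow0 zeta x : flow zeta 0 x = x.
Proof. by rewrite /flow /= scale0r exp0 act1. Qed.

Lemma flowD zeta s s' x : flow zeta (s + s') x = flow zeta s (flow zeta s' x).
Proof. by rewrite /flow /= scalerDl expD actM. Qed.

Lemma flow_continuous zeta x : continuous (fun s => flow zeta s x).
Proof.
have [_ H _ _] := hexp; have [c _ _] := H zeta; move=> s.
apply: (@continuous_comp _ _ _ (exp_line exp zeta) (fun g => act g x)).
  exact: c.
exact: act_continuous.
Qed.

Definition lie_act zeta x := inf_act act (exp_line exp zeta) x.

Lemma lie_act_derive zeta x : is_derive (0 : R) 1 (fun s => flow zeta s x) (lie_act zeta x).
Proof.
apply: DeriveDef; last by rewrite /lie_act /inf_act derive1E.
have := @one_parameter_derivable0 R n (flow zeta) (flow0 zeta) (flowD zeta) (@flow_continuous zeta) x.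
exact.
Qed.

Lemma lie_act_eq zeta x d : is_derive (0 : R) 1 (fun s => flow zeta s x) d -> lie_act zeta x = d.
Proof. by case=> _ <-; rewrite /lie_act /inf_act derive1E. Qed.

Lemma lie_act_linear zeta : linear (lie_act zeta).
Proof.
move=> c x y; apply: lie_act_eq.
have H := is_deriveD (is_deriveZ c (lie_act_derive zeta x)) (lie_act_derive zeta y).
rewrite (_ : (fun s => _) = c \*: (fun s => flow zeta s x) + (fun s => flow zeta s y)) //.
by apply/funext => s; rewrite linearP.
Qed.

Definition lie_actL zeta : {linear 'rV[R]_n -> 'rV[R]_n} :=
  HB.pack (lie_act zeta) (GRing.isLinear.Build _ _ _ _ _ (lie_act_linear zeta)).

Lemma flow_curve_derive zeta (gamma : R -> 'rV[R]_n) d :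
  is_derive (0 : R) 1 gamma d ->
  is_derive (0 : R) 1 (fun s => flow zeta s (gamma s)) (d + lie_act zeta (gamma 0)).
Proof.
move=> Hg.
pose M (s : R) : 'M[R]_n := lin1_mx (flow zeta s).
have HM i j : is_derive (0 : R) 1 (fun s => M s i j : R) ((lin1_mx (lie_actL zeta)) i j).
  rewrite mxE (_ : (fun s => _) = (fun s => flow zeta s (delta_mx 0 i) 0 j : R)).
    exact: is_derive_row_coord (lie_act_derive zeta _).
  by apply/funext => s; rewrite mxE.
have := is_derive_mulmx Hg HM.
rewrite !mul_rV_lin1 flow0 /=; congr is_derive.
by apply/funext => s; rewrite mul_rV_lin1.
Qed.

(** The product rule for the flow of [zeta] applied to an orbit of [eta], as the
    torus is abelian. *)
Lemma lie_actD zeta eta x : lie_act (zeta + eta) x = lie_act zeta x + lie_act eta x.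
Proof.
apply: lie_act_eq; have := flow_curve_derive zeta (lie_act_derive eta x).
rewrite flow0 addrC; congr is_derive.
by apply/funext => s; rewrite /flow /= scalerDr expD actM.
Qed.

Lemma lie_actZ c zeta x : lie_act (c *: zeta) x = c *: lie_act zeta x.
Proof.
apply: lie_act_eq.
have ds : is_derive (0 : R) (1 : R) (fun s : R => s * c) c.
  have := @is_deriveM R _ (id : R -> R) (fun=> c) 0 1 _ _ (is_derive_id _ _) (is_derive_cst _ _ _).
  by rewrite scaler0 add0r /GRing.scale /= mulr1.
have H := lie_act_derive zeta x.
have df : differentiable (fun s => flow zeta s x) (0 * c).
  by rewrite mul0r; apply/derivable1_diffP; case: H.
have := @is_derive_diff_comp R _ _ (fun s : R => flow zeta s x) (fun s : R => s * c) 0 c df ds.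
rewrite mul0r => D.
have -> : c *: lie_act zeta x = 'd (fun s => flow zeta s x) (0 : R) c.
  rewrite -[in RHS](mulr1 c) [RHS]linearZ; congr (_ *: _).
  case: H => H1 <-; rewrite deriveE//.
  exact/derivable1_diffP.
move: D; congr is_derive; apply/funext => s.
by rewrite /flow /= scalerA.
Qed.

Lemma lie_actN zeta x : lie_act (- zeta) x = - lie_act zeta x.
Proof. by rewrite -scaleN1r lie_actZ scaleN1r. Qed.

Lemma lie_act_commute zeta (L : {linear 'rV[R]_n -> 'rV[R]_n}) x :
  (forall s y, L (flow zeta s y) = flow zeta s (L y)) ->
  L (lie_act zeta x) = lie_act zeta (L x).
Proof.
move=> H; symmetry; apply: lie_act_eq.
have := is_derive_linear_comp (@linear_rV_continuous _ _ _ L) (lie_act_derive zeta x).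
by congr is_derive; apply/funext => s /=; rewrite H.
Qed.

Lemma exp_comm zeta eta : (exp zeta * exp eta = exp eta * exp zeta)%g.
Proof. by rewrite -!expD addrC. Qed.

Lemma lie_act_exp zeta eta x : act (exp eta) (lie_act zeta x) = lie_act zeta (act (exp eta) x).
Proof.
apply: (@lie_act_commute zeta (actL (exp eta))) => s y.
by rewrite /flow /= -!actM exp_comm.
Qed.

Lemma lie_act_lie_act zeta eta x : lie_act eta (lie_act zeta x) = lie_act zeta (lie_act eta x).
Proof.
apply: (@lie_act_commute zeta (lie_actL eta)) => s y.
by rewrite /flow /= lie_act_exp.
Qed.

Lemma lie_act_skew (b : 'rV[R]_n -> 'rV[R]_n -> R) zeta x y :
  invariant_form act b -> b (lie_act zeta x) y = - b x (lie_act zeta y).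
Proof.
move=> [bl br binv].
pose bL : {linear 'rV[R]_n -> R^o} := HB.pack (b^~ y : _ -> R^o) (GRing.isLinear.Build _ _ _ _ _ (bl y)).
pose bR : {linear 'rV[R]_n -> R^o} := HB.pack (b x : _ -> R^o) (GRing.isLinear.Build _ _ _ _ _ (br x)).
have H1 := is_derive_linear_comp (@linear_rV_continuous _ _ _ bL) (lie_act_derive zeta x).
have H2 := is_derive_linear_comp (@linear_rV_continuous _ _ _ bR) (lie_act_derive (- zeta) y).
have E : bL \o (fun s => flow zeta s x) = bR \o (fun s => flow (- zeta) s y).
  apply/funext => s /=; rewrite -(binv (exp (s *: - zeta)) (act (exp (s *: zeta)) x) y).
  by rewrite -actM -expD scalerN addNr exp0 act1.
have [_ D1] := H1; have [_ D2] := H2.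
have -> : b (lie_act zeta x) y = b x (lie_act (- zeta) y).
  rewrite -[LHS]/(bL (lie_act zeta x)) -[RHS]/(bR (lie_act (- zeta) y)).
  by rewrite -D1 -D2 E.
by rewrite lie_actN -[LHS]/(bR (- lie_act zeta y)) linearN.
Qed.

Lemma lie_act_invariant (f : 'rV[R]_n -> R^o) zeta x :
  (forall g y, f (act g y) = f y) -> differentiable f x -> 'd f x (lie_act zeta x) = 0.
Proof.
move=> finv df.
have df' : differentiable f (flow zeta 0 x) by rewrite flow0.
have [_ D] := is_derive_diff_comp df' (lie_act_derive zeta x).
rewrite flow0 in D; rewrite -D.
have -> : f \o (fun s => flow zeta s x) = cst (f x).
  by apply/funext => s /=; rewrite finv.
exact: derive_cst.
Qed.

End Infinitesimal.

(** * Vectors fixed by an isotropy group *)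

Section Isotropy.
Variables (R : realType) (G : topGroupType) (T : set G) (t : vectType R) (exp : t -> G).
Hypothesis hexp : lie_algebra_exp T exp.
Variables (n : nat) (act : G -> 'rV[R]_n -> 'rV[R]_n).
Hypothesis hact : representation act.
Hypothesis hGcompact : compact [set: G].

Local Notation lie_act := (lie_act exp act).

Lemma act_bound : exists2 C : R, 1 <= C & forall g x, `|act g x| <= C * `|x|.
Proof.
have H (i : 'I_n) : exists C : R, forall g, `|act g (delta_mx 0 i)| <= C.
  have cf : {within [set: G], continuous (fun g => `|act g (delta_mx 0 i)| : R)}.
    apply: continuous_subspaceT => g.
    apply: (@continuous_comp _ _ _ (fun g => act g (delta_mx 0 i))); last exact: norm_continuous.
    exact: act_continuous.
  have [|g _ Hg] := compact_EVT_max _ hGcompact cf; first by exists 1%g.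
  by exists `|act g (delta_mx 0 i)| => g'; apply: Hg; rewrite inE.
pose C i := projT1 (cid (H i)).
have CP i g : `|act g (delta_mx 0 i)| <= C i := projT2 (cid (H i)) g.
exists (1 + \sum_i `|C i|); first by rewrite lerDl sumr_ge0.
move=> g x; rewrite {1}(row_sum_delta x) -[act g _]/(actL hact g _) linear_sum /=.
apply: le_trans (ler_norm_sum _ _ _) _.
rewrite mulrDl mul1r -[leLHS]add0r lerD// mulr_suml; apply: ler_sum => i _.
have E1 : act g (x 0 i *: delta_mx 0 i) = x 0 i *: act g (delta_mx 0 i).
  exact: (linearZZ (actL hact g)).
rewrite E1 normrZ mulrC; apply: ler_pM => //; last exact: rV_coord_le.
exact: le_trans (CP i g) (ler_norm _).
Qed.


(** A cluster point replaces the limit of a subsequence; it inherits every closed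
    condition that holds eventually. *)
Lemma compact_closed_eventually (u : nat -> G) : exists g,
  forall A : set G, closed A -> (\forall m \near \oo, A (u m)) -> A g.
Proof.
have PF : ProperFilter (u @ \oo) by exact: fmap_proper_filter.
have [|g [_ Hg]] := hGcompact PF; first exact: filterT.
exists g => A cA HA; apply: cA => B nB.
by apply: Hg => //; exact: HA.
Qed.

Lemma act_pow_dist C g x m : (forall k y, `|act k y| <= C * `|y|) ->
  `|act (g ^+ m)%g x - x| <= m%:R * C * `|act g x - x|.
Proof.
move=> HC; elim: m => [|m IH].
  by rewrite expg0 (act1 hact) subrr normr0 !mul0r.
rewrite expgSr (actM hact) -(subrKA (act (g ^+ m)%g x)).
rewrite -[X in `|X + _|](linearB (actL hact (g ^+ m)%g)) /=.
apply: le_trans (ler_normD _ _) _.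
rewrite -natr1 !mulrDl mul1r addrC; apply: lerD => //; exact: HC.
Qed.

(** Telescoping along the powers of [g], with the uniform bound of the compact
    group action, keeps the error of [m] small steps with increment [v] quadratic
    in the total displacement. *)
Lemma act_pow_linear_dist C g x v m : 1 <= C -> (forall k y, `|act k y| <= C * `|y|) ->
  `|act (g ^+ m)%g x - x - m%:R *: v| <=
    m%:R * C * `|act g x - x - v| + m%:R ^+ 2 * C * `|act g v - v|.
Proof.
move=> C1 HC; elim: m => [|m IH].
  by rewrite expg0 (act1 hact) subrr scale0r subr0 normr0 expr0n /= !mul0r addr0.
have -> : act (g ^+ m.+1)%g x - x - m.+1%:R *: v =
    actL hact (g ^+ m)%g (act g x - x - v) + (act (g ^+ m)%g v - v) +
    (act (g ^+ m)%g x - x - m%:R *: v).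
  rewrite expgSr (actM hact) !linearB /= -natr1 scalerDl scale1r.
  apply/rowP => j; rewrite !mxE; ring.
apply: le_trans (ler_normD _ _) _.
have A : `|actL hact (g ^+ m)%g (act g x - x - v) + (act (g ^+ m)%g v - v)| <=
   C * `|act g x - x - v| + m%:R * C * `|act g v - v|.
  apply: le_trans (ler_normD _ _) _; apply: lerD; first exact: HC.
  exact: act_pow_dist.
apply: le_trans (lerD A IH) _.
have p1 := normr_ge0 (act g x - x - v); have p2 := normr_ge0 (act g v - v).
rewrite -natr1; move: p1 p2.
move: (`|act g x - x - v|) (`|act g v - v|) => p q p0 q0.
have m0 : (0 : R) <= m%:R by [].
have K : 0 <= C * q * (m%:R + 1).
  by rewrite mulr_ge0 ?addr_ge0// mulr_ge0// (le_trans ler01).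
rewrite -subr_ge0.
by have <- : C * q * (m%:R + 1) = (m%:R + 1) * C * p + (m%:R + 1) ^+ 2 * C * q -
   (C * p + m%:R * C * q + (m%:R * C * p + m%:R ^+ 2 * C * q)) by ring.
Qed.

(** For [k] in the isotropy group [K] of [x], the curve
    [gam s = k exp(s zeta) k^-1 exp(- s zeta)] has velocity
    [Y = k zeta k^-1 - zeta] at [0], and [Y x = 0] by the first hypothesis. The
    elements [(gam (tau / m))^m] have a cluster point [g] in the compact group [G];
    it fixes [x], as [Y x = 0], hence it fixes [u]. But it moves [u] by [tau Y u] up
    to [O(tau^2)], so [Y u = 0], which is the claim. *)
Lemma lie_act_isotropy zeta x u :
  (forall k, act k x = x -> act k (lie_act zeta x) = lie_act zeta x) ->
  (forall k, act k x = x -> act k u = u) ->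
  forall k, act k x = x -> act k (lie_act zeta u) = lie_act zeta u.
Proof.
move=> Hx Hu k kx.
have [C C1 HC] := act_bound.
pose gam s := (k * exp (s *: zeta) * k^-1 * exp (s *: - zeta))%g.
pose Y w := act k (lie_act zeta (act k^-1%g w)) - lie_act zeta w.
have dgam w : is_derive (0 : R) 1 (fun s => act (gam s) w) (Y w).
  have H1 := lie_act_derive hexp hact (- zeta) w.
  have H2 := is_derive_linear_comp (@linear_rV_continuous _ _ _ (actL hact k^-1%g)) H1.
  have H3 := flow_curve_derive hexp hact zeta H2.
  have := is_derive_linear_comp (@linear_rV_continuous _ _ _ (actL hact k)) H3.
  have E0 : (actL hact k^-1%g \o (fun s => flow exp hact (- zeta) s w)) 0 = act k^-1%g w.
    by rewrite /= scale0r (exp0 hexp) (act1 hact).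
  rewrite E0 linearD /= (lie_actN hexp hact).
  have -> : act k (act k^-1%g (- lie_act zeta w)) = - lie_act zeta w.
    by rewrite (actKV hact).
  rewrite addrC; congr is_derive.
  by apply/funext => s; rewrite /gam !(actM hact).
have eps w e : 0 < e -> \forall s \near (0 : R), `|act (gam s) w - w - s *: Y w| <= e * `|s|.
  move=> e0; have [D1 D2] := dgam w.
  have D1' : differentiable (fun s => act (gam s) w) (0 : R) by exact/derivable1_diffP.
  have g0 : gam 0 = 1%g.
    by rewrite /gam !scale0r (exp0 hexp) !mulg1 mulgV.
  have := differentiable_eps D1' e0; apply: filterS => s.
  rewrite subr0 g0 (act1 hact).
  have -> // : 'd (fun s => act (gam s) w) (0 : R) s = s *: Y w.
  by rewrite -{1}(mulr1 s) linearZ /= -D2 deriveE.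
have Yx : Y x = 0.
  have kVx : act k^-1%g x = x by rewrite -{1}kx (actVK hact).
  by rewrite /Y kVx Hx// subrr.
suff Yu : Y u = 0.
  have kVu : act k^-1%g u = u by rewrite -{1}(Hu k kx) (actVK hact).
  by move/eqP: Yu; rewrite /Y kVu subr_eq0 => /eqP.
have C0 : 0 < C by exact: lt_le_trans C1.
pose K := C * (`|Y (Y u)| + 2).
(* the constant [K] is chosen so that the errors of order [tau ^+ 2] below add up to it *)
have small tau : 0 < tau -> `|tau *: Y u| <= K * tau ^+ 2.
  move=> tau0.
  have lim0 : (fun m => tau * m.+1%:R^-1) @ \oo --> (0 : R).
    by rewrite -(mulr0 tau); apply: cvgMr; exact: cvg_harmonic.
  pose s m : R := tau * m.+1%:R^-1.
  have seq0 (P : set R) : (\forall s \near (0 : R), P s) -> \forall m \near \oo, P (s m).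
    exact: lim0.
  have [g Hg] := compact_closed_eventually (fun m => (gam (s m) ^+ m.+1)%g).
  have sm m : m.+1%:R * `|s m| = tau.
    by rewrite ger0_norm ?mulr_ge0 ?ltW// mulrCA divff ?mulr1// pnatr_eq0.
  have closed_le_act w y e : closed [set h | `|act h w - y| <= e].
    rewrite (_ : mkset _ = (fun h => `|act h w - y|) @^-1` [set x | x <= e])//.
    apply: closed_comp; last exact: closed_le.
    move=> h _; apply: continuous_comp; last exact: norm_continuous.
    have FF : Filter (nbhs h) by exact: nbhs_filter.
    exact: (@cvgB _ _ _ (nbhs h) FF (fun h => act h w) (fun=> y) _ _
      (@act_continuous _ _ _ _ hact w h) (@cvg_cst _ y _ _ _)).
  have gx : act g x = x.
    apply/eqP; rewrite -subr_eq0 -normr_le0; apply/ler_addgt0Pr => e e0; rewrite add0r.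
    apply: (Hg [set h | `|act h x - x| <= e]); first exact: closed_le_act.
    have e'0 : 0 < e / C / tau by rewrite !divr_gt0.
    apply: filterS (seq0 _ (eps x _ e'0)) => m /=.
    rewrite Yx scaler0 subr0 => Hm.
    apply: le_trans (act_pow_dist _ _ _ HC) _.
    have A : m.+1%:R * C * `|act (gam (s m)) x - x| <= m.+1%:R * C * (e / C / tau * `|s m|).
      by rewrite ler_wpM2l// mulr_ge0// ltW.
    apply: le_trans A _; rewrite le_eqVlt; apply/orP; left; apply/eqP.
    move: (sm m); move: (m.+1%:R : R) (`|s m|) => N r E.
    have -> : N * C * (e / C / tau * r) = N * r / tau * e by field; rewrite !gt_eqF.
    by rewrite E divff ?mul1r// gt_eqF.
  have gu : act g u = u by exact: Hu.
  suff S : `|act g u - (u + tau *: Y u)| <= K * tau ^+ 2.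
    have E : `|tau *: Y u| = `|act g u - (u + tau *: Y u)|.
      by rewrite gu opprD addrA subrr sub0r normrN.
    by rewrite E.
  apply: (Hg [set h | `|act h u - (u + tau *: Y u)| <= K * tau ^+ 2]).
    exact: closed_le_act.
  have N1 := seq0 _ (eps u _ tau0).
  have N2 := seq0 _ (eps (Y u) _ ltr01).
  apply: filterS2 N1 N2 => m /= H1 H2.
  rewrite opprD addrA.
  have -> : tau *: Y u = m.+1%:R *: (s m *: Y u).
    by rewrite scalerA /s mulrCA divff ?mulr1// pnatr_eq0.
  apply: le_trans (act_pow_linear_dist _ _ _ _ C1 HC) _.
  have H3 : `|act (gam (s m)) (s m *: Y u) - s m *: Y u| <= `|s m| * ((`|Y (Y u)| + 1) * `|s m|).
    have E1 : act (gam (s m)) (s m *: Y u) = s m *: act (gam (s m)) (Y u).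
      exact: (linearZZ (actL hact (gam (s m)))).
    rewrite E1 -scalerBr normrZ ler_wpM2l//.
    rewrite -[X in `|X|](subrK (s m *: Y (Y u))).
    apply: le_trans (ler_normD _ _) _; rewrite normrZ mulrDl [X in _ <= X]addrC mul1r.
    by rewrite [`|s m| * _]mulrC lerD// -[leRHS]mul1r.
  have sm' := sm m.
  move: H1 H3 sm'; rewrite /K; move: (`|act _ u - u - _|) (`|act _ _ - _|) (`|s m|) (normr_ge0 (s m)).
  move=> p q r r0; move: (`|_|) (normr_ge0 (Y (Y u))) => y y0 H1 H3 E.
  have m0 : (0 : R) <= m.+1%:R by [].
  move: (m.+1%:R : R) m0 E => N N0 E.
  apply: (@le_trans _ _ (N * C * (tau * r) + N ^+ 2 * C * (r * ((y + 1) * r)))).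
    by apply: lerD; rewrite ler_wpM2l// ?mulr_ge0 ?exprn_ge0// ltW.
  rewrite le_eqVlt; apply/orP; left; apply/eqP.
  by rewrite -E; ring.
apply/eqP; rewrite -normr_le0; apply/ler_addgt0Pr => e e0; rewrite add0r.
have K0 : 0 < K by rewrite mulr_gt0// ltr_wpDl.
have tau0 : 0 < e / K by rewrite divr_gt0.
have := small _ tau0; rewrite normrZ gtr0_norm//.
have -> : K * (e / K) ^+ 2 = e / K * e by field; rewrite gt_eqF.
by rewrite ler_pM2l.
Qed.

End Isotropy.

(** * Spectral decomposition of invariant subspaces *)

Section Subspace.
Variables (R : realType) (n : nat).
Local Notation V := 'rV[R]_n.

(** Subspaces as sets: the fixed vectors of a group come as a property, without a
    basis. *)
Definition lin_sub (E : set V) := E 0 /\ forall c u v, E u -> E v -> E (c *: u + v).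

Lemma lin_subD E u v : lin_sub E -> E u -> E v -> E (u + v).
Proof. by move=> [_ H] Eu Ev; rewrite -[u]scale1r; exact: H. Qed.

Lemma lin_subZ E c u : lin_sub E -> E u -> E (c *: u).
Proof. by move=> [E0 H] Eu; rewrite -[_ *: _]addr0; exact: H. Qed.

Lemma lin_subB E u v : lin_sub E -> E u -> E v -> E (u - v).
Proof. by move=> HE Eu Ev; rewrite -scaleN1r; apply: lin_subD => //; exact: lin_subZ. Qed.

(** A subspace of maximal dimension contained in [E] exhausts it. *)
Lemma lin_sub_vspace E : lin_sub E -> exists W : {vspace V}, forall u, E u <-> u \in W.
Proof.
move=> HE.
pose P d := `[< exists W : {vspace V}, (forall u, u \in W -> E u) /\ \dim W = d >].
have P0 : exists d, P d.
  exists 0%N; apply/asboolP; exists 0%VS; split; last by rewrite dimv0.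
  by move=> u; rewrite memv0 => /eqP->; case: HE.
have Pn d : P d -> (d <= \dim {:V})%N.
  by move=> /asboolP[W [_ <-]]; apply: dimvS; exact: subvf.
have [d /asboolP[W [WE dW]] dmax] := ex_maxnP P0 Pn.
exists W => u; split; last exact: WE.
move=> Eu; apply: contrapT => /negP uW.
have : P (\dim (W + <[u]>)%VS).
  apply/asboolP; exists (W + <[u]>)%VS; split=> // _ /memv_addP[x xW [_ /vlineP[c ->] ->]].
  by apply: lin_subD => //; [exact: WE|exact: lin_subZ].
move=> /dmax; rewrite -dW => le.
have sub : (W <= W + <[u]>)%VS by exact: addvSl.
have /eqP E1 : W == (W + <[u]>)%VS by rewrite eqEdim sub le.
by move: uW; rewrite E1 (subvP (addvSr W <[u]>)) ?memv_line.
Qed.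

Lemma lin_sub_stable_inj E (F : {linear V -> V}) : lin_sub E ->
  (forall u, E u -> E (F u)) -> (forall u, E u -> F u = 0 -> u = 0) ->
  forall w, E w -> exists2 u, E u & F u = w.
Proof.
move=> HE FE Finj w Ew; have [W HW] := lin_sub_vspace HE.
pose f : 'End(V) := linfun F.
have fE u : f u = F u by rewrite lfunE.
have sub : (f @: W <= W)%VS.
  by apply/subvP => _ /memv_imgP[u uW ->]; rewrite fE; apply/HW/FE/HW.
have dim : \dim (f @: W) = \dim W.
  apply: limg_dim_eq; apply/eqP; rewrite -subv0; apply/subvP => u.
  rewrite memv_cap memv_ker memv0 fE => /andP[uW /eqP Fu0].
  by apply/eqP/Finj => //; apply/HW.
have /eqP E1 : (f @: W)%VS == W by rewrite eqEdim sub dim leqnn.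
have : w \in W by apply/HW.
rewrite -E1 => /memv_imgP[u uW ->].
by exists u; [apply/HW|rewrite fE].
Qed.

(** A subspace stable under [B] contains the components of its elements in the sum
    of the images of the [p j], as soon as [B ^ 2] is a scalar on each image and
    no such scalar is an eigenvalue of [B ^ 2] on the common kernel. The proof
    removes one [p j] at a time: [B ^ 2 + c j] kills the image of [p j] and is
    invertible on the elements of [E] in the common kernel. *)
Lemma lin_sub_spectral k (p : 'I_k -> {linear V -> V}) (B : {linear V -> V})
    (c : 'I_k -> R) (E : set V) :
  let P x := \sum_j p j x in
  (forall x, P (P x) = P x) ->
  (forall j x, p j (B x) = B (p j x)) ->
  (forall j x, B (B (p j x)) + c j *: p j x = 0) ->
  (forall j u, P u = 0 -> B (B u) + c j *: u = 0 -> u = 0) ->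
  lin_sub E -> (forall u, E u -> E (B u)) -> forall y, E y -> E (P y).
Proof.
move=> P plane_proj_idem pB Bp Binj HE BE y Ey.
have P0 : P 0 = 0 by rewrite /P big1// => j _; rewrite linear0.
have PD x z : P (x + z) = P x + P z.
  by rewrite /P -big_split; apply: eq_bigr => j _; rewrite linearD.
have PZ d x : P (d *: x) = d *: P x.
  by rewrite /P scaler_sumr; apply: eq_bigr => j _; rewrite linearZ.
have PB x : P (B x) = B (P x).
  by rewrite /P linear_sum; apply: eq_bigr => j _.
suff H (s : seq 'I_k) : forall y, E y -> (forall j, j \notin s -> p j y = 0) -> E (y - P y).
  have -> : P y = y - (y - P y) by rewrite opprB addrC subrK.
  apply: (lin_subB HE Ey).
  by apply: (H (enum 'I_k) y Ey) => j; rewrite mem_enum.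
elim: s => [|j s IH] {Ey}y Ey Hy.
  by rewrite /P big1 ?subr0// => j _; exact: Hy.
pose D : {linear V -> V} := (B \o B) \+ (c j \*: idfun).
have DE x : D x = B (B x) + c j *: x by [].
have pD i x : p i (D x) = D (p i x) by rewrite !DE linearD linearZ /= !pB.
have PDc x : P (D x) = D (P x) by rewrite !DE PD PZ !PB.
have ED u : E u -> E (D u).
  by move=> Eu; apply: lin_subD => //; [exact/BE/BE|exact: lin_subZ].
have EDy : E (D (y - P y)).
  rewrite linearB -PDc; apply: IH; first exact: ED.
  move=> i /negP is_; rewrite pD; have [->|ij] := eqVneq i j; first exact: Bp.
  by rewrite Hy ?linear0// inE negb_or ij; apply/negP.
pose E1 u := E u /\ P u = 0.
have HE1 : lin_sub E1.
  split; first by split=> //; case: HE.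
  move=> d u z [Eu Pu] [Ez Pz]; split; first by case: HE => _; apply.
  by rewrite PD PZ Pu Pz scaler0 addr0.
have Py : P (y - P y) = 0.
  by rewrite PD -scaleN1r PZ plane_proj_idem scaleN1r subrr.
have [|||u [Eu Pu] Du] := @lin_sub_stable_inj E1 D HE1 _ _ (D (y - P y)).
- by move=> u [Eu Pu]; split; [exact: ED|rewrite PDc Pu linear0].
- by move=> u [_ Pu]; exact: Binj.
- by split=> //; rewrite PDc Py linear0.
have /eqP : u - (y - P y) = 0.
  apply: (Binj j); first by rewrite PD Pu -scaleN1r PZ Py scaler0 addr0.
  by rewrite -DE linearB Du subrr.
by rewrite subr_eq0 => /eqP <-.
Qed.

End Subspace.

(** * Reduction to a frequency equation *)

Section Reduction.
Variables (R : realType) (n k : nat).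
Local Notation V := 'rV[R]_n.
Variables (a b : 'I_k -> {linear V -> R^o}) (v w : 'I_k -> V).
Hypothesis av : forall i j, a i (v j) = (i == j)%:R.
Hypothesis aw : forall i j, a i (w j) = 0.
Hypothesis bv : forall i j, b i (v j) = 0.
Hypothesis bw : forall i j, b i (w j) = (i == j)%:R.

Definition plane j (x : V) : V := (a j x : R) *: v j + (b j x : R) *: w j.

Lemma plane_linear j : linear (plane j).
Proof.
move=> c x y; rewrite /plane.
have -> : a j (c *: x + y) = c * a j x + a j y by exact: linearP.
have -> : b j (c *: x + y) = c * b j x + b j y by exact: linearP.
by apply/rowP => i; rewrite !mxE; ring.
Qed.

Definition planeL j : {linear V -> V} :=
  HB.pack (plane j) (GRing.isLinear.Build _ _ _ _ _ (plane_linear j)).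

Definition plane_proj (x : V) : V := \sum_j plane j x.

Local Notation P := plane_proj.

Lemma plane_proj_linear : linear P.
Proof.
move=> c x y; rewrite /plane_proj scaler_sumr -big_split /=; apply: eq_bigr => j _.
by rewrite plane_linear.
Qed.

Definition plane_projL : {linear V -> V} :=
  HB.pack P (GRing.isLinear.Build _ _ _ _ _ plane_proj_linear).

Local Notation PL := plane_projL.

Lemma a_plane i j x : a i (plane j x) = (i == j)%:R * a j x.
Proof. by rewrite /plane linearD !linearZ /= av aw /GRing.scale /= mulr0 addr0 mulrC. Qed.

Lemma b_plane i j x : b i (plane j x) = (i == j)%:R * b j x.
Proof. by rewrite /plane linearD !linearZ /= bv bw /GRing.scale /= mulr0 add0r mulrC. Qed.

Lemma coord_plane_proj j x : a j (P x) = a j x.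
Proof.
rewrite /plane_proj linear_sum (bigD1 j)//= a_plane eqxx mul1r big1 ?addr0// => i ij.
by rewrite a_plane eq_sym (negPf ij) mul0r.
Qed.

Lemma coordJ_plane_proj j x : b j (P x) = b j x.
Proof.
rewrite /plane_proj linear_sum (bigD1 j)//= b_plane eqxx mul1r big1 ?addr0// => i ij.
by rewrite b_plane eq_sym (negPf ij) mul0r.
Qed.

Lemma plane_proj_idem x : P (P x) = P x.
Proof. by rewrite /plane_proj; apply: eq_bigr => j _; rewrite /plane -/(P x) coord_plane_proj coordJ_plane_proj. Qed.

Lemma plane_proj_eq0 x : P x = 0 -> forall j, a j x = 0 /\ b j x = 0.
Proof. by move=> Px j; rewrite -coord_plane_proj -coordJ_plane_proj Px !linear0. Qed.

Lemma linear_plane (L : {linear V -> V}) j x :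
  L (plane j x) = (a j x : R) *: L (v j) + (b j x : R) *: L (w j).
Proof. by rewrite /plane linearD !linearZ. Qed.

(** The first two conditions describe [L] on the planes; the last two say that the
    complement [a = b = 0] is stable under [L] as well. *)
Definition rotates (L : {linear V -> V}) (m : 'I_k -> R) :=
  forall j, [/\ L (v j) = m j *: w j, L (w j) = - m j *: v j,
    forall x, a j (L x) = - (m j * b j x) & forall x, b j (L x) = m j * a j x].

Lemma rotates_plane L m : rotates L m -> forall j x, plane j (L x) = L (plane j x).
Proof.
move=> H j x; have [Lv Lw La Lb] := H j.
rewrite linear_plane /plane La Lb Lv Lw.
by apply/rowP => i; rewrite !mxE; ring.
Qed.

Lemma rotates_P L m : rotates L m -> forall x, P (L x) = L (P x).
Proof.
move=> H x; rewrite /plane_proj linear_sum; apply: eq_bigr => j _; exact: rotates_plane H j x.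
Qed.

Variables (A Z0 : {linear V -> V}) (N : 'I_k -> {linear V -> V}) (mu : 'I_k -> R).
Hypothesis rA : rotates A mu.
Hypothesis rZ : rotates Z0 mu.
Hypothesis rN : forall i, rotates (N i) (fun j => (i == j)%:R).
Hypothesis kerB : forall x, A x = Z0 x -> P x = x.

(** The generator obtained from [Z0] by changing the frequencies by [l]. *)
Definition gen_act (l : 'rV[R]_k) (x : V) : V := Z0 x + \sum_j l 0 j *: N j x.

Local Notation zeta := gen_act.

Lemma gen_act_linear l : linear (zeta l).
Proof.
move=> c x y; rewrite /gen_act (linearP Z0) scalerDr scaler_sumr addrACA; congr (_ + _).
rewrite -big_split; apply: eq_bigr => j _ /=.
by rewrite (linearP (N j)) scalerDr !scalerA mulrC.
Qed.

Definition gen_actL l : {linear V -> V} :=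
  HB.pack (zeta l) (GRing.isLinear.Build _ _ _ _ _ (gen_act_linear l)).

Local Notation zetaL := gen_actL.

Lemma N_plane i x : N i (P x) = a i x *: w i - b i x *: v i.
Proof.
rewrite /plane_proj linear_sum (bigD1 i)//= big1 => [|j ji]; last first.
  have [Lv Lw _ _] := rN i j.
  by rewrite linear_plane Lv Lw eq_sym (negPf ji) oppr0 !scale0r !scaler0 addr0.
have [Lv Lw _ _] := rN i i.
by rewrite addr0 linear_plane Lv Lw eqxx scale1r scaleN1r scalerN.
Qed.

Lemma gen_act_rotates l : rotates (zetaL l) (fun j => mu j + l 0 j).
Proof.
move=> j; have [Zv Zw Za Zb] := rZ j.
have Nj i : [/\ N i (v j) = (i == j)%:R *: w j, N i (w j) = - (i == j)%:R *: v j,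
    forall x, a j (N i x) = - ((i == j)%:R * b j x) &
    forall x, b j (N i x) = (i == j)%:R * a j x] := rN i j.
split=> /=.
- rewrite /gen_act Zv scalerDl (bigD1 j)//= big1 => [|i ij].
    by have [-> _ _ _] := Nj j; rewrite eqxx scale1r addr0.
  by have [-> _ _ _] := Nj i; rewrite (negPf ij) scale0r scaler0.
- rewrite /gen_act Zw opprD scalerDl (bigD1 j)//= big1 => [|i ij].
    have [_ -> _ _] := Nj j; rewrite eqxx addr0.
    by apply/rowP => i; rewrite !mxE /=; ring.
  by have [_ -> _ _] := Nj i; rewrite (negPf ij) oppr0 scale0r scaler0.
- move=> x; rewrite /gen_act linearD Za mulrDl opprD; congr (_ + _).
  rewrite linear_sum (bigD1 j)//= big1 => [|i ij]; rewrite linearZ /= /GRing.scale /=.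
    by have [_ _ -> _] := Nj j; rewrite eqxx mul1r mulrN addr0.
  by have [_ _ -> _] := Nj i; rewrite (negPf ij) mul0r oppr0 mulr0.
- move=> x; rewrite /gen_act linearD Zb mulrDl; congr (_ + _).
  rewrite linear_sum (bigD1 j)//= big1 => [|i ij]; rewrite linearZ /= /GRing.scale /=.
    by have [_ _ _ ->] := Nj j; rewrite eqxx mul1r addr0.
  by have [_ _ _ ->] := Nj i; rewrite (negPf ij) mul0r mulr0.
Qed.

Lemma eq_on_planes x : A (P x) = Z0 (P x).
Proof.
rewrite /plane_proj !linear_sum; apply: eq_bigr => j _; rewrite !linear_plane.
by have [-> -> _ _] := rA j; have [-> -> _ _] := rZ j.
Qed.

(** [A - Z0] vanishes on the planes; adding the projection on the planes makes it
    invertible, so that both the complementary equation and the constraint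
    [P u = 0] can be solved by one implicit function. *)
Definition complement_op (u : V) : V := A u - Z0 u + P u.

Local Notation F := complement_op.

Lemma complement_op_linear : linear F.
Proof.
move=> c x y; rewrite /complement_op plane_proj_linear (linearP A) (linearP Z0).
by apply/rowP => i; rewrite !mxE; ring.
Qed.

Definition complement_opL : {linear V -> V} := HB.pack F (GRing.isLinear.Build _ _ _ _ _ complement_op_linear).

Local Notation FL := complement_opL.

Lemma complement_op_inj u : F u = 0 -> u = 0.
Proof.
move=> Fu; have Pu : P u = 0.
  have : P (F u) = P u.
    rewrite /complement_op -[P _]/(PL (A u - Z0 u + P u)) linearD linearB /= plane_proj_idem.
    by rewrite (rotates_P rA) (rotates_P rZ) eq_on_planes subrr add0r.
  by rewrite Fu -[P 0]/(PL 0) linear0.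
have /kerB : A u = Z0 u.
  by move/eqP: Fu; rewrite /complement_op Pu addr0 subr_eq0 => /eqP.
by rewrite Pu.
Qed.

Definition complement_inv : {linear V -> V} := mulmxr (invmx (lin1_mx FL)).

Lemma complement_op_unit : lin1_mx FL \in unitmx.
Proof.
rewrite unitmxE unitfE; apply/det0P => -[x x0 xF].
move: xF; rewrite mul_rV_lin1 => /complement_op_inj x00.
by rewrite x00 eqxx in x0.
Qed.

Lemma complement_opK u : complement_inv (F u) = u.
Proof.
have -> : F u = u *m lin1_mx FL by rewrite mul_rV_lin1.
by rewrite /complement_inv /= mulmxK//; exact: complement_op_unit.
Qed.

Lemma complement_invK u : F (complement_inv u) = u.
Proof.
have -> : F (complement_inv u) = complement_inv u *m lin1_mx FL by rewrite mul_rV_lin1.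
by rewrite /complement_inv /= mulmxKV//; exact: complement_op_unit.
Qed.

(** A stable subspace is finite dimensional, so an injective operator maps it onto
    itself. *)
Lemma complement_inv_sub (E : set V) : lin_sub E -> (forall u, E u -> E (A u)) ->
  (forall u, E u -> E (Z0 u)) -> (forall u, E u -> E (P u)) ->
  forall u, E u -> E (complement_inv u).
Proof.
move=> HE EA EZ EP u Eu.
have [||x Ex <-] := @lin_sub_stable_inj R n E FL HE _ _ u Eu.
- move=> y Ey; apply: (lin_subD HE); last exact: EP.
  by apply: (lin_subB HE); [exact: EA|exact: EZ].
- by move=> y _; exact: complement_op_inj.
- by rewrite complement_opK.
Qed.

Variable X : V -> V.
Hypothesis sX : forall m, Ck_on m setT X.
Hypothesis X0 : X 0 = 0.
Hypothesis dX : forall x, 'd X 0 x = A x.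

Lemma diff_scale0 (U : normedModType R) m (f : U -> R^o) (g : U -> 'rV[R]_m) x h :
  f x = 0 -> g x = 0 -> differentiable f x -> differentiable g x ->
  differentiable (fun y => (f y : R) *: g y) x ->
  'd (fun y => (f y : R) *: g y) x h = 0.
Proof.
move=> fx gx df dg dfg; apply/rowP => j; rewrite diff_coord_fun//.
have dgj : differentiable (fun y => g y 0 j : R^o) x.
  apply: (@differentiable_comp _ _ _ _ g (fun M : 'rV[R]_m => M 0 j : R^o)) => //.
  exact: differentiable_coord.
rewrite (_ : (fun y => (f y *: g y) 0 j) = f * (fun y => g y 0 j : R^o)); last first.
  by apply/funext => y; rewrite !mxE.
rewrite diffM//= fx gx !mxE.
set p := 'd (fun y => g y 0 j : R^o) x h; set q := 'd f x h.
suff : (0 : R) * (p : R) + (0 : R) * (q : R) = 0 by [].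
by move: (p : R) (q : R) => p' q'; rewrite !mul0r addr0.
Qed.

(** The unknown is the component [u] of [y = P x + (u - P u)] off the planes. The
    equation is preconditioned by the inverse of its linearization, which makes its
    partial differential the identity; [P u] is added so that solutions satisfy
    [P u = 0]. The frequencies [l] are parameters on the same footing as [x], and
    the differential of the solution vanishes because the equation has no linear
    term in [P x]. *)
Lemma complement_reduction : exists (r : R) (phi : 'rV[R]_(n + k) -> V),
  [/\ 0 < r,
      forall m, Ck_on m [set z | `|z| < r] phi,
      (forall x l, `|row_mx x l| < r -> let y := P x + phi (row_mx x l) in
         P (phi (row_mx x l)) = 0 /\ P (X y - zeta l y) = X y - zeta l y),
      (forall h, 'd phi 0 h = 0) &
      forall x l (E : set V), `|row_mx x l| < r -> closed E -> lin_sub E ->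
        (forall u, E u -> E (A u)) -> (forall u, E u -> E (zeta l u)) ->
        (forall u, E u -> E (Z0 u)) ->
        (forall u, E u -> E (P u)) -> (forall u, E u -> E (X u)) ->
        E (P x) -> E (phi (row_mx x l))].
Proof.
pose px : {linear 'rV[R]_(n + k + n) -> V} := lsubmx \o lsubmx.
pose pl : {linear 'rV[R]_(n + k + n) -> 'rV[R]_k} := rsubmx \o lsubmx.
pose pu : {linear 'rV[R]_(n + k + n) -> V} := rsubmx.
pose P1 : {linear V -> V} := idfun \- PL.
pose Y : {linear 'rV[R]_(n + k + n) -> V} := (PL \o px) \+ (P1 \o pu).
pose q j z : V := (pl z 0 j : R) *: (N j \o Y) z.
pose W z : V := X (Y z) - ((Z0 \o Y) z + \sum_j q j z).
pose Phi z : V := complement_inv (P1 (W z) + (PL \o pu) z).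
have WE z : W z = X (Y z) - zeta (pl z) (Y z) by [].
have oT (U : topologicalType) : open [set: U] by exact: openT.
have sq j m : Ck_on m setT (q j).
  apply: (@Ck_scale R _ n m setT (fun z => pl z 0 j : R^o) (N j \o Y)) => //.
    by apply: (@Ck_coord _ _ k 1 m setT pl 0 j) => //; exact: Ck_linear.
  exact: Ck_linear.
have sXY m : Ck_on m setT (X \o Y).
  by apply: (Ck_comp (P := setT)) => //; exact: Ck_linear.
have sW m : Ck_on m setT W.
  apply: Ck_add => //; apply: Ck_opp => //; apply: Ck_add => //; first exact: Ck_linear.
  exact: Ck_sum.
have sG m : Ck_on m setT (fun z => P1 (W z) + (PL \o pu) z).
  apply: Ck_add => //; last exact: Ck_linear.
  apply: (@Ck_linear_comp _ _ _ _ P1) => //; exact: linear_rV_continuous.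
have sPhi m : Ck_on m setT Phi.
  apply: (@Ck_linear_comp _ _ _ _ complement_inv) => //; exact: linear_rV_continuous.
have Phi0 : Phi 0 = 0.
  rewrite /Phi WE.
  have -> : Y 0 = 0 by exact: linear0.
  have -> : zeta (pl 0) 0 = 0 by exact: (linear0 (zetaL (pl 0))).
  have -> : (PL \o pu) 0 = 0 by exact: linear0.
  by rewrite X0 subrr (linear0 P1) addr0 linear0.
have dY h : 'd Y 0 h = Y h.
  by rewrite -deriveE; [exact: derive_linear_rV|exact: linear_rV_differentiable].
have dW h : 'd W 0 h = A (Y h) - Z0 (Y h).
  have dXd : differentiable X (Y 0) by rewrite linear0; exact: (sX 1).1.
  have dYd : differentiable Y 0 by exact: linear_rV_differentiable.
  have D1 : differentiable (X \o Y) 0 by exact: differentiable_comp.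
  have D2 : differentiable (Z0 \o Y) 0 by exact: linear_rV_differentiable.
  have D3 j : differentiable (q j) 0 by exact: (sq j 1).1.
  have D3s : differentiable (fun z => \sum_j q j z) 0.
    rewrite (_ : (fun z => _) = \sum_j q j); first exact: differentiable_sum.
    by apply/funext => z; rewrite fct_sumE.
  have E3 j : 'd (q j) 0 h = 0.
    apply: diff_scale0.
    - by rewrite linear0 mxE.
    - by rewrite linear0.
    - by have [] := @Ck_coord _ _ k 1 1 setT pl 0 j openT (Ck_linear _ _ pl) => + _; apply.
    - exact: linear_rV_differentiable.
    - exact: D3.
  have E3s : 'd (fun z => \sum_j q j z) 0 h = 0.
    rewrite -deriveE// (_ : (fun z => _) = \sum_j q j); last first.
      by apply/funext => z; rewrite fct_sumE.
    rewrite derive_sum; last by move=> j; apply: diff_derivable.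
    apply: big1 => j _; exact: etrans (deriveE _ (D3 j)) (E3 j).
  have D23 : differentiable ((Z0 \o Y) + (fun z => \sum_j q j z)) 0.
    exact: differentiableD.
  have F1 : 'd (X \o Y) 0 h = A (Y h).
    apply: etrans (congr1 (fun f => f h) (diff_comp dYd dXd)) _.
    apply: etrans (congr1 _ (dY h)) _.
    apply: etrans (congr1 (fun x0 => 'd X x0 (Y h)) (linear0 Y)) _; exact: dX.
  have F2 : 'd (Z0 \o Y) 0 h = Z0 (Y h).
    apply: etrans (esym (deriveE _ D2)) _; exact: (derive_linear_rV (Z0 \o Y)).
  have F23 := congr1 (fun f => f h) (diffD D2 D3s).
  have FW := congr1 (fun f => f h) (diffB D1 D23).
  apply: etrans FW _; apply: (congr2 (fun x y => x - y) F1).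
  apply: etrans F23 _; exact: etrans (congr2 +%R F2 E3s) (addr0 _).
have dPhi h : 'd Phi 0 h = complement_inv (P1 (A (Y h) - Z0 (Y h)) + P (pu h)).
  have [DW _] := sW 1%N; have DW0 := DW 0 I.
  have DPu : differentiable (PL \o pu) 0 by exact: linear_rV_differentiable.
  have DP1 : differentiable P1 (W 0) by exact: linear_rV_differentiable.
  have DPW : differentiable (P1 \o W) 0 by exact: differentiable_comp.
  have DG : differentiable ((P1 \o W) + (PL \o pu)) 0 by exact: differentiableD.
  have DF x : differentiable complement_inv x by exact: linear_rV_differentiable.
  have -> : Phi = complement_inv \o ((P1 \o W) + (PL \o pu)) by [].
  apply: etrans (congr1 (fun f => f h) (diff_comp DG (DF _))) _.
  apply: etrans (esym (deriveE _ (DF _))) _.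
  apply: etrans (derive_linear_rV _ _ _) _; congr (complement_inv _).
  apply: etrans (congr1 (fun f => f h) (diffD DPW DPu)) _; congr (_ + _).
    apply: etrans (congr1 (fun f => f h) (diff_comp DW0 DP1)) _.
    apply: etrans (esym (deriveE _ DP1)) _.
    by apply: etrans (derive_linear_rV _ _ _) _; rewrite dW.
  apply: etrans (esym (deriveE _ DPu)) _; exact: (derive_linear_rV (PL \o pu)).
have PB x : P (A x - Z0 x) = 0.
  rewrite -[LHS]/(PL (A x - Z0 x)) linearB /= (rotates_P rA) (rotates_P rZ).
  by rewrite eq_on_planes subrr.
have YE x l u : Y (row_mx (row_mx x l) u) = P x + (u - P u).
  by rewrite /Y /= !row_mxKl row_mxKr.
have puE z u : pu (row_mx z u) = u by exact: row_mxKr.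
have plE x l u : pl (row_mx (row_mx x l) u) = l by rewrite /pl /= row_mxKl row_mxKr.
have dPhi1 u : 'd Phi 0 (row_mx 0 u) = u.
  rewrite dPhi -[row_mx 0 u](_ : row_mx (row_mx 0 0) u = _); last by rewrite row_mx0.
  rewrite YE puE -[P 0]/(PL 0) linear0 add0r -[RHS]complement_opK; congr (complement_inv _).
  rewrite /complement_op /P1 /= PB subr0; congr (_ + _).
  by rewrite (linearB A) (linearB Z0) /= eq_on_planes opprB addrA subrK.
have [r [phi [r0 phiPhi [phi0 sphi] dphi phiE]]] :=
@implicit_function R (n + k) n setT Phi openT I sPhi Phi0 dPhi1.
exists r, phi; split=> //.
- move=> x l xlr.
  have [_ E] := phiPhi _ xlr; set u := phi (row_mx x l) in E *.
  have G0 : P1 (W (row_mx (row_mx x l) u)) + P u = 0.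
    have : F (complement_inv (P1 (W (row_mx (row_mx x l) u)) + P u)) = 0.
      by move: E; rewrite /Phi [(PL \o pu) _]/= row_mxKr => ->; rewrite -[F 0]/(FL 0) linear0.
    by rewrite complement_invK.
  have PP1 y : P (P1 y) = 0.
    by rewrite -[LHS]/(PL (y - PL y)) linearB /= plane_proj_idem subrr.
  have Pu : P u = 0.
    have := congr1 PL G0; rewrite linearD linear0 /= PP1 plane_proj_idem add0r.
    exact.
  split=> //; move: G0; rewrite Pu addr0 WE YE plE Pu subr0.
  by move/eqP; rewrite subr_eq0 => /eqP E2; exact: esym E2.
- move=> h; have -> : h = row_mx (lsubmx h) (rsubmx h) by rewrite hsubmxK.
  have Pz : P 0 = 0 by exact: (linear0 PL).
  rewrite dphi dPhi YE puE Pz subr0 !addr0 eq_on_planes subrr (linear0 P1).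
  by rewrite linear0 oppr0.
- move=> x l E xlr cE HE EA Ez EZ EP EX EPx.
  apply: (phiE _ _ xlr cE HE.1) => u _ Eu; apply: (lin_subB HE Eu).
  apply: complement_inv_sub => //; rewrite WE YE plE [(PL \o pu) _]/= row_mxKr.
  have Ey : E (P x + (u - P u)).
    by apply: (lin_subD HE) => //; apply: (lin_subB HE) => //; exact: EP.
  have EW : E (X (P x + (u - P u)) - zeta l (P x + (u - P u))).
    by apply: (lin_subB HE); [exact: EX|exact: Ez].
  apply: (lin_subD HE); last exact: EP.
  by apply: (lin_subB HE) => //; exact: EP.
Qed.

Hypothesis radial : forall y l j, P (X y - zeta l y) = X y - zeta l y ->
  a j (X y - zeta l y) * a j y + b j (X y - zeta l y) * b j y = 0.

Definition lplaneL j : {linear 'rV[R]_(n + k) -> 'rV[R]_(n + k)} :=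
  mulmxr (row_mx 1%:M 0) \o planeL j \o lsubmx.

Lemma lplaneE j z : lplaneL j z = row_mx (plane j (lsubmx z)) 0.
Proof. by rewrite /lplaneL /= mul_mx_row mulmx1 mulmx0. Qed.

Lemma plane_plane j x : plane j (plane j x) = plane j x.
Proof. by rewrite {1}/plane a_plane b_plane eqxx !mul1r. Qed.

Lemma lplane_idem j z : lplaneL j (lplaneL j z) = lplaneL j z.
Proof. by rewrite !lplaneE row_mxKl plane_plane. Qed.

(** A ball need not be stable under the squeezing of a plane; adding the condition
    at the end of the segment makes it so, by convexity. *)
Definition star_dom (r : R) j := [set z | `|z| < r /\ `|z - lplaneL j z| < r].

Lemma open_star_dom r j : open (star_dom r j).
Proof.
have -> : star_dom r j = [set z | `|z| < r] `&` [set z | `|z - lplaneL j z| < r] by [].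
apply: openI; first exact: open_norm_ball.
apply: (open_norm_lt (f := fun z => z - lplaneL j z)).
pose L : {linear 'rV[R]_(n + k) -> 'rV[R]_(n + k)} := idfun \- lplaneL j.
exact: (@linear_rV_continuous _ _ _ L).
Qed.

Lemma star_dom_star r j z (s : R) : star_dom r j z -> 0 <= s <= 1 ->
  star_dom r j (squeeze (lplaneL j) s z).
Proof.
move=> [z1 z2] /andP[s0 s1].
have E : squeeze (lplaneL j) s z = s *: z + (1 - s) *: (z - lplaneL j z).
  rewrite /squeeze; move: (lplaneL j z) => q.
  by apply/rowP => i; rewrite !mxE; ring.
have E2 : squeeze (lplaneL j) s z - lplaneL j (squeeze (lplaneL j) s z) = z - lplaneL j z.
  rewrite /squeeze; set q := lplaneL j z.
  have -> : lplaneL j (z - q + s *: q) = s *: q.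
    have qi : lplaneL j q = q by exact: lplane_idem.
    rewrite (linearD (lplaneL j)) (linearB (lplaneL j)) (linearZZ (lplaneL j)).
    by rewrite qi -/q subrr add0r.
  by rewrite addrK.
split; last by rewrite E2.
rewrite E; apply: le_lt_trans (ler_normD _ _) _; rewrite !normrZ (ger0_norm s0) ger0_norm ?subr_ge0//.
have [->|sn0] := eqVneq s 0; first by rewrite mul0r add0r subr0 mul1r.
have sp : 0 < s by rewrite lt_neqAle eq_sym sn0.
rewrite [ltRHS](_ : r = s * r + (1 - s) * r); last by rewrite -mulrDl addrC subrK mul1r.
apply: ltr_leD; first by rewrite ltr_pM2l.
by apply: ler_wpM2l; [rewrite subr_ge0|exact: ltW].
Qed.

(** In the coordinates of the [j]-th plane the residual equation reads
    [g1 = - l_j b_j], [g2 = l_j a_j], and orthogonality is the relation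
    [a_j g1 + b_j g2 = 0]; by division [g1 = - f_j b_j] and [g2 = f_j a_j] with [f_j]
    smooth, so [l = f] suffices. The function [f] vanishes with [x], since there its
    value is determined by the linear part of [X], which rotates the planes at the
    frequencies [mu]; hence [l = f (x, l)] is solvable for [l] near [0]. The bound
    [eps] on the frequencies can be prescribed since [lam 0 = 0]. The last clause
    follows both fixed point iterations inside [E]. *)
Lemma planar_reduction (eps : R) : 0 < eps ->
  exists (rho : R) (phi : V -> V) (lam : V -> 'rV[R]_k),
  [/\ 0 < rho,
      forall m, Ck_on m [set x | `|x| < rho] phi,
      phi 0 = 0 /\ (forall h, 'd phi 0 h = 0),
      (forall x, `|x| < rho -> [/\ P (phi x) = 0, `|lam x| < eps &
         X (P x + phi x) = zeta (lam x) (P x + phi x)]) &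
      forall x (E : set V), `|x| < rho -> closed E -> lin_sub E ->
        (forall u, E u -> E (A u)) ->
        (forall u, E u -> E (P u)) -> (forall u, E u -> E (X u)) ->
        (forall l, E (zeta l (P x)) -> forall u, E u -> E (zeta l u)) ->
        E (P x) -> E (phi x)].
Proof.
move=> eps0.
have [r [phi [r0 sphi phiP dphi phiE]]] := complement_reduction.
have P0 : P 0 = 0 by exact: (linear0 PL).
have zeta0 l : zeta l 0 = 0 by exact: (linear0 (zetaL l)).
have zE0 u : zeta 0 u = Z0 u.
  by rewrite /gen_act big1 ?addr0// => j _; rewrite mxE scale0r.
(* the zero subspace is stable under everything, so it contains [phi (0, l)] *)
have phil (l : 'rV[R]_k) : `|row_mx (0 : V) l| < r -> phi (row_mx 0 l) = 0.
  move=> lr; apply: (phiE 0 l [set 0] lr).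
  - by apply: accessible_closed_set1; apply: hausdorff_accessible; exact: norm_hausdorff.
  - by split=> // c u _ -> ->; rewrite scaler0 addr0.
  - by move=> u ->; rewrite /= linear0.
  - by move=> u ->; rewrite /= zeta0.
  - by move=> u ->; rewrite /= linear0.
  - by move=> u ->; rewrite /= P0.
  - by move=> u ->; rewrite /= X0.
  - by rewrite /= P0.
pose xz : {linear 'rV[R]_(n + k) -> V} := lsubmx.
pose lz : {linear 'rV[R]_(n + k) -> 'rV[R]_k} := rsubmx.
pose Y z : V := P (xz z) + phi z.
pose g1 j z : R^o := a j (X (Y z)) + mu j * b j (xz z).
pose g2 j z : R^o := b j (X (Y z)) - mu j * a j (xz z).
have oB : open [set z : 'rV[R]_(n + k) | `|z| < r] by exact: open_norm_ball.
have sXY m : Ck_on m [set z : 'rV[R]_(n + k) | `|z| < r] (X \o Y).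
  apply: (Ck_comp (P := setT)) => //; first exact: openT.
  apply: (@Ck_add _ _ _ _ _ (PL \o xz) phi oB _ (sphi m)).
  exact: Ck_linear.
have sg (c : {linear V -> R^o}) (d : {linear V -> R^o}) (t : R) m :
    Ck_on m [set z : 'rV[R]_(n + k) | `|z| < r] (fun z => c (X (Y z)) + t * d (xz z) : R^o).
  apply: Ck_add => //.
    apply: (@Ck_linear_comp _ _ _ _ c _ _ (X \o Y)) => //; exact: linear_rV_continuous.
  apply: Ck_scalar_mul => //; first exact: Ck_cst.
  exact: (Ck_linear _ _ (d \o xz)).
have sg1 j m : Ck_on m [set z | `|z| < r] (g1 j) by exact: sg.
have sg2 j m : Ck_on m [set z | `|z| < r] (g2 j).
  apply: Ck_ext (sg (b j) (a j) (- mu j) m) => // z _.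
  by rewrite /g2 mulNr.
have aY j z : `|z| < r -> a j (Y z) = a j (xz z) /\ b j (Y z) = b j (xz z).
  move=> zr; have := phiP (lsubmx z) (rsubmx z); rewrite hsubmxK => /(_ zr)[Pz _].
  by rewrite /Y !linearD coord_plane_proj coordJ_plane_proj (plane_proj_eq0 Pz j).1 (plane_proj_eq0 Pz j).2 !addr0.
(* [zeta l] rotates the planes, so its contribution to the relation cancels *)
have grel j z : `|z| < r -> a j (xz z) * g1 j z + b j (xz z) * g2 j z = 0.
  move=> zr; have := phiP (lsubmx z) (rsubmx z); rewrite hsubmxK => /(_ zr)[_ Pz].
  have := radial j Pz; rewrite -/(Y z) !linearB.
  have [_ _ za zb] := gen_act_rotates (rsubmx z) j.
  rewrite -[zeta _ _]/(zetaL (rsubmx z) (Y z)) za zb.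
  rewrite (aY j z zr).1 (aY j z zr).2 /g1 /g2.
  move=> H; rewrite -[RHS]H.
  move: (a j (X _)) (b j (X _)) (a j (xz z)) (b j (xz z)) => p q p' q'.
  ring.
have exF j : exists f : 'rV[R]_(n + k) -> R^o, (forall m, Ck_on m (star_dom r j) f) /\
    forall z, star_dom r j z -> g1 j z = - (f z * b j (xz z)) /\ g2 j z = f z * a j (xz z).
  have sub : star_dom r j `<=` [set z | `|z| < r] by move=> z [].
  apply: (@division R (n + k) (a j \o xz) (b j \o xz) (row_mx (v j) 0) (row_mx (w j) 0)
    _ _ _ _ (lplaneL j)).
  - by rewrite /= row_mxKl av eqxx.
  - by rewrite /= row_mxKl aw.
  - by rewrite /= row_mxKl bv.
  - by rewrite /= row_mxKl bw eqxx.
  - by move=> z; rewrite lplaneE /plane !scale_row_mx !scaler0 add_row_mx addr0.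
  - exact: open_star_dom.
  - by move=> z s; exact: star_dom_star.
  - by move=> m; exact: Ck_sub sub (sg1 j m).
  - by move=> m; exact: Ck_sub sub (sg2 j m).
  - by move=> z [zr _]; exact: grel.
pose f j := projT1 (cid (exF j)).
have [sf fE] : (forall j m, Ck_on m (star_dom r j) (f j)) /\
    forall j z, star_dom r j z -> g1 j z = - (f j z * b j (xz z)) /\ g2 j z = f j z * a j (xz z).
  by split=> j; have [H1 H2] := projT2 (cid (exF j)).
pose O : set 'rV[R]_(n + k) := [set z | `|z| < r /\ forall j, star_dom r j z].
have oO : open O.
  rewrite openE => z [zr zs]; rewrite /interior.
  have N1 : \forall y \near z, `|y| < r by exact: open_nbhs_nbhs.
  have N2 : \forall y \near z, forall j : 'I_k, star_dom r j y.
    have FF : Filter (nbhs z) by exact: nbhs_filter.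
    apply: (@filter_forall _ 'I_k (fun j y => star_dom r j y) _ FF) => j.
    by apply: open_nbhs_nbhs; split; [exact: open_star_dom|exact: zs].
  exact: filterS2 N1 N2.
have O0 : O 0.
  split=> [|j]; first by rewrite /= normr0.
  split; first by rewrite normr0.
  have -> : lplaneL j 0 = 0 by exact: (linear0 (lplaneL j)).
  by rewrite subrr normr0.
pose Fv z : 'rV[R]_k := \row_j f j z.
have sFv m : Ck_on m O Fv.
  apply: Ck_row => // j; apply: (@Ck_ext _ _ _ _ _ (f j)) => //.
    by move=> z _; rewrite mxE.
  by apply: Ck_sub (sf j m) => z [_]; exact.
(* differentiate [g2 = f_j a_j] along [v j] at [x = 0], where [a_j] vanishes *)
have F0 l : O (row_mx 0 l) -> Fv (row_mx 0 l) = 0.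
  move=> Ol; apply/rowP => j; rewrite !mxE.
  have [z0r zs] := Ol; have z0s := zs j.
  set z0 := row_mx 0 l in Ol z0r zs z0s *.
  pose e : 'rV[R]_(n + k) := row_mx (v j) 0.
  have xe : xz e = v j by exact: row_mxKl.
  have x0 : xz z0 = 0 by exact: row_mxKl.
  have dphi0 : differentiable phi z0 by exact: (sphi 1%N).1.
  have dY0 : differentiable Y z0.
    apply: differentiableD => //; exact: (linear_rV_differentiable (PL \o xz)).
  have Y0 : Y z0 = 0 by rewrite /Y x0 P0 add0r phil.
  have dX0 : differentiable X (Y z0) by exact: (sX 1).1.
  have dXY : differentiable (X \o Y) z0 by exact: differentiable_comp.
  have DP : P ('D_e phi z0) = 0.
    have cP : continuous PL by exact: linear_rV_continuous.
    suff H : 'D_e (PL \o phi) z0 = 0.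
      by have := derive_linear_comp e cP dphi0; rewrite H => /esym.
    rewrite -[RHS](derive_cst (0 : V) z0 e); apply: near_eq_derive.
    have N1 : \forall y \near z0, `|y| < r by exact: open_nbhs_nbhs.
    apply: filterS N1 => y yr; have := phiP (lsubmx y) (rsubmx y).
    by rewrite hsubmxK => /(_ yr)[].
  have DY : 'D_e Y z0 = P (v j) + 'D_e phi z0.
    have dPx : differentiable (PL \o xz) z0 by exact: linear_rV_differentiable.
    have -> : Y = (PL \o xz) + phi by [].
    apply: etrans (deriveD (derivable_along e dPx) (derivable_along e dphi0)) _.
    congr (_ + _); apply: etrans (derive_linear_rV (PL \o xz) z0 e) _.
    by rewrite /= -[lsubmx e]/(xz e) xe.
  have DXY : 'D_e (X \o Y) z0 = A (P (v j) + 'D_e phi z0).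
    apply: etrans (deriveE _ dXY) _.
    apply: etrans (congr1 (fun f => f e) (diff_comp dY0 dX0)) _.
    apply: etrans (congr1 (fun y => 'd X y ('d Y z0 e)) Y0) _.
    apply: etrans (dX _) _; congr (A _).
    by apply: etrans (esym (deriveE _ dY0)) _.
  have cb : continuous (b j) by exact: linear_rV_continuous.
  have Dg2 : 'D_e (g2 j) z0 = 0.
    have D1 : differentiable (b j \o (X \o Y)) z0.
      by apply: differentiable_comp => //; exact: linear_rV_differentiable.
    have D2 : differentiable (a j \o xz) z0 by exact: linear_rV_differentiable.
    have D2' : differentiable (mu j \*: (a j \o xz)) z0 by exact: differentiableZ.
    have -> : g2 j = (b j \o (X \o Y)) - (mu j \*: (a j \o xz)) by [].
    apply: etrans (deriveB (derivable_along e D1) (derivable_along e D2')) _.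
    have E1 : 'D_e (b j \o (X \o Y)) z0 = mu j.
      apply: etrans (derive_linear_comp e cb dXY) _; rewrite DXY.
      have [_ _ _ ->] := rA j; rewrite linearD coord_plane_proj av eqxx.
      by rewrite (plane_proj_eq0 DP j).1 addr0 mulr1.
    have E2 : 'D_e (mu j \*: (a j \o xz)) z0 = mu j.
      apply: etrans (deriveZ (mu j) (derivable_along e D2)) _.
      have -> : 'D_e (a j \o xz) z0 = 1.
        apply: etrans (derive_linear_rV (a j \o xz) z0 e) _.
        by rewrite /= -[lsubmx e]/(xz e) xe av eqxx.
      by rewrite /GRing.scale /= mulr1.
    by rewrite E1 E2 subrr.
  have df : differentiable (f j) z0 by exact: (sf j 1%N).1.
  have D2 : differentiable (a j \o xz) z0 by exact: linear_rV_differentiable.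
  have : 'D_e (g2 j) z0 = 'D_e (fun z => f j z * (a j \o xz) z : R^o) z0.
    apply: near_eq_derive.
    have N2 : \forall y \near z0, star_dom r j y.
      by apply: open_nbhs_nbhs; split=> //; exact: open_star_dom.
    by apply: filterS N2 => y /fE[].
  rewrite Dg2 => E.
  have := deriveM (derivable_along e df) (derivable_along e D2).
  move=> E'; have {E E'} := etrans E E'.
  have -> : (a j \o xz) z0 = 0 by rewrite /= -[lsubmx z0]/(xz z0) x0 linear0.
  have -> : 'D_e (a j \o xz) z0 = 1.
    apply: etrans (derive_linear_rV (a j \o xz) z0 e) _.
    by rewrite /= -[lsubmx e]/(xz e) xe av eqxx.
  by rewrite /GRing.scale /= mul0r addr0 mulr1.
pose Psi z : 'rV[R]_k := lz z - Fv z.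
have sPsi m : Ck_on m O Psi.
  apply: Ck_add => //; first exact: Ck_linear.
  by apply: Ck_opp.
have Psi0 : Psi 0 = 0.
  have := F0 0; rewrite row_mx0 => /(_ O0) E.
  by rewrite /Psi E linear0 subr0.
have dFv : differentiable Fv 0 by exact: (sFv 1%N).1.
(* [f] vanishes on [{0} x R^k], so the partial differential of [Psi] is the identity *)
have dPsi l : 'd Psi 0 (row_mx 0 l) = l.
  have dl : differentiable lz 0 by exact: linear_rV_differentiable.
  have dP : differentiable ((lz : 'rV[R]_(n + k) -> 'rV[R]_k) - Fv) 0.
    exact: differentiableB.
  have PsiE : Psi = (lz : 'rV[R]_(n + k) -> 'rV[R]_k) - Fv by [].
  rewrite PsiE.
  apply: etrans (esym (deriveE _ dP)) _.
  apply: etrans (deriveB (derivable_along _ dl) (derivable_along _ dFv)) _.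
  have E1 : 'D_(row_mx 0 l) lz 0 = l.
    by apply: etrans (derive_linear_rV lz 0 (row_mx 0 l)) _; exact: row_mxKr.
  have E2 : 'D_(row_mx 0 l) Fv 0 = 0.
    apply: derive_zero_line => //.
    have N1 : \forall s \near (0 : R), O (s *: row_mx 0 l).
      have ct : {for (0 : R), continuous (fun s : R => s *: (row_mx 0 l : 'rV[R]_(n + k)))}.
        exact: scalel_continuous.
      apply: ct; rewrite scale0r; exact: open_nbhs_nbhs.
    by apply: filterS N1 => s; rewrite scale_row_mx scaler0 => /F0.
  by rewrite E1 E2 subr0.
have [r2 [lam [r20 lamP [lam0 slam] dlam lamE]]] :=
  @implicit_function R n k O Psi oO O0 sPsi Psi0 dPsi.
have clam : {for 0, continuous lam}.
  by apply: (Ck_continuous (slam 0%N)); rewrite /= normr0.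
have /nbhs_ballP[r3 /= r30 Hr3] : \forall x \near (0 : V), `|lam x| < eps.
  have /cvgrPdist_lt/(_ _ eps0) := clam; rewrite lam0.
  by apply: filterS => x; rewrite sub0r normrN.
pose rho := Num.min r2 r3.
have rho2 (x : V) : `|x| < rho -> `|x| < r2 by rewrite lt_min => /andP[].
have rho3 (x : V) : `|x| < rho -> `|lam x| < eps.
  rewrite lt_min => /andP[_ x3]; apply: Hr3.
  by rewrite -ball_normE /= sub0r normrN.
pose u x : 'rV[R]_(n + k) := row_mx x (lam x).
have oR : open [set x : V | `|x| < rho] by exact: open_norm_ball.
have su m : Ck_on m [set x | `|x| < rho] u.
  apply: (@Ck_ext _ _ _ _ _ (fun p => mulmxr (row_mx 1%:M 0) p +
      (mulmxr (row_mx 0 1%:M) \o lam) p)) => //.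
    by move=> p _; rewrite /u [RHS]row_mx_sum.
  apply: Ck_add => //; first exact: Ck_linear.
  apply: Ck_linear_comp => //; first exact: linear_rV_continuous.
  by apply: Ck_sub (slam m) => x; exact: rho2.
have uO x : `|x| < rho -> O (u x) by move=> /rho2/lamP[].
have u0 : u 0 = 0 by rewrite /u lam0 row_mx0.
have sphiu m : Ck_on m [set x | `|x| < rho] (phi \o u).
  by apply: (Ck_comp oR oB _ (su m) (sphi m)) => x /uO[].
have rho0 : 0 < rho by rewrite lt_min r20.
have z0 : `|0 : V| < rho by rewrite normr0.
exists rho, (phi \o u), lam; split.
- exact: rho0.
- exact: sphiu.
- split.
    by rewrite /= u0; have := phil 0; rewrite row_mx0; apply; rewrite normr0.
  move=> h; have du : differentiable u 0 by exact: (su 1%N).1.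
  have dpu : differentiable phi (u 0).
    by rewrite u0; apply: (sphi 1%N).1; rewrite /= normr0.
  apply: etrans (congr1 (fun f => f h) (diff_comp du dpu)) _.
  by rewrite /comp u0; exact: dphi.
- move=> x xr; have [zr zs] := uO x xr.
  have [Pphi PR] := phiP x (lam x) zr.
  have [_ PsiE] := lamP x (rho2 x xr).
  split=> //; first exact: rho3.
  have lE j : lam x 0 j = f j (u x).
    have <- : Fv (u x) 0 j = f j (u x) by rewrite mxE.
    move/eqP: PsiE; rewrite /Psi subr_eq0 => /eqP <-.
    by rewrite -[lz _]/(rsubmx (row_mx x (lam x))) row_mxKr.
  have YE : P x + phi (u x) = Y (u x).
    by rewrite /Y -[xz _]/(lsubmx (row_mx x (lam x))) row_mxKl.
  have xE : xz (u x) = x by exact: row_mxKl.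
  rewrite -/(u x) in PR.
  apply/eqP; rewrite -subr_eq0 -PR /=; apply/eqP.
  rewrite /plane_proj; apply: big1 => j _; rewrite /plane !linearB.
  have [_ _ za zb] := gen_act_rotates (lam x) j.
  rewrite -[zeta _ _]/(zetaL (lam x) _) za zb YE (aY j _ zr).1 (aY j _ zr).2.
  have [E1 E2] := fE j _ (zs j).
  move: E1 E2; rewrite /g1 /g2 lE xE.
  move: (a j (X _)) (b j (X _)) => p q E1 E2.
  have -> : p - - ((mu j + f j (u x)) * b j x) = 0.
    by rewrite opprK mulrDl addrA E1 addNr.
  have -> : q - (mu j + f j (u x)) * a j x = 0.
    by rewrite mulrDl opprD addrA E2 subrr.
  by rewrite !scale0r addr0.
- move=> x E xr cE HE EA EP EX Ez EPx.
  have [zr zs] := uO x xr.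
  have EZ y : E y -> E (Z0 y).
    rewrite -zE0; apply: Ez; rewrite zE0 -eq_on_planes; exact: EA.
  (* it is enough that [zeta (lam x)] preserves [E], and this is decided on [P x];
     the iterates of [lam x] keep [zeta l (P x)] in [E] *)
  suff El : E (zeta (lam x) (P x)) by apply: (phiE x (lam x) E) => //; exact: Ez.
  apply: (lamE x [set l | E (zeta l (P x))] (rho2 x xr)).
  + pose M : 'M[R]_(k, n) := \matrix_j N j (P x).
    rewrite (_ : mkset _ = (fun l : 'rV[R]_k => Z0 (P x) + mulmxr M l) @^-1` E).
      apply: closed_comp => // l _.
      apply: (@Ck_continuous R _ _ 0 setT) => //.
      by apply: Ck_add; [exact: openT|exact: Ck_cst|exact: (Ck_linear _ _ (mulmxr M))].
    apply/funext => l; congr E; rewrite /gen_act /= mulmx_sum_row; congr (_ + _).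
    by apply: eq_bigr => j _; rewrite rowK.
  + by rewrite /= zE0 -eq_on_planes; exact: EA.
  + move=> l Ol /= El.
    have -> : l - Psi (row_mx x l) = Fv (row_mx x l).
      by rewrite /Psi -[lz _]/(rsubmx (row_mx x l)) row_mxKr opprB addrC subrK.
    have [zr' zs'] := Ol.
    have Ephi : E (phi (row_mx x l)) by apply: (phiE x l E) => //; exact: Ez.
    (* the next iterate rotates [P x] exactly as [X] moves the current approximation *)
    have -> : zeta (Fv (row_mx x l)) (P x) = P (X (Y (row_mx x l))).
      rewrite /gen_act {2}/plane_proj linear_sum -big_split /plane_proj.
      apply: eq_bigr => j _; rewrite mxE N_plane linear_plane.
      have [-> -> _ _] := rZ j.
      have [] := fE j _ (zs' j); rewrite /g1 /g2 -[xz _]/(lsubmx (row_mx x l)) row_mxKl.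
      rewrite /plane; move: (a j (X _)) (b j (X _)) (f j _) => p q F' E1 E2.
      have -> : p = - (F' * b j x) - mu j * b j x by rewrite -E1 addrK.
      have -> : q = F' * a j x + mu j * a j x by rewrite -E2 subrK.
      by apply/rowP => i; rewrite !mxE; ring.
    apply/EP/EX; apply: (lin_subD HE) => //.
    by rewrite -[xz _]/(lsubmx (row_mx x l)) row_mxKl.
Qed.

(** With [B = A - zeta l], the square of [B] is [- l_j^2] on the [j]-th plane, while
    off the planes [B] is close to the invertible operator [A - Z0] and expands
    norms by a factor bounded away from [0]. For small [l] the two parts have
    disjoint spectra. *)
Lemma plane_proj_stable : exists2 eps : R, 0 < eps & forall (l : 'rV[R]_k) (E : set V), `|l| < eps -> lin_sub E ->
  (forall u, E u -> E (A u)) -> (forall u, E u -> E (zeta l u)) ->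
  forall u, E u -> E (P u).
Proof.
have /linear_lipschitz[c c0 Hc] := @linear_rV_continuous R _ n complement_inv.
have Ks j : exists2 K : R, 0 < K & forall x, `|N j x| <= K * `|x|.
  by apply: linear_lipschitz; exact: linear_rV_continuous.
pose K j := s2val (cid2 (Ks j)).
have K0 j : 0 < K j by exact: (s2valP (cid2 (Ks j))).
have HK j x : `|N j x| <= K j * `|x| by exact: (s2valP' (cid2 (Ks j))).
pose C := 1 + c + c * \sum_j K j.
have S0 : 0 <= \sum_j K j by apply: sumr_ge0 => j _; exact: ltW.
have C0 : 0 < C by rewrite /C ltr_wpDr ?mulr_ge0 ?addr_gt0// ltW.
have e0 : 0 < (4 * C)^-1 by rewrite invr_gt0 mulr_gt0.
exists (4 * C)^-1 => // l E le HE EA Ez u Eu.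
pose B : {linear V -> V} := A \- zetaL l.
have rB j x : planeL j (B x) = B (planeL j x).
  rewrite -[planeL j _]/(planeL j (A x - zetaL l x)) (linearB (planeL j)).
  have := rotates_plane rA j x; rewrite -[plane j (A x)]/(planeL j (A x)) => ->.
  by have := rotates_plane (gen_act_rotates l) j x; rewrite -[plane j (zetaL l x)]/(planeL j (zetaL l x)) => ->.
have PB x : P x = 0 -> P (B x) = 0.
  move=> Px; rewrite /plane_proj; apply: big1 => j _.
  rewrite -[plane j _]/(planeL j (B x)) rB.
  have -> : planeL j x = 0 by rewrite /= /plane (plane_proj_eq0 Px j).1 (plane_proj_eq0 Px j).2 !scale0r addr0.
  exact: linear0.
have cl : c * (\sum_j K j) * `|l| <= 4^-1 /\ c * `|l| <= 4^-1.
  have H : `|l| * C <= 4^-1.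
    have := ltW le; rewrite invfM => H; apply: le_trans (ler_wpM2r (ltW C0) H) _.
    by rewrite mulfVK// gt_eqF.
  have l0 := normr_ge0 l.
  have H2 : `|l| * C = `|l| + c * `|l| + c * (\sum_j K j) * `|l| by rewrite /C; ring.
  have H3 : 0 <= c * `|l| by rewrite mulr_ge0// ltW.
  have H4 : 0 <= c * (\sum_j K j) * `|l| by rewrite mulr_ge0// mulr_ge0// ltW.
  by rewrite H2 in H; split; lra.
have lower x : P x = 0 -> `|x| <= 4 / 3 * (c * `|B x|).
  move=> Px; have := Hc (F x); rewrite complement_opK /complement_op Px addr0 => H1.
  have E1 : A x - Z0 x = B x + \sum_j l 0 j *: N j x.
    by rewrite /B /= /gen_act opprD addrA subrK.
  have H2 : `|\sum_j l 0 j *: N j x| <= (\sum_j K j) * `|l| * `|x|.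
    apply: le_trans (ler_norm_sum _ _ _) _; rewrite !mulr_suml.
    apply: ler_sum => j _; rewrite normrZ mulrAC mulrC.
    by apply: ler_pM => //; exact: rV_coord_le.
  have H3 : `|A x - Z0 x| <= `|B x| + (\sum_j K j) * `|l| * `|x|.
    by rewrite E1; apply: le_trans (ler_normD _ _) _; rewrite lerD2l.
  have H4 := ler_wpM2l (ltW c0) H3.
  have H5 : c * (\sum_j K j) * `|l| * `|x| <= 4^-1 * `|x|.
    by rewrite ler_wpM2r//; exact: cl.1.
  rewrite mulrDr !mulrA in H4.
  move: H1 H4 H5; move: (`|x|) (`|A x - Z0 x|) (`|B x|) (`|l|) (\sum_j K j) => X1 X2 X3 X4 X5.
  by lra.
apply: (@lin_sub_spectral R n k planeL B (fun j => (l 0 j) ^+ 2) E) => //.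
- exact: plane_proj_idem.
- move=> j x.
  have Bv : B (v j) = - l 0 j *: w j.
    have [Zv _ _ _] := gen_act_rotates l j; have [Av _ _ _] := rA j.
    rewrite -[B _]/(A (v j) - zetaL l (v j)) Zv Av.
    by apply/rowP => i; rewrite !mxE; ring.
  have Bw : B (w j) = l 0 j *: v j.
    have [_ Zw _ _] := gen_act_rotates l j; have [_ Aw _ _] := rA j.
    rewrite -[B _]/(A (w j) - zetaL l (w j)) Zw Aw.
    by apply/rowP => i; rewrite !mxE; ring.
  rewrite -[planeL j x]/(plane j x) (linear_plane B) Bv Bw !scalerA.
  rewrite (linearD B) (linearZZ B) (linearZZ B) Bv Bw /plane.
  by apply/rowP => i; rewrite !mxE; ring.
- move=> j x Px Bx; apply/eqP; rewrite -normr_le0.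
  have H1 := lower x Px; have H2 := lower (B x) (PB x Px).
  have E1 : B (B x) = - ((l 0 j) ^+ 2 *: x) by apply/eqP; rewrite -addr_eq0; apply/eqP.
  have H3 : `|B (B x)| <= `|l| ^+ 2 * `|x|.
    rewrite E1 normrN normrZ normrX ler_wpM2r// ler_pXn2r ?nnegrE//.
    exact: rV_coord_le.
  have H4 : c * `|B x| <= c * (4 / 3 * (c * (`|l| ^+ 2 * `|x|))).
    rewrite ler_pM2l//; apply: le_trans H2 _.
    by rewrite ler_pM2l ?divr_gt0// ler_pM2l.
  have H5 : (c * `|l|) ^+ 2 <= 4^-1 ^+ 2.
    by rewrite ler_pXn2r ?nnegrE ?invr_ge0 ?mulr_ge0 ?(ltW c0)//; exact: cl.2.
  have H6 : (c * `|l|) ^+ 2 * `|x| <= 4^-1 ^+ 2 * `|x| by rewrite ler_wpM2r.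
  have E2 : c * (4 / 3 * (c * (`|l| ^+ 2 * `|x|))) = 4 / 3 * ((c * `|l|) ^+ 2 * `|x|) by ring.
  rewrite E2 in H4; move: H1 H4 H6.
  by move: (`|x|) (`|B x|) (`|l|) => X1 X2 X3; lra.
- by move=> x Ex; apply: (lin_subB HE); [exact: EA|exact: Ez].
Qed.

End Reduction.

(** * Symmetry of second derivatives *)

Section Schwarz.
Variables (R : realType) (n : nat).
Local Notation V := 'rV[R]_n.

Lemma is_diff_shift (W : normedModType R) (f : V -> W) c y :
  differentiable f (y + c) -> is_diff y (fun z => f (z + c)) ('d f (y + c)).
Proof.
move=> df.
have ds : is_diff y (fun z : V => z + c) (id : V -> V).
  by apply: is_diff_eq; apply/funext => z /=; rewrite addr0.
have ds' : differentiable (fun z : V => z + c) y by [].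
apply: DiffDef; first exact: (differentiable_comp ds' df).
apply: etrans (diff_comp ds' df) _.
by rewrite diff_val.
Qed.

Lemma second_difference (f : V -> R^o) x u v e : (forall k, Ck_on k setT f) -> 0 < e ->
  exists2 d : R, 0 < d & forall s : R, 0 < s -> s * (`|u| + `|v|) < d ->
   `|f (x + s *: v + s *: u) - f (x + s *: v) - (f (x + s *: u) - f x)
     - s ^+ 2 * 'D_u ('D_v f : V -> R^o) x| <= e * s ^+ 2 * `|u|.
Proof.
move=> sf e0.
have [_ sfv] := sf 2%N; have {}sfv := sfv v.
have df y : differentiable f y by exact: (sf 1%N).1.
have [d d0 Hd] := strict_differentiable_scalar openT sfv (I : setT x) e0.
exists d => // s s0 sd.
pose phi (y : V) : R^o := f (y + s *: u) - f y.
have dphi y : is_diff y phi (fun w => 'd f (y + s *: u) w - 'd f y w).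
  have H1 := is_diff_shift (df (y + s *: u)).
  by have := is_diffB H1 (differentiableP (df y)).
have [th th01 E] : exists2 th : R, 0 <= th <= 1 & phi (x + s *: v) - phi x =
    'd phi (x + th *: (x + s *: v - x)) (x + s *: v - x).
  by apply: mean_value_rV => th _; case: (dphi (x + th *: (x + s *: v - x))).
have xv : x + s *: v - x = s *: v by rewrite addrC addKr.
rewrite xv in E; set y := x + th *: (s *: v) in E.
have B w a b : 0 <= a <= s -> 0 <= b <= s -> w = x + a *: v + b *: u -> ball x d w.
  move=> /andP[a0 a1] /andP[b0 b1] ->; rewrite -ball_normE /= -addrA opprD addrA subrr sub0r normrN.
  apply: le_lt_trans sd; apply: le_trans (ler_normD _ _) _.
  rewrite !normrZ !ger0_norm// mulrDr addrC.
  by apply: lerD; apply: ler_wpM2r.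
have /andP[th0 th1] := th01.
have ths : 0 <= th * s <= s by rewrite mulr_ge0 ?(ltW s0)//= ger_pMl.
have s_s : 0 <= s <= s by apply/andP; split=> //; exact: ltW.
have z_s : (0 : R) <= (0 : R) <= s by rewrite lexx /= ltW.
have B1 : ball x d (y + s *: u) by apply: (B _ (th * s) s) => //; rewrite /y scalerA.
have B2 : ball x d y by apply: (B _ (th * s) 0) => //; rewrite /y scalerA scale0r addr0.
have := Hd _ _ B1 B2.
have -> : y + s *: u - y = s *: u by rewrite addrC addKr.
have Du : 'd ('D_v f : V -> R^o) x (s *: u) = s * 'D_u ('D_v f : V -> R^o) x.
  rewrite linearZ /=; congr (_ * _); rewrite deriveE//.
  exact: sfv.1.
have nu : `|s *: u| = s * `|u| by rewrite normrZ gtr0_norm.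
have L1 z : 'd f z (s *: v) = s * 'D_v f z :> R.
  apply: etrans (linearZZ ('d f z) s v) _.
  by apply: (congr1 (fun r : R => s * r)); exact: esym (deriveE _ (df z)).
have E2 : phi (x + s *: v) - phi x = s * ('D_v f (y + s *: u) - 'D_v f y).
  apply: etrans E _.
  have [_ Ed] := dphi y; apply: etrans (congr1 (fun g => g (s *: v)) Ed) _.
  exact: etrans (congr2 (fun a b : R => a - b) (L1 _) (L1 _)) (esym (mulrBr _ _ _)).
rewrite Du nu -/(phi (x + s *: v)) -/(phi x) E2.
move: ('D_v f (y + s *: u) - 'D_v f y) ('D_u ('D_v f : V -> R^o) x) => p q H.
have -> : s * p - s ^+ 2 * q = s * (p - s * q) by ring.
rewrite normrM (gtr0_norm s0) (_ : e * s ^+ 2 * `|u| = s * (e * (s * `|u|))); last by ring.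
by rewrite ler_pM2l.
Qed.

(** Both second derivatives are the limit of the same second difference quotient. *)
Lemma derive_symmetric (f : V -> R^o) x u v : (forall k, Ck_on k setT f) ->
  'D_u ('D_v f : V -> R^o) x = 'D_v ('D_u f : V -> R^o) x.
Proof.
move=> sf; apply/eqP; rewrite -subr_eq0 -normr_le0; apply/ler_addgt0Pr => e e0; rewrite add0r.
pose M := `|u| + `|v| + 1.
have M0 : 0 < M by rewrite ltr_wpDl// addr_ge0.
have eM : 0 < e / M by rewrite divr_gt0.
have [d1 d10 H1] := second_difference x u v sf eM.
have [d2 d20 H2] := second_difference x v u sf eM.
pose d := Num.min d1 d2; have d0 : 0 < d by rewrite lt_min d10.
pose s := d / M; have s0 : 0 < s by rewrite divr_gt0.
have sd : s * (`|u| + `|v|) < d.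
  by rewrite /s mulrAC ltr_pdivrMr// ltr_pM2l// /M ltrDl.
have dd : d <= d1 /\ d <= d2 by rewrite !ge_min !lexx orbT.
have A1 := H1 s s0 (lt_le_trans sd dd.1).
have A2 : `|f (x + s *: u + s *: v) - f (x + s *: u) - (f (x + s *: v) - f x)
     - s ^+ 2 * 'D_v ('D_u f : V -> R^o) x| <= e / M * s ^+ 2 * `|v|.
  by apply: H2 => //; rewrite [`|v| + _]addrC; exact: lt_le_trans sd dd.2.
have E : f (x + s *: u + s *: v) - f (x + s *: u) - (f (x + s *: v) - f x) =
   f (x + s *: v + s *: u) - f (x + s *: v) - (f (x + s *: u) - f x).
  by rewrite [x + s *: u + s *: v]addrAC; move: (f _) (f _) (f _) (f _) => p q r t; ring.
rewrite E in A2; move: A1 A2.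
move: ('D_u ('D_v f : V -> R^o) x) ('D_v ('D_u f : V -> R^o) x) (f _ - f _ - (f _ - f _)) => p q g A1 A2.
have s20 : 0 < s ^+ 2 by rewrite exprn_gt0.
rewrite -(ler_pM2l s20) -{1}(gtr0_norm s20) -normrM.
have -> : s ^+ 2 * (p - q) = (g - s ^+ 2 * q) - (g - s ^+ 2 * p) by ring.
apply: le_trans (ler_normB _ _) _; apply: le_trans (lerD A2 A1) _.
have -> : e / M * s ^+ 2 * `|v| + e / M * s ^+ 2 * `|u| =
    s ^+ 2 * (e * ((`|u| + `|v|) / M)) by ring.
rewrite ler_pM2l// -[leRHS]mulr1 ler_pM2l// ler_pdivrMr// mul1r.
by rewrite /M lerDl.
Qed.

End Schwarz.

(** * Hamiltonian vector fields *)

Section DualVectors.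
Variables (R : realType) (t : vectType R).

(** The matrix of the forms [s] in a basis of [t] has full row rank, and the columns
    of a right inverse are the coordinates of the dual vectors. *)
Lemma free_dual (s : seq 'Hom(t, R^o)) : free s ->
  exists eta : 'I_(size s) -> t, forall i j : 'I_(size s), s`_i (eta j) = (i == j)%:R :> R.
Proof.
move=> fs; pose k := size s; pose d := \dim {:t}.
pose bt : d.-tuple t := vbasis {:t}.
pose M : 'M[R]_(k, d) := \matrix_(i, l) (s`_i (bt`_l) : R).
have fM : row_free M.
  rewrite -kermx_eq0; apply/eqP/row_matrixP => i0; rewrite row0.
  set c := row i0 (kermx M).
  have cM : c *m M = 0 by rewrite /c -row_mul mulmx_ker row0.
  have E : \sum_(i < k) c 0 i *: (in_tuple s)`_i = 0.
    apply/lfunP => x; rewrite sum_lfunE lfunE /=.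
    have -> : x = \sum_(l < d) coord bt l x *: bt`_l by apply: coord_vbasis; rewrite memvf.
    apply: etrans (_ : \sum_(l < d) coord bt l x * (c *m M) 0 l = 0); last first.
      by rewrite cM; apply: big1 => l _; rewrite mxE mulr0.
    under eq_bigr do rewrite lfunE /= linear_sum /=.
    rewrite (eq_bigr (fun i : 'I_k => \sum_(l < d) c 0 i * (coord bt l x * s`_i (bt`_l)))); last first.
      move=> i _; rewrite scaler_sumr; apply: eq_bigr => l _.
      by rewrite linearZ.
    rewrite exchange_big /=; apply: eq_bigr => l _.
    rewrite mxE mulr_sumr; apply: eq_bigr => i _.
    by rewrite [M i l]mxE mulrCA.
  have /freeP/(_ _ E) H : free (in_tuple s) by exact: fs.
  by apply/rowP => i; rewrite H mxE.
have /row_freeP[B MB] := fM.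
exists (fun j => \sum_(l < d) B l j *: bt`_l) => i j.
rewrite linear_sum /=.
have := congr1 (fun N : 'M[R]_k => N i j) MB; rewrite !mxE => <-.
by apply: eq_bigr => l _; rewrite linearZ !mxE mulrC.
Qed.

End DualVectors.

Section BilinearForms.
Variables (R : realType) (n : nat) (b : 'rV[R]_n -> 'rV[R]_n -> R).
Hypotheses (bl : forall y, scalar (b ^~ y)) (br : forall x, scalar (b x)).

Definition formL y : {linear 'rV[R]_n -> R^o} :=
  HB.pack (b ^~ y : 'rV[R]_n -> R^o) (GRing.isLinear.Build _ _ _ _ _ (bl y)).
Definition formR x : {linear 'rV[R]_n -> R^o} :=
  HB.pack (b x : 'rV[R]_n -> R^o) (GRing.isLinear.Build _ _ _ _ _ (br x)).

Lemma bform0l y : b 0 y = 0. Proof. exact: (linear0 (formL y)). Qed.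
Lemma bformDl x x' y : b (x + x') y = b x y + b x' y.
Proof. exact: (linearD (formL y)). Qed.
Lemma bformDr x y y' : b x (y + y') = b x y + b x y'.
Proof. exact: (linearD (formR x)). Qed.
Lemma bformNr x y : b x (- y) = - b x y. Proof. exact: (linearN (formR x)). Qed.
Lemma bformBl x x' y : b (x - x') y = b x y - b x' y.
Proof. exact: (linearB (formL y)). Qed.
Lemma bformZl c x y : b (c *: x) y = c * b x y. Proof. exact: (linearZZ (formL y)). Qed.
Lemma bformZr c x y : b x (c *: y) = c * b x y. Proof. exact: (linearZZ (formR x)). Qed.

Lemma form_matrix_unit : (forall x, (forall y, b x y = 0) -> x = 0) ->
  (\matrix_(i, j) b (delta_mx 0 i) (delta_mx 0 j) : 'M[R]_n) \in unitmx.
Proof.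
move=> nd; rewrite unitmxE unitfE; apply/det0P => -[x x0 xM].
move/eqP: x0; apply; apply: nd => y.
rewrite (row_sum_delta y) -[b x _]/(formR x _) linear_sum; apply: big1 => j _.
rewrite linearZ /= (_ : b x (delta_mx 0 j) = 0) ?scaler0//.
have := congr1 (fun N : 'rV[R]_n => N 0 j) xM; rewrite !mxE => <-.
rewrite {1}(row_sum_delta x) -[b _ _]/(formL _ _) linear_sum.
by apply: eq_bigr => i _; rewrite linearZ /= mxE.
Qed.

(** A nondegenerate form identifies a vector with its pairings; this is how a
    Hamiltonian vector field is smooth as soon as the Hamiltonian is. *)
Lemma form_row x (c : 'rV[R]_n) : (forall x, (forall y, b x y = 0) -> x = 0) ->
  (forall j, b x (delta_mx 0 j) = c 0 j) ->
  x = c *m invmx (\matrix_(i, j) b (delta_mx 0 i) (delta_mx 0 j)).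
Proof.
move=> nd H; set M := \matrix_(i, j) _.
have -> : c = x *m M.
  apply/rowP => j; rewrite -H mxE {1}(row_sum_delta x) -[b _ _]/(formL _ _) linear_sum.
  by apply: eq_bigr => i _; rewrite linearZ /= mxE.
by rewrite mulmxK//; exact: form_matrix_unit.
Qed.

End BilinearForms.

Section HamiltonianField.
Variables (R : realType) (G : topGroupType) (n : nat) (act : G -> 'rV[R]_n -> 'rV[R]_n).
Hypothesis hact : representation act.
Variable omega : 'rV[R]_n -> 'rV[R]_n -> R.
Hypothesis homega : symplectic_form act omega.
Variable h : 'rV[R]_n -> R.
Hypothesis hsmooth : smooth_on [set: 'rV[R]_n] (h : 'rV[R]_n -> R^o).
Hypothesis hinv : forall g x, h (act g x) = h x.
Hypothesis hcrit : forall v : 'rV[R]_n, 'd (h : 'rV[R]_n -> R^o) 0 v = 0.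
Variable X : 'rV[R]_n -> 'rV[R]_n.
Hypothesis hX : hamiltonian_vf omega h X.
Local Notation V := 'rV[R]_n.

Lemma hamiltonian_smooth k : Ck_on k setT (h : V -> R^o).
Proof.
apply: Ck_local => x _; have [B [g [oO Ox gC hg]]] := hsmooth (I : setT x).
exists B; split=> //; apply: Ck_ext (gC k) => // y Oy; symmetry.
by apply: hg; rewrite inE.
Qed.

Lemma hamiltonian_diff x : differentiable (h : V -> R^o) x.
Proof. exact: (hamiltonian_smooth 1%N).1. Qed.

Lemma field_smooth k : Ck_on k setT X.
Proof.
have [[bl br _] _ nd] := homega.
pose c x : V := \row_j 'D_(delta_mx 0 j) (h : V -> R^o) x.
apply: (@Ck_ext _ _ _ _ _ (fun x => mulmxr (invmx (\matrix_(i, j) omega (delta_mx 0 i) (delta_mx 0 j))) (c x))).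
- exact: openT.
- move=> x _; symmetry; apply: form_row => // j.
  by rewrite mxE deriveE ?hX//; exact: hamiltonian_diff.
- apply: (Ck_linear_comp (g := c)); [exact: openT|exact: linear_rV_continuous|].
  apply: Ck_row; first exact: openT.
  move=> j; apply: (@Ck_ext _ _ _ _ _ ('D_(delta_mx 0 j) (h : V -> R^o))).
  + exact: openT.
  + by move=> x _; rewrite mxE.
  + by have [_] := hamiltonian_smooth k.+1; apply.
Qed.

Lemma omega_inj x x' : (forall y, omega x y = omega x' y) -> x = x'.
Proof.
have [[bl br _] _ nd] := homega => H; apply/eqP; rewrite -subr_eq0; apply/eqP/nd => y.
by rewrite (bformBl bl) H subrr.
Qed.

Lemma omega_sym x y : omega x y = - omega y x.
Proof.
have [[bl br _] alt _] := homega; have := alt (x + y).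
rewrite (bformDl bl) !(bformDr br) !alt add0r addr0 => H.
by apply/eqP; rewrite -addr_eq0 H.
Qed.

Lemma field0 : X 0 = 0.
Proof.
have [[bl br _] _ nd] := homega.
by apply: nd => y; rewrite -hX hcrit.
Qed.

Lemma field_equivariant g x : X (act g x) = act g (X x).
Proof.
have [[bl br inv] _ nd] := homega.
apply: omega_inj => y.
have -> : y = act g (act g^-1%g y) by rewrite (actKV hact).
rewrite inv -!hX.
have dg : differentiable (actL hact g) x by exact: linear_rV_differentiable.
have dh : differentiable (h : V -> R^o) (actL hact g x) by exact: hamiltonian_diff.
have E : (h : V -> R^o) \o actL hact g = h by apply/funext => z /=; rewrite hinv.
have H := congr1 (fun f => f (act g^-1%g y)) (diff_comp dg dh).
apply: esym; apply: etrans (congr1 (fun f : V -> R^o => 'd f x (act g^-1%g y)) (esym E)) _.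
apply: etrans H _; apply: (congr1 ('d (h : V -> R^o) (act g x))).
apply: etrans (esym (deriveE _ dg)) _; exact: (derive_linear_rV (actL hact g)).
Qed.

Definition field_lin : {linear V -> V} := 'd X 0.

Local Notation lin := field_lin.

Lemma field_diff x : differentiable X x.
Proof. exact: (field_smooth 1%N).1. Qed.

Lemma lin_act g x : lin (act g x) = act g (lin x).
Proof.
have dX : differentiable X (actL hact g 0) by exact: field_diff.
have dg : differentiable (actL hact g) 0 by exact: linear_rV_differentiable.
have E : X \o actL hact g = actL hact g \o X.
  by apply/funext => y /=; rewrite field_equivariant.
have cg : continuous (actL hact g) by exact: linear_rV_continuous.
have H1 := derive_linear_comp x cg (field_diff 0).
have dc : differentiable (X \o actL hact g) 0 by exact: differentiable_comp.
have g0 : actL hact g 0 = 0 by exact: (linear0 (actL hact g)).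
have H2 : 'D_x (X \o actL hact g) 0 = lin (act g x).
  apply: etrans (deriveE _ dc) _.
  apply: etrans (congr1 (fun f => f x) (diff_comp dg dX)) _.
  apply: etrans (congr1 (fun y => 'd X y ('d (actL hact g) 0 x)) g0) _.
  apply: (congr1 lin); apply: etrans (esym (deriveE _ dg)) _.
  exact: derive_linear_rV.
rewrite -H2 E H1; congr (act g _); exact: (deriveE _ (field_diff 0)).
Qed.

Lemma derive_hamiltonian v y : 'D_v (h : V -> R^o) y = omega (X y) v.
Proof. by rewrite deriveE ?hX//; exact: hamiltonian_diff. Qed.

Lemma d2_hamiltonian u v : d2 h 0 u v = omega (lin u) v.
Proof.
have [[bl br inv] _ nd] := homega.
rewrite /d2 (_ : (fun y => 'D_v h y : R^o) = formL bl v \o X); last first.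
  by apply/funext => y; exact: derive_hamiltonian.
have cv : continuous (formL bl v) by exact: linear_rV_continuous.
apply: etrans (derive_linear_comp u cv (field_diff 0)) _.
by apply: (congr1 (formL bl v)); exact: (deriveE _ (field_diff 0)).
Qed.

(** The linearization of a Hamiltonian vector field is infinitesimally symplectic
    because second derivatives commute. *)
Lemma lin_skew u v : omega (lin u) v = - omega u (lin v).
Proof.
rewrite -(omega_sym (lin v) u) -!d2_hamiltonian.
exact: (derive_symmetric 0 u v hamiltonian_smooth).
Qed.

End HamiltonianField.

(** * Weight vectors *)

Section WeightVectors.
Variables (R : realType) (G : topGroupType) (T : set G) (t : vectType R) (exp : t -> G).
Hypothesis hexp : lie_algebra_exp T exp.
Variables (n : nat) (act : G -> 'rV[R]_n -> 'rV[R]_n).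
Hypothesis hact : representation act.
Variables (omega ip : 'rV[R]_n -> 'rV[R]_n -> R).
Hypothesis homega : symplectic_form act omega.
Hypothesis hip : inner_product act ip.
Variable J : 'End('rV[R]_n).
Hypothesis omegaE : forall x y, omega x y = ip x (J y).
Local Notation V := 'rV[R]_n.
Local Notation lie_act := (lie_act exp act).

Let ipl : forall y, scalar (ip ^~ y). Proof. by have [[]] := hip. Qed.
Let ipr : forall x, scalar (ip x). Proof. by have [[]] := hip. Qed.

Lemma ip_sym x y : ip x y = ip y x. Proof. by have [_ H _] := hip. Qed.

Lemma ip_inv g x y : ip (act g x) (act g y) = ip x y.
Proof. by have [[_ _ H] _ _] := hip. Qed.

Lemma ip_inj x x' : (forall y, ip y x = ip y x') -> x = x'.
Proof.
have [_ _ pos] := hip => H; apply/eqP; rewrite -subr_eq0; apply: contraT => /pos.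
by rewrite (bformDr ipr) (bformNr ipr) H subrr ltxx.
Qed.

Lemma J_skew x y : ip (J x) y = - ip x (J y).
Proof. by rewrite ip_sym -!omegaE (omega_sym homega). Qed.

(** [J] compares two invariant forms, hence is equivariant on the whole space. *)
Lemma J_act g x : J (act g x) = act g (J x).
Proof.
have [[_ _ inv] _ _] := homega.
apply: ip_inj => y; rewrite -omegaE -[y](actKV hact g) inv omegaE.
by rewrite ip_inv.
Qed.

Lemma J_lie_act zeta x : J (lie_act zeta x) = lie_act zeta (J x).
Proof.
pose JL : {linear V -> V} := J.
by apply: (@lie_act_commute _ _ _ _ _ hexp _ _ hact zeta JL x) => s y /=; exact: J_act.
Qed.

Lemma is_derive_scalel (f : R -> R) (s d : R) (y : V) :
  is_derive s 1 f d -> is_derive s 1 (fun r => f r *: y) (d *: y).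
Proof.
move=> H.
have lin : linear (fun r : R^o => (r : R) *: y) by move=> c p q; rewrite scalerDl scalerA.
pose L : {linear R^o -> V} := HB.pack (fun r : R^o => (r : R) *: y) (GRing.isLinear.Build _ _ _ _ _ lin).
have cL : continuous L by exact: scalel_continuous.
exact: (is_derive_linear_comp cL H).
Qed.

Lemma lie_act_weight (alpha : 'Hom(t, R^o)) (y : V) zeta :
  weight_vector act exp J alpha y -> lie_act zeta y = (2 * pi * alpha zeta : R) *: J y.
Proof.
move=> H; apply: (lie_act_eq (hact := hact)).
pose c : R := 2 * pi * alpha zeta.
have -> : (fun s => flow exp hact zeta s y) =
    (fun s => (cos (s * c) : R) *: y) + (fun s => (sin (s * c) : R) *: J y).
  apply/funext => s; rewrite /flow /= H /= linearZ /= fctE /c.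
  by congr (cos _ *: _ + sin _ *: _); rewrite /GRing.scale /=; ring.
have ds : is_derive (0 : R) (1 : R) (fun s : R => s * c) c.
  have := @is_deriveM R _ (id : R -> R) (fun=> c) 0 1 _ _ (is_derive_id _ _) (is_derive_cst _ _ _).
  by rewrite scaler0 add0r /GRing.scale /= mulr1.
have dcos : is_derive (0 : R) 1 (fun s : R => cos (s * c)) 0.
  have H1 : is_derive (0 * c) 1 cos (- sin (0 * c)) by exact: is_derive_cos.
  have := @is_derive1_comp R cos (fun s : R => s * c) 0 _ _ H1 ds.
  by rewrite mul0r sin0 oppr0 /GRing.scale /= ?mul0r ?mulr0.
have dsin : is_derive (0 : R) 1 (fun s : R => sin (s * c)) c.
  have H1 : is_derive (0 * c) 1 sin (cos (0 * c)) by exact: is_derive_sin.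
  have := @is_derive1_comp R sin (fun s : R => s * c) 0 _ _ H1 ds.
  by rewrite mul0r cos0 /GRing.scale /= ?mul1r ?mulr1.
have := is_deriveD (is_derive_scalel y dcos) (is_derive_scalel (J y) dsin).
by rewrite scale0r add0r.
Qed.

(** When [2 pi alpha] takes the value [1] at [eta], a quarter of a turn of its flow acts
    on [y] as [J], and half a turn as [- 1]. *)
Lemma J_weight (alpha : 'Hom(t, R^o)) (y : V) eta :
  weight_vector act exp J alpha y -> (2 * pi * alpha eta : R) = 1 -> J (J y) = - y.
Proof.
move=> H E.
have E' (s : R) : (2 * pi * alpha (s *: eta) : R) = s.
  by rewrite linearZ /= /GRing.scale /= mulrCA E mulr1.
have quarter : act (exp ((pi / 2) *: eta)) y = J y.
  by rewrite H E' cos_pihalf sin_pihalf scale0r scale1r add0r.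
have half : act (exp (pi *: eta)) y = - y.
  by rewrite H E' cospi sinpi scale0r addr0 scaleN1r.
have <- : act (exp ((pi / 2) *: eta)) (J y) = J (J y) by rewrite -J_act quarter.
rewrite -quarter -(actM hact) -(expD hexp) -scalerDl -half.
by congr (act (exp (_ *: _)) _); rewrite -splitr.
Qed.

Variables (s : seq 'Hom(t, R^o)) (vs : seq V).
Hypothesis szv : size vs = size s.
Hypothesis fs : free s.
Hypothesis ws : forall i, (i < size s)%N -> weight_vector act exp J s`_i vs`_i.
Hypothesis vs0 : forall i, (i < size s)%N -> vs`_i != 0.
Local Notation k := (size s).

(** The elements of [t] whose flows rotate one weight plane at unit speed and fix the
    others. *)
Lemma weight_generators : exists eta : 'I_k -> t, forall i j : 'I_k,
  (2 * pi * s`_i (eta j) : R) = (i == j)%:R.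
Proof.
have [eta H] := free_dual fs.
exists (fun j => (2 * pi)^-1 *: eta j) => i j.
have -> : s`_i ((2 * pi)^-1 *: eta j) = (2 * pi)^-1 * (s`_i (eta j) : R) :> R.
  exact: linearZZ.
rewrite H mulrA divff ?mul1r//.
by rewrite mulf_neq0// gt_eqF// pi_gt0.
Qed.

Definition weight_vec (j : 'I_k) : V := vs`_j.
Definition weight_vecJ (j : 'I_k) : V := J (weight_vec j).
Definition weight_sqnorm j := ip (weight_vec j) (weight_vec j).

Lemma weight_sqnorm_gt0 j : 0 < weight_sqnorm j.
Proof. by have [_ _ pos] := hip; apply: pos; exact: vs0. Qed.

Lemma J_weight_vecJ j : J (weight_vecJ j) = - weight_vec j.
Proof.
have [eta H] := weight_generators.
by apply: (J_weight (eta := eta j) (ws (ltn_ord j))); rewrite H eqxx.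
Qed.

Lemma lie_act_weight_vec zeta j : lie_act zeta (weight_vec j) = (2 * pi * s`_j zeta : R) *: weight_vecJ j.
Proof. exact: (lie_act_weight _ (ws (ltn_ord j))). Qed.

Lemma lie_act_weight_vecJ zeta j : lie_act zeta (weight_vecJ j) = - (2 * pi * s`_j zeta : R) *: weight_vec j.
Proof. by rewrite /weight_vecJ -J_lie_act lie_act_weight_vec linearZ /= J_weight_vecJ scalerN scaleNr. Qed.

Lemma ip_skew zeta x y : ip (lie_act zeta x) y = - ip x (lie_act zeta y).
Proof. by apply: (lie_act_skew hexp hact); have [H _ _] := hip. Qed.

(** Distinct planes are orthogonal: a generator rotates one and fixes the other, and
    it is skew. *)
Lemma ip_vv i j : ip (weight_vec i) (weight_vec j) = (i == j)%:R * weight_sqnorm j.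
Proof.
have [->|ij] := eqVneq i j; first by rewrite mul1r.
have [eta H] := weight_generators.
have E1 : lie_act (eta j) (weight_vec i) = 0 by rewrite lie_act_weight_vec H (negPf ij) scale0r.
have E2 : lie_act (eta j) (weight_vecJ j) = - weight_vec j by rewrite lie_act_weight_vecJ H eqxx scaleN1r.
rewrite mul0r -[weight_vec j]opprK -E2 (bformNr ipr) -ip_skew E1; exact: (bform0l ipl).
Qed.

Lemma ip_vw i j : ip (weight_vec i) (weight_vecJ j) = 0.
Proof.
have [->|ij] := eqVneq i j.
  by rewrite /weight_vecJ -omegaE; have [_ ->] := homega.
have [eta H] := weight_generators.
have E1 : lie_act (eta j) (weight_vec i) = 0 by rewrite lie_act_weight_vec H (negPf ij) scale0r.
have E2 : lie_act (eta j) (weight_vec j) = weight_vecJ j by rewrite lie_act_weight_vec H eqxx scale1r.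
apply/eqP; rewrite -E2 -oppr_eq0 -ip_skew E1; apply/eqP; exact: (bform0l ipl).
Qed.

Lemma ip_ww i j : ip (weight_vecJ i) (weight_vecJ j) = (i == j)%:R * weight_sqnorm j.
Proof.
by rewrite {1}/weight_vecJ J_skew J_weight_vecJ (bformNr ipr) opprK ip_vv.
Qed.

Lemma weight_coord_linear j : linear (fun x : V => ip x (weight_vec j) / weight_sqnorm j : R^o).
Proof.
by move=> c x y; rewrite (bformDl ipl) (bformZl ipl) mulrDl -mulrA.
Qed.

Definition weight_coord j : {linear V -> R^o} :=
  HB.pack (fun x : V => ip x (weight_vec j) / weight_sqnorm j : R^o) (GRing.isLinear.Build _ _ _ _ _ (weight_coord_linear j)).

Lemma weight_coordJ_linear j : linear (fun x : V => ip x (weight_vecJ j) / weight_sqnorm j : R^o).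
Proof.
by move=> c x y; rewrite (bformDl ipl) (bformZl ipl) mulrDl -mulrA.
Qed.

Definition weight_coordJ j : {linear V -> R^o} :=
  HB.pack (fun x : V => ip x (weight_vecJ j) / weight_sqnorm j : R^o) (GRing.isLinear.Build _ _ _ _ _ (weight_coordJ_linear j)).

Lemma weight_coord_vec i j : weight_coord i (weight_vec j) = (i == j)%:R.
Proof.
rewrite -[weight_coord i _]/(ip (weight_vec j) (weight_vec i) / weight_sqnorm i) ip_vv mulfK; first by rewrite eq_sym.
by rewrite gt_eqF// weight_sqnorm_gt0.
Qed.

Lemma weight_coord_vecJ i j : weight_coord i (weight_vecJ j) = 0.
Proof. by rewrite /= ip_sym ip_vw mul0r. Qed.

Lemma weight_coordJ_vec i j : weight_coordJ i (weight_vec j) = 0.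
Proof. by rewrite /= ip_vw mul0r. Qed.

Lemma weight_coordJ_vecJ i j : weight_coordJ i (weight_vecJ j) = (i == j)%:R.
Proof.
rewrite -[weight_coordJ i _]/(ip (weight_vecJ j) (weight_vecJ i) / weight_sqnorm i) ip_ww mulfK; first by rewrite eq_sym.
by rewrite gt_eqF// weight_sqnorm_gt0.
Qed.

Lemma lie_rotates zeta :
  rotates weight_coord weight_coordJ weight_vec weight_vecJ (lie_actL hexp hact zeta) (fun j => 2 * pi * s`_j zeta).
Proof.
move=> j; split; rewrite /=.
- exact: lie_act_weight_vec.
- exact: lie_act_weight_vecJ.
- by move=> x; rewrite ip_skew lie_act_weight_vec (bformZr ipr) mulNr mulrA.
- by move=> x; rewrite ip_skew lie_act_weight_vecJ (bformZr ipr) !mulNr opprK mulrA.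
Qed.

Variable A : {linear V -> V}.
Hypothesis A_skew : forall x y, omega (A x) y = - omega x (A y).
Variable xi : t.
Hypothesis Av : forall j, A (weight_vec j) = lie_act xi (weight_vec j).
Hypothesis Aw : forall j, A (weight_vecJ j) = lie_act xi (weight_vecJ j).

Lemma A_rotates : rotates weight_coord weight_coordJ weight_vec weight_vecJ A (fun j => 2 * pi * s`_j xi).
Proof.
move=> j; split; rewrite /=.
- by rewrite Av lie_act_weight_vec.
- by rewrite Aw lie_act_weight_vecJ.
- move=> x; have -> : ip (A x) (weight_vec j) = - omega (A x) (weight_vecJ j).
    by rewrite omegaE J_weight_vecJ (bformNr ipr) opprK.
  by rewrite A_skew opprK Aw lie_act_weight_vecJ omegaE linearZ /= (bformZr ipr) !mulNr mulrA.
- move=> x; rewrite -[weight_vecJ j]/(J (weight_vec j)) -omegaE A_skew Av lie_act_weight_vec omegaE linearZ /= J_weight_vecJ.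
  by rewrite (bformZr ipr) (bformNr ipr) mulrN opprK mulrA.
Qed.

Lemma plane_proj_span u : u \in <<vs ++ map J vs>>%VS -> plane_proj weight_coord weight_coordJ weight_vec weight_vecJ u = u.
Proof.
pose PLw : {linear V -> V} := plane_projL weight_coord weight_coordJ weight_vec weight_vecJ.
pose W := fixedSpace (linfun PLw).
have sub : (<<vs ++ map J vs>> <= W)%VS.
  apply/span_subvP => x; rewrite mem_cat => /orP[|/mapP[y + ->]].
    move=> xin; have /(nthP 0) [i ik <-] := xin; rewrite szv in ik.
    apply/fixedSpaceP; rewrite lfunE /= /plane_proj (bigD1 (Ordinal ik))//=.
    rewrite /plane (weight_coord_vec _ (Ordinal ik)) (weight_coordJ_vec _ (Ordinal ik)) eqxx scale1r scale0r addr0.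
    rewrite big1 ?addr0// => j jk.
    by rewrite (weight_coord_vec j (Ordinal ik)) (weight_coordJ_vec j (Ordinal ik)) (negPf jk) !scale0r addr0.
  move=> xin; have /(nthP 0) [i ik <-] := xin; rewrite szv in ik.
  apply/fixedSpaceP; rewrite lfunE /= /plane_proj (bigD1 (Ordinal ik))//=.
  rewrite /plane (weight_coord_vecJ _ (Ordinal ik)) (weight_coordJ_vecJ _ (Ordinal ik)) eqxx scale1r scale0r add0r.
  rewrite big1 ?addr0// => j jk.
  by rewrite (weight_coord_vecJ j (Ordinal ik)) (weight_coordJ_vecJ j (Ordinal ik)) (negPf jk) !scale0r addr0.
move=> /(subvP sub) /fixedSpaceP; rewrite lfunE.
exact.
Qed.

Lemma plane_proj_in_span x : plane_proj weight_coord weight_coordJ weight_vec weight_vecJ x \in <<vs ++ map J vs>>%VS.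
Proof.
apply: memv_suml => j _; apply: memvD; apply: memvZ; apply: memv_span.
  by rewrite mem_cat mem_nth// szv.
by rewrite mem_cat; apply/orP; right; apply: map_f; rewrite mem_nth// szv.
Qed.

(** [Y - zeta y] is [omega]-orthogonal to the orbit direction [eta_j y], since [Y] is
    by hypothesis and [zeta y] is because [zeta] and [eta_j] are commuting and skew.
    Moving [eta_j] to the other side restricts the pairing to the [j]-th plane, where
    it is the inner product of the components of [Y - zeta y] and [y]. *)
Lemma weights_radial (eta : 'I_k -> t) (Y y : V) zeta j :
  (forall i j : 'I_k, (2 * pi * s`_i (eta j) : R) = (i == j)%:R) ->
  omega Y (lie_act (eta j) y) = 0 ->
  plane_proj weight_coord weight_coordJ weight_vec weight_vecJ (Y - lie_act zeta y) = Y - lie_act zeta y ->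
  weight_coord j (Y - lie_act zeta y) * weight_coord j y + weight_coordJ j (Y - lie_act zeta y) * weight_coordJ j y = 0.
Proof.
move=> H HY; set r := Y - lie_act zeta y => Pr.
have [[bl br inv] alt nd] := homega.
have Hz : omega (lie_act zeta y) (lie_act (eta j) y) = 0.
  have skew z x x' : omega (lie_act z x) x' = - omega x (lie_act z x').
    by apply: (lie_act_skew hexp hact); have [] := homega.
  have E1 : omega (lie_act zeta y) (lie_act (eta j) y) = omega (lie_act (eta j) y) (lie_act zeta y).
    rewrite (skew zeta y (lie_act (eta j) y)) (skew (eta j) y (lie_act zeta y)).
    by rewrite (lie_act_lie_act hexp hact (eta j) zeta y).
  have E2 := omega_sym homega (lie_act (eta j) y) (lie_act zeta y).
  move: E1 E2; move: (omega _ _) (omega _ _) => p q; lra.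
have E0 : ip r (J (lie_act (eta j) y)) = 0.
  by rewrite -omegaE (bformBl bl) HY Hz subrr.
have Nr : lie_act (eta j) r = (weight_coord j r : R) *: weight_vecJ j - (weight_coordJ j r : R) *: weight_vec j.
  have rN i : rotates weight_coord weight_coordJ weight_vec weight_vecJ (lie_actL hexp hact (eta i)) (fun j => (i == j)%:R).
    have := lie_rotates (eta i); congr rotates; apply/funext => l.
    by rewrite H eq_sym.
  have := N_plane rN j r; rewrite Pr.
  exact.
have Jw x : ip (weight_vecJ j) (J x) = weight_sqnorm j * weight_coord j x.
  by rewrite ip_sym J_skew J_weight_vecJ (bformNr ipr) opprK /= mulrC divfK// gt_eqF// weight_sqnorm_gt0.
have Jv x : ip (weight_vec j) (J x) = - (weight_sqnorm j * weight_coordJ j x).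
  by rewrite ip_sym J_skew -/(weight_vecJ j) /= [weight_sqnorm j * _]mulrC divfK// gt_eqF// weight_sqnorm_gt0.
have : ip (lie_act (eta j) r) (J y) = 0.
  by apply/eqP; rewrite ip_skew oppr_eq0 -J_lie_act E0.
rewrite Nr (bformBl ipl) !(bformZl ipl) Jw Jv.
move: (weight_coord j r : R) (weight_coordJ j r : R) (weight_coord j y : R) (weight_coordJ j y : R) (weight_sqnorm_gt0 j) => p q p' q' w0 E.
have : weight_sqnorm j * (p * p' + q * q') = 0 by rewrite -E; ring.
by move/eqP; rewrite mulf_eq0 gt_eqF//= => /eqP.
Qed.

End WeightVectors.

(** * Graphs as submanifolds *)

Lemma smooth_on_Ck (R : realType) (V W : normedModType R) (O : set V) (f : V -> W) :
  open O -> (forall k, Ck_on k O f) -> smooth_on O f.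
Proof. by move=> oO sf x Ox; exists O, f; split. Qed.

Lemma Ck_id (R : realType) (V : normedModType R) k (O : set V) : Ck_on k O (fun x : V => x).
Proof.
case: k => [|k]; first by move=> x _; exact: cvg_id.
split=> [x _|v] //.
rewrite (_ : 'D_v _ = fun=> v); first exact: Ck_cst.
by apply/funext => x; exact: derive_id.
Qed.

Section Graph.
Variables (R : realType) (n : nat).
Local Notation V := 'rV[R]_n.
Variables (Pi : {linear V -> V}) (V0 : {vspace V}).
Hypothesis Pi_V0 : forall x, x \in V0 <-> Pi x = x.
Variables (rho : R) (phi : V -> V).
Hypothesis rho0 : 0 < rho.
Local Notation O := [set x : V | `|x| < rho].
Hypothesis sphi : forall k, Ck_on k O phi.
Hypothesis Pphi : forall x, O x -> Pi (phi x) = 0.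
Hypothesis phi0 : phi 0 = 0.
Hypothesis dphi0 : forall v, 'd phi 0 v = 0.

Let M0 := (fun x => x + phi x) @` (O `&` [set x | x \in V0]).

Lemma graph_open : open O. Proof. exact: open_norm_ball. Qed.

Lemma graph_zero : O 0. Proof. by rewrite /= normr0. Qed.

Lemma graph_smooth k : Ck_on k O (fun x => x + phi x).
Proof. by apply: Ck_add; [exact: graph_open|exact: Ck_id|exact: sphi]. Qed.

Lemma graph_proj y : M0 y -> [/\ Pi y \in V0, O (Pi y) & y = Pi y + phi (Pi y)].
Proof.
move=> [x [Ox xV0] <-]; have Pix : Pi (x + phi x) = x.
  by rewrite linearD Pphi// addr0; apply/Pi_V0.
by rewrite Pix; split.
Qed.

(** The shear [y |-> y - phi (Pi y)] straightens the graph; it is defined, with its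
    inverse, on all points over the ball. *)
Lemma graph_submanifold : submanifold_dim (\dim V0) M0.
Proof.
pose W := [set y : V | `|Pi y| < rho].
have oW : open W by apply: open_norm_lt; exact: linear_rV_continuous.
have sphiP k : Ck_on k W (phi \o Pi).
  by apply: (Ck_comp oW graph_open _ (Ck_linear _ _ Pi) (sphi k)).
have PW y : W y -> Pi (phi (Pi y)) = 0 by move=> Wy; exact: Pphi.
move=> p Mp; have [_ Op _] := graph_proj Mp.
exists W, W, (fun y => y - phi (Pi y)), (fun z => z + phi (Pi z)), V0; split=> //.
- split; apply: smooth_on_Ck => // k; apply: Ck_add => //; try exact: Ck_id.
  by apply: Ck_opp => //; exact: sphiP.
- split=> y Wy.
    have E : Pi (y - phi (Pi y)) = Pi y by rewrite linearB PW// subr0.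
    by rewrite /W /= E subrK.
  have E : Pi (y + phi (Pi y)) = Pi y by rewrite linearD PW// addr0.
  by rewrite /W /= E addrK.
- move=> y Wy; split=> [/graph_proj[yV0 _ E]|yV0].
    by rewrite {1}E addrK.
  have E : Pi y = y - phi (Pi y).
    by move/Pi_V0: yV0; rewrite linearB PW// subr0.
  exists (Pi y); last by rewrite {1}E subrK.
  by split=> //=; rewrite E.
Qed.

(** A curve in the graph is determined by its projection, and [phi] contributes
    nothing to its velocity at [0] as its differential vanishes there. *)
Lemma graph_tangent : tangent_space M0 0 = [set x | x \in V0].
Proof.
have dphi : differentiable phi 0 by apply: (sphi 1%N).1; exact: graph_zero.
have id_derive (v : V) : is_derive (0 : R) (1 : R) (fun s : R => s *: v) v.
  have d1 : differentiable (fun s : R => s *: v) (0 : R) by [].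
  apply: DeriveDef; first exact: diff_derivable.
  by rewrite deriveE// diff_val scale1r.
apply/seteqP; split=> v /=.
  move=> [e [gamma [e0 sg g0 Mg ->]]].
  have e00 : `]- e, e[%classic (0 : R) by rewrite /= in_itv /= oppr_lt0 e0.
  have [B [g [oB B0 gC gE]]] := sg 0 e00.
  have nI : \forall s \near (0 : R), `]- e, e[%classic s.
    by apply: open_nbhs_nbhs; split=> //; exact: itv_open.
  have nB : \forall s \near (0 : R), B s by exact: open_nbhs_nbhs.
  have ng : \forall s \near (0 : R), g s = gamma s.
    by apply: filterS2 nI nB => s sI sB; symmetry; apply: gE; rewrite inE.
  have dg : derivable g (0 : R) 1 by apply: diff_derivable; exact: (gC 1%N).1.
  have Dg : is_derive (0 : R) 1 gamma ('D_1 gamma 0).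
    apply: DeriveDef; [exact: near_eq_derivable ng dg|by []].
  rewrite derive1E; set w := 'D_1 gamma 0 in Dg *.
  have cP : continuous Pi by exact: linear_rV_continuous.
  have DP := is_derive_linear_comp cP Dg.
  have dphi' : differentiable phi ((Pi \o gamma) 0) by rewrite /= g0 linear0.
  have Dphi := is_derive_diff_comp dphi' DP.
  have Dphi0 : 'd phi ((Pi \o gamma) 0) (Pi w) = 0.
    have -> : (Pi \o gamma) 0 = 0 by rewrite /= g0 linear0.
    exact: dphi0.
  have [_ E] := is_deriveD DP Dphi.
  apply/Pi_V0; rewrite -[LHS]addr0 -Dphi0 -E; apply: near_eq_derive.
  apply: filterS nI => s sI; have [_ _ E2] := graph_proj (Mg s sI).
  by rewrite [RHS]E2.
move=> vV0; pose e := rho / (`|v| + 1).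
have v1 : 0 < `|v| + 1 by rewrite ltr_wpDl.
have e0 : 0 < e by rewrite divr_gt0.
have sO s : `]- e, e[%classic s -> O (s *: v).
  rewrite /= in_itv /= -ltr_norml => se; rewrite normrZ.
  apply: (@le_lt_trans _ _ (`|s| * (`|v| + 1))); first by rewrite ler_wpM2l// lerDl.
  by rewrite -ltr_pdivlMr.
have oI : open (`]- e, e[%classic : set R^o) by exact: itv_open.
exists e, (fun s => s *: v + phi (s *: v)); split=> //.
- have sv k : Ck_on k (`]- e, e[%classic : set R^o) (fun s : R^o => (s : R) *: v).
    by apply: (Ck_scalel v oI); exact: Ck_id.
  apply: smooth_on_Ck => // k.
  exact: (Ck_comp oI graph_open sO (sv k) (graph_smooth k)).
- by rewrite scale0r phi0 addr0.
- move=> s sI; exists (s *: v) => //; split; first exact: sO.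
  by rewrite /= memvZ.
- rewrite derive1E.
  have dphi' : differentiable phi ((0 : R) *: v) by rewrite scale0r.
  have D := is_derive_diff_comp dphi' (id_derive v).
  have [_ E] := is_deriveD (id_derive v) D.
  have E0 : 'd phi ((0 : R) *: v) v = 0 by rewrite scale0r dphi0.
  by rewrite -[LHS]addr0 -E0 -E.
Qed.

End Graph.

(** * Relative equilibria *)

Section AugmentedHamiltonian.
Variables (R : realType) (G : topGroupType) (T : set G) (t : vectType R) (exp : t -> G).
Hypothesis hexp : lie_algebra_exp T exp.
Variables (n : nat) (act : G -> 'rV[R]_n -> 'rV[R]_n).
Hypothesis hact : representation act.
Local Notation V := 'rV[R]_n.
Variable omega : V -> V -> R.
Hypothesis homega : symplectic_form act omega.
Variable Jm : V -> (R -> G) -> R.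
Hypothesis hJm : momentum_map act omega Jm.
Variable h : V -> R.
Hypothesis hsmooth : smooth_on [set: V] (h : V -> R^o).
Variable X : V -> V.
Hypothesis hX : hamiltonian_vf omega h X.

Lemma exp_line_one_param xi : one_param [set: G] (exp_line exp xi).
Proof. by have [_ H _ _] := hexp; have [c m _] := H xi; split. Qed.

Lemma momentum_diff xi x : differentiable (Jm ^~ (exp_line exp xi) : V -> R^o) x.
Proof. by have [_ H _ _] := hJm (exp_line_one_param xi). Qed.

Lemma augmented_differentiable xi x :
  differentiable (augmented exp Jm h xi : V -> R^o) x.
Proof.
apply: (@differentiableB _ _ _ (h : V -> R^o) (Jm ^~ (exp_line exp xi) : V -> R^o)).
  exact: hamiltonian_diff.
exact: momentum_diff.
Qed.

Lemma augmented_diff xi x v :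
  'd (augmented exp Jm h xi : V -> R^o) x v = omega (X x - lie_act exp act xi x) v.
Proof.
have [[bl br inv] _ nd] := homega.
have [_ _ H _] := hJm (exp_line_one_param xi).
have D := congr1 (fun f => f v) (diffB (hamiltonian_diff hsmooth x) (momentum_diff xi x)).
apply: etrans D _; rewrite (bformBl bl).
exact: (congr2 (fun p q : R => p - q) (hX x v) (H x v)).
Qed.

(** As [omega] is nondegenerate, the kernel of the Hessian is that of [A - xi]. *)
Lemma augmented_d2 xi u v :
  d2 (augmented exp Jm h xi) 0 u v = omega (field_lin X u - lie_act exp act xi u) v.
Proof.
have [[bl br inv] _ nd] := homega.
have dX : differentiable X 0 by exact: (field_diff homega hsmooth hX).
have dZ : differentiable (lie_actL hexp hact xi) 0 by exact: linear_rV_differentiable.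
have dB : differentiable (X - (lie_actL hexp hact xi : V -> V)) 0 by exact: differentiableB.
rewrite /d2 (_ : (fun y => 'D_v (augmented exp Jm h xi) y : R^o) =
    formL bl v \o (X - (lie_actL hexp hact xi : V -> V))); last first.
  apply/funext => y; apply: etrans (augmented_diff xi y v).
  exact: (deriveE _ (augmented_differentiable xi y)).
have cv : continuous (formL bl v) by exact: linear_rV_continuous.
apply: etrans (derive_linear_comp u cv dB) _; apply: (congr1 (formL bl v)).
apply: etrans (deriveE _ dB) _; apply: etrans (congr1 (fun f => f u) (diffB dX dZ)) _.
apply: (congr2 (fun p q : V => p - q)); first by [].
apply: etrans (esym (deriveE _ dZ)) _; exact: (derive_linear_rV (lie_actL hexp hact xi)).
Qed.

End AugmentedHamiltonian.

Section FixedVectors.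
Variables (R : realType) (G : topGroupType) (n : nat) (act : G -> 'rV[R]_n -> 'rV[R]_n).
Hypothesis hact : representation act.
Local Notation V := 'rV[R]_n.

Definition isotropy_fixed (x : V) : set V :=
  [set u | forall k, act k x = x -> act k u = u].

Lemma isotropy_fixed_lin_sub x : lin_sub (isotropy_fixed x).
Proof.
split=> [k _|c u v Eu Ev k kx]; first exact: (linear0 (actL hact k)).
by rewrite -[act k _]/(actL hact k _) linearP /= Eu// Ev.
Qed.

Lemma isotropy_fixed_closed x : closed (isotropy_fixed x).
Proof.
have -> : isotropy_fixed x = \bigcap_(k in isotropy act x) [set u | actL hact k u - u = 0].
  apply/seteqP; split=> u /= H k kx; first by rewrite /= (H k kx) subrr.
  by apply/eqP; rewrite -subr_eq0; apply/eqP; exact: (H k kx).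
apply: closed_bigI => k _.
pose L : {linear V -> V} := actL hact k \- idfun.
rewrite (_ : mkset _ = L @^-1` [set 0])//.
apply: closed_comp; first by move=> u _; exact: linear_rV_continuous.
exact/accessible_closed_set1/hausdorff_accessible/norm_hausdorff.
Qed.

End FixedVectors.

Theorem theorem2p13 (R : realType) (G : topGroupType)
    (hG : lie_group R G) (hGcompact : compact [set: G])
    (hGconnected : connected [set: G])
    (T : set G) (hT : maximal_torus R T)
    (t : vectType R) (exp : t -> G) (hexp : lie_algebra_exp T exp)
    (n : nat) (act : G -> 'rV[R]_n -> 'rV[R]_n) (hact : representation act)
    (omega : 'rV[R]_n -> 'rV[R]_n -> R) (homega : symplectic_form act omega)
    (Jm : 'rV[R]_n -> (R -> G) -> R) (hJm : momentum_map act omega Jm)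
    (h : 'rV[R]_n -> R)
    (hsmooth : smooth_on [set: 'rV[R]_n] (h : 'rV[R]_n -> R^o))
    (hinv : forall g x, h (act g x) = h x)
    (hcrit : forall v : 'rV[R]_n, 'd (h : 'rV[R]_n -> R^o) 0 v = 0)
    (X : 'rV[R]_n -> 'rV[R]_n) (hX : hamiltonian_vf omega h X)
    (ip : 'rV[R]_n -> 'rV[R]_n -> R) (J H : 'End('rV[R]_n))
    (Vc : {vspace 'rV[R]_n}) (r : nat) (U : 'I_r -> {vspace 'rV[R]_n})
    (c : 'I_r -> R)
    (hGC : GC act omega ip h X J H Vc U c)
    (hNR : NR' act exp J U c)
    (xi : t) (V0 : {vspace 'rV[R]_n})
    (hV0 : forall u, u \in V0 <->
       forall v, d2 (augmented exp Jm h xi) 0 u v = 0)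
    (hweights : exists2 s : seq 'Hom(t, R^o),
       weights_with_mult act exp J V0 s & free s) :
  exists (O : set 'rV[R]_n) (m : 'rV[R]_n -> 'rV[R]_n),
    let N := O `&` [set x | x \in V0] in
    let M0 := m @` N in
    [/\ [/\ open O, O 0 & smooth_on N m],
        submanifold M0 /\ (forall y, M0 y -> T_relative_equilibrium exp Jm h y),
        M0 0,
        tangent_space M0 0 = [set x | x \in V0] &
        forall x, N x -> isotropy act (m x) = isotropy act x].
Proof.
have hip := GC_inner_product hGC; have omegaE := GC_omega hGC.
have [[bl br inv] alt nd] := homega.
have [s [vs [szv bV0 ws']] fs] := hweights.
have ws i : (i < size s)%N -> weight_vector act exp J s`_i vs`_i by move=> /ws'[].
have vs0 i : (i < size s)%N -> vs`_i != 0.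
  move=> hi; apply: (free_not0 (X := vs ++ map J vs)); first exact: basis_free bV0.
  by rewrite mem_cat mem_nth// szv.
pose A := field_lin X.
have V0E u : u \in V0 <-> A u = lie_act exp act xi u.
  split=> [/hV0 H0|E].
    apply/eqP; rewrite -subr_eq0; apply/eqP/nd => v.
    by rewrite -(augmented_d2 hexp hact homega hJm hsmooth hX).
  apply/hV0 => v; rewrite (augmented_d2 hexp hact homega hJm hsmooth hX).
  by rewrite -/A E subrr (bform0l bl).
have [eta etaE] := weight_generators fs.
pose k := size s.
pose N (i : 'I_k) := lie_actL hexp hact (eta i).
pose Z0 := lie_actL hexp hact xi.
pose gen (l : 'rV[R]_k) : t := xi + \sum_j l 0 j *: eta j.
have zetaE l x : gen_act Z0 N l x = lie_act exp act (gen l) x.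
  rewrite /gen (lie_actD hexp hact); congr (_ + _).
  have S (q : seq 'I_k) : lie_act exp act (\sum_(j <- q) l 0 j *: eta j) x =
      \sum_(j <- q) l 0 j *: N j x.
    elim: q => [|j q IH]; last first.
      by rewrite !big_cons (lie_actD hexp hact) (lie_actZ hexp hact) IH.
    rewrite !big_nil -[LHS](_ : lie_act exp act ((0 : R) *: (0 : t)) x = _); last by rewrite scale0r.
    by rewrite (lie_actZ hexp hact) scale0r.
  exact/esym/S.
pose a : 'I_k -> {linear 'rV[R]_n -> R^o} := weight_coord hip vs.
pose b : 'I_k -> {linear 'rV[R]_n -> R^o} := weight_coordJ hip J vs.
pose v : 'I_k -> 'rV[R]_n := weight_vec vs.
pose w : 'I_k -> 'rV[R]_n := weight_vecJ J vs.
have av i j : a i (v j) = (i == j)%:R by exact: (weight_coord_vec hexp hact homega hip omegaE fs ws vs0).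
have aw i j : a i (w j) = 0 by exact: (weight_coord_vecJ hexp hact homega hip omegaE fs ws).
have bv i j : b i (v j) = 0 by exact: (weight_coordJ_vec hexp hact homega hip omegaE fs ws).
have bw i j : b i (w j) = (i == j)%:R by exact: (weight_coordJ_vecJ hexp hact homega hip omegaE fs ws vs0).
have inV0 x : x \in V0 = (x \in <<vs ++ map J vs>>%VS) by rewrite (span_basis bV0).
have V0P x : x \in V0 <-> plane_projL a b v w x = x.
  rewrite inV0; split=> [|<-].
    exact: (plane_proj_span hexp hact homega hip omegaE szv fs ws vs0).
  exact: (plane_proj_in_span hip J szv).
have vV0 j : v j \in V0.
  by rewrite inV0; apply: memv_span; rewrite mem_cat mem_nth// szv.
have wV0 j : w j \in V0.
  rewrite inV0; apply: memv_span; rewrite mem_cat; apply/orP; right.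
  by apply: map_f; rewrite mem_nth// szv.
pose mu (j : 'I_k) : R := 2 * pi * s`_j xi.
have rZ : rotates a b v w Z0 mu by exact: (lie_rotates hexp hact homega hip omegaE fs ws).
(* [A] agrees with [xi] on [V0] and is skew, hence commutes with the projections *)
have rA : rotates a b v w A mu.
  apply: (A_rotates hexp hact homega hip omegaE fs ws).
  - exact: (lin_skew homega hsmooth hX).
  - by move=> j; apply/V0E; exact: vV0.
  - by move=> j; apply/V0E; exact: wV0.
have rN i : rotates a b v w (N i) (fun j => (i == j)%:R).
  have := lie_rotates hexp hact homega hip omegaE fs ws (eta i); congr rotates.
  by apply/funext => j; rewrite etaE eq_sym.
have kerB x : A x = Z0 x -> plane_proj a b v w x = x by move=> E; apply/V0P/V0E.
have X0 := field0 homega hcrit hX.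
have Xact g x := field_equivariant hact homega hsmooth hinv hX g x.
have Aact g x : A (act g x) = act g (A x).
  exact: (lin_act hact homega hsmooth hinv hX).
have radial y l j : plane_proj a b v w (X y - gen_act Z0 N l y) = X y - gen_act Z0 N l y ->
    a j (X y - gen_act Z0 N l y) * a j y + b j (X y - gen_act Z0 N l y) * b j y = 0.
  rewrite zetaE => Pr.
  have orth : omega (X y) (lie_act exp act (eta j) y) = 0.
    rewrite -hX; apply: (lie_act_invariant hexp hact (f := h)) => //.
    exact: hamiltonian_diff.
  have := weights_radial hexp hact homega omegaE fs ws vs0 etaE orth Pr.
  exact.
(* frequencies below [eps] are needed at [m x], where the projection must preserve
   the vectors fixed by its isotropy group *)
have [eps eps0 Pst] := plane_proj_stable av aw bv bw rA rZ rN kerB.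
have dXA x : 'd X 0 x = A x by [].
have [rho [phi [lam [rho0 sphi [phi0 dphi0] phiP phiE]]]] :=
  planar_reduction av aw bv bw rA rZ rN kerB (field_smooth homega hsmooth hX) X0 dXA radial eps0.
have Pphi x : `|x| < rho -> plane_projL a b v w (phi x) = 0 by move=> /phiP[].
have NE x : x \in V0 -> plane_proj a b v w x = x by move=> /V0P.
exists [set x | `|x| < rho], (fun x => x + phi x); split.
- split; [exact: graph_open|exact: graph_zero|].
  move=> x [xr _]; exists [set x | `|x| < rho], (fun x => x + phi x); split=> //.
    exact: graph_open.
  by move=> m; exact: graph_smooth.
- split; first by exists (\dim V0); exact: (graph_submanifold V0P sphi Pphi).
  move=> _ [x [xr xV0] <-]; exists (gen (lam x)) => u.
  have [_ _] := phiP x xr; rewrite (NE _ xV0) => E.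
  by rewrite (augmented_diff hexp homega hJm hsmooth hX) E zetaE subrr (bform0l bl).
- by exists 0; [split; [exact: graph_zero|exact: mem0v]|rewrite phi0 addr0].
- exact: (graph_tangent V0P rho0 sphi Pphi phi0 dphi0).
move=> x [xr xV0]; have Px := NE _ xV0.
have [Pphix lamx] := phiP x xr; rewrite Px zetaE => Xm.
have fixL y g u : isotropy_fixed act y u -> act g y = y -> act g u = u by move=> + gy; apply.
have EA y u : isotropy_fixed act y u -> isotropy_fixed act y (A u).
  by move=> Eu g gy; rewrite -Aact Eu.
have EX y u : isotropy_fixed act y u -> isotropy_fixed act y (X u).
  by move=> Eu g gy; rewrite -Xact Eu.
have Ey y : isotropy_fixed act y y by [].
have Ez y l : isotropy_fixed act y (gen_act Z0 N l y) ->
    forall u, isotropy_fixed act y u -> isotropy_fixed act y (gen_act Z0 N l u).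
  rewrite zetaE => Ez u Eu; rewrite zetaE.
  exact: (lie_act_isotropy hexp hact hGcompact Ez Eu).
have lE y := isotropy_fixed_lin_sub hact y.
apply/seteqP; split=> g /= gx.
- pose y := x + phi x.
  (* the group of [y] fixes [zeta y = X y], hence the projection [x] of [y] *)
  have Ezy : isotropy_fixed act y (gen_act Z0 N (lam x) y) by rewrite zetaE -Xm; exact: EX.
  have Py : plane_proj a b v w y = x.
    by rewrite -[LHS]/(plane_projL a b v w y) linearD /= Px Pphix addr0.
  have : isotropy_fixed act y (plane_proj a b v w y).
    exact: (Pst (lam x) _ lamx (lE y) (EA y) (Ez y (lam x) Ezy)).
  by rewrite Py; exact.
- have Ex : isotropy_fixed act x (gen_act Z0 N 0 x).
    (* the generator [xi] acts on [x] as [A], which is equivariant *)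
    have -> : gen_act Z0 N 0 x = A x.
      rewrite zetaE /gen big1 ?addr0; last by move=> j _; rewrite mxE scale0r.
      by symmetry; apply/V0E.
    exact: EA.
  have EP u : isotropy_fixed act x u -> isotropy_fixed act x (plane_proj a b v w u).
    have l0 : `|0 : 'rV[R]_k| < eps by rewrite normr0.
    exact: (Pst 0 _ l0 (lE x) (EA x) (Ez x 0 Ex)).
  have Ephi : isotropy_fixed act x (phi x).
    have Ezx l : isotropy_fixed act x (gen_act Z0 N l (plane_proj a b v w x)) ->
        forall u, isotropy_fixed act x u -> isotropy_fixed act x (gen_act Z0 N l u).
      by rewrite Px; exact: Ez.
    have EPx : isotropy_fixed act x (plane_proj a b v w x) by rewrite Px.
    exact: (phiE x _ xr (isotropy_fixed_closed hact (x := x)) (lE x) (EA x) EP (EX x) Ezx EPx).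
  apply: etrans (linearD (actL hact g) x (phi x)) _.
  exact: (congr2 +%R gx (Ephi g gx)).
Qed.
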